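(* For every $s\in[0,1]$, $N\in\frac12\mathbb Z\setminus\{0\}$ and $a\in\mathcal A(S^2_{qs})$, the residue at $z=2$ of (the meromorphic extension of) $\zeta_a(z)=\mathrm{Tr}_{\mathcal H}(a|D|^{-z})$ is $${\int\!\!\!\!\!-}\; a|D|^{-2}:=\mathrm{Res}_{z=2}\,\zeta_a(z)=\frac2\pi\int_{S^1}\sigma_s(a)(\theta)\,d\theta .$$ For $s=0$, $\sigma_0(a)\in\mathbb C$ is constant and the right-hand side equals $4\,\sigma_0(a)$.
   Context: Fix $0<q<1$; $[x]=(q^x-q^{-x})/(q-q^{-1})$. For $0\le s\le1$, $\mathcal A(S^2_{qs})$ is the unital $*$-algebra generated by $A=A^*,B,B^*$ with relations $AB=q^2BA$, $BB^*+(A+s^2)(A-1)=0$, $B^*B+(q^2A+s^2)(q^2A-1)=0$ (Podle\'s sphere). Let $\mathcal A(S^1)$ be the polynomial $*$-algebra generated by the function $u(\theta)=e^{i\theta}$, and let $\sigma_s:\mathcal A(S^2_{qs})\to\mathcal A(S^1)$ be the $*$-algebra morphism with $\sigma_s(A)=0$, $\sigma_s(B)=su$. For nonzero $M\in\frac12\mathbb Z$ let $\mathcal H_M$ be the Hilbert space with orthonormal basis $|l,m;M\rangle$, $l-|M|\in\mathbb N$, $m\in\{-l,-l+1,\dots,l\}$. Put $x_1=(q[2])^{1/2}B$, $x_0=1-s^2-q[2]A$. The $*$-representation of $\mathcal A(S^2_{qs})$ on $\mathcal H_M$ is $$x_1|l,m;M\rangle=q^{-l+m}\sqrt{[l+m+1][l+m+2]}\,\alpha_{M,l+1}|l+1,m+1;M\rangle-q^{m+2}\sqrt{[2][l-m][l+m+1]}\,\beta_{M,l}|l,m+1;M\rangle-q^{l+m+1}\sqrt{[l-m][l-m-1]}\,\alpha_{M,l}|l-1,m+1;M\rangle,$$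 $$x_0|l,m;M\rangle=q^m\sqrt{[2][l-m+1][l+m+1]}\,\alpha_{M,l+1}|l+1,m;M\rangle+\big([2l]-q^{l+m+1}[2][l-m]\big)\beta_{M,l}|l,m;M\rangle+q^m\sqrt{[2][l-m][l+m]}\,\alpha_{M,l}|l-1,m;M\rangle,$$ with terms involving vectors outside the index set omitted, where $$\alpha_{M,l}=\frac1{[2l]}\sqrt{\frac{[2][l+M][l-M]}{[2l-1][2l+1]}}\sqrt{(q^{l+M}+q^{-(l+M)}s^2)(q^{l-M}s^2+q^{-(l-M)})},$$ $$\beta_{M,l}=\frac{([2l]-q^{l+M+1}[2][l-M])(1-s^2)+q[2][2M]s^2}{q^2[2l][2l+2]}.$$ Fix $N\in\frac12\mathbb Z$, $N\ne0$. Let $\mathcal H=\mathcal H_{-N}\oplus\mathcal H_N$ and let $D$ be the self-adjoint operator with $D|l,m;\pm N\rangle=(l-|N|+1)|l,m;\mp N\rangle$, so $|D|\,|l,m;\pm N\rangle=(l-|N|+1)|l,m;\pm N\rangle$. *)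

(* Defs.v *)
From HB Require Import structures.
From mathcomp Require Import all_boot all_order all_algebra.
From mathcomp Require Import sesquilinear finmap generic_quotient.
From mathcomp Require Import all_classical all_reals all_analysis.
From mathcomp Require summability.
From mathcomp Require Import complex.

Set Implicit Arguments.
Unset Strict Implicit.
Unset Printing Implicit Defensive.

Import Order.TTheory GRing.Theory Num.Theory.
Import numFieldNormedType.Exports.

Local Open Scope classical_set_scope.
Local Open Scope ring_scope.
Local Open Scope complex_scope.
Local Open Scope quotient_scope.

(** The algebra of the Podles sphere [S^2_qs] consists of the noncommutative
    *-polynomials in [A = A^*], [B], [B^*], modulo the smallest *-algebra
    congruence containing the defining relations (the last three constructors
    of [peq]). The other relations of the presentation, such as
    [B^* A = q^2 A B^*], follow by [peq_star]. *)

Inductive pterm (R : Type) : Type :=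
| TA | TB | TBs
| TCst of R[i]
| TAdd of pterm R & pterm R
| TMul of pterm R & pterm R.
Arguments TA {R}.
Arguments TB {R}.
Arguments TBs {R}.

HB.instance Definition _ (R : Type) := gen_eqMixin (pterm R).
HB.instance Definition _ (R : Type) := gen_choiceMixin (pterm R).

Fixpoint tstar (R : realType) (t : pterm R) : pterm R :=
  match t with
  | TA => TA
  | TB => TBs
  | TBs => TB
  | TCst c => TCst (Num.conj c)
  | TAdd x y => TAdd (tstar x) (tstar y)
  | TMul x y => TMul (tstar y) (tstar x)
  end.

Inductive peq (R : realType) (q s : R) : pterm R -> pterm R -> Prop :=
| peq_refl x : peq q s x x
| peq_sym x y : peq q s x y -> peq q s y x
| peq_trans x y z : peq q s x y -> peq q s y z -> peq q s x z
| peq_add x x' y y' :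
    peq q s x x' -> peq q s y y' -> peq q s (TAdd x y) (TAdd x' y')
| peq_mul x x' y y' :
    peq q s x x' -> peq q s y y' -> peq q s (TMul x y) (TMul x' y')
| peq_star x y : peq q s x y -> peq q s (tstar x) (tstar y)
| peq_addA x y z : peq q s (TAdd x (TAdd y z)) (TAdd (TAdd x y) z)
| peq_addC x y : peq q s (TAdd x y) (TAdd y x)
| peq_add0 x : peq q s (TAdd (TCst 0) x) x
| peq_addN x : peq q s (TAdd (TMul (TCst (- 1)) x) x) (TCst 0)
| peq_mulA x y z : peq q s (TMul x (TMul y z)) (TMul (TMul x y) z)
| peq_mul1 x : peq q s (TMul (TCst 1) x) x
| peq_mulDl x y z : peq q s (TMul (TAdd x y) z) (TAdd (TMul x z) (TMul y z))
| peq_mulDr x y z : peq q s (TMul x (TAdd y z)) (TAdd (TMul x y) (TMul x z))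
| peq_cstD c d : peq q s (TCst (c + d)) (TAdd (TCst c) (TCst d))
| peq_cstM c d : peq q s (TCst (c * d)) (TMul (TCst c) (TCst d))
| peq_cstC c x : peq q s (TMul (TCst c) x) (TMul x (TCst c))
| peq_AB : peq q s (TMul TA TB) (TMul (TCst (q ^+ 2)%:C) (TMul TB TA))
| peq_BBs :
    peq q s (TAdd (TMul TB TBs)
               (TMul (TAdd TA (TCst (s ^+ 2)%:C)) (TAdd TA (TCst (- 1)))))
      (TCst 0)
| peq_BsB :
    peq q s (TAdd (TMul TBs TB)
               (TMul (TAdd (TMul (TCst (q ^+ 2)%:C) TA) (TCst (s ^+ 2)%:C))
                     (TAdd (TMul (TCst (q ^+ 2)%:C) TA) (TCst (- 1)))))
      (TCst 0).

(** Elements of the circle algebra are functions of the angle. *)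
Definition circle_u (R : realType) (theta : R) : R[i] :=
  cos theta +i* sin theta.

Inductive circle_poly (R : realType) : (R -> R[i]) -> Prop :=
| circle_poly_u : circle_poly (@circle_u R)
| circle_poly_cst c : circle_poly (fun=> c)
| circle_poly_add f g : circle_poly f -> circle_poly g ->
    circle_poly (fun theta => f theta + g theta)
| circle_poly_mul f g : circle_poly f -> circle_poly g ->
    circle_poly (fun theta => f theta * g theta)
| circle_poly_conj f : circle_poly f ->
    circle_poly (fun theta => Num.conj (f theta)).

Fixpoint tsymbol (R : realType) (s : R) (t : pterm R) (theta : R) : R[i] :=
  match t with
  | TA => 0
  | TB => s%:C * circle_u theta
  | TBs => s%:C * Num.conj (circle_u theta)
  | TCst c => c
  | TAdd x y => tsymbol s x theta + tsymbol s y theta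
  | TMul x y => tsymbol s x theta * tsymbol s y theta
  end.

Lemma circle_u_conj (R : realType) (theta : R) :
  circle_u theta * Num.conj (circle_u theta) = 1.
Proof.
apply/eqP; rewrite eq_complex /=; apply/andP; split; apply/eqP.
  by rewrite mulrN opprK -!expr2 cos2Dsin2.
by rewrite mulrN mulrC addNr.
Qed.

Lemma conj_realC (R : realType) (x : R) : Num.conj (x%:C) = x%:C.
Proof. by apply/eqP; rewrite eq_complex /= oppr0 !eqxx. Qed.

Lemma tsymbol_star (R : realType) (s : R) (t : pterm R) (theta : R) :
  tsymbol s (tstar t) theta = Num.conj (tsymbol s t theta).
Proof.
elim: t => //=.
- by rewrite rmorph0.
- by rewrite rmorphM /= conj_realC.
- by rewrite rmorphM /= conj_realC conjCK.
- by move=> x -> y ->; rewrite rmorphD.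
- by move=> x -> y ->; rewrite rmorphM mulrC.
Qed.

Lemma tsymbol_peq (R : realType) (q s : R) (x y : pterm R) :
  peq q s x y -> tsymbol s x = tsymbol s y.
Proof.
have e2 theta : s%:C * circle_u theta * (s%:C * Num.conj (circle_u theta))
    = (s ^+ 2)%:C.
  by rewrite mulrACA circle_u_conj mulr1 -expr2 -rmorphXn.
elim=> //=; try by (move=> *; apply/funext => theta;
    rewrite ?(addrA, addr0, add0r, mulrA, mul1r, mulrDl, mulrDr)).
- by move=> ? ? ? _ -> _ ->.
- by move=> x0 x1 y0 y1 _ e _ e'; apply/funext=> theta; rewrite /= e e'.
- by move=> x0 x1 y0 y1 _ e _ e'; apply/funext=> theta; rewrite /= e e'.
- by move=> x0 y0 _ e; apply/funext=> theta; rewrite !tsymbol_star e.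
- by move=> x0 y0; apply/funext=> theta; rewrite addrC.
- by move=> x0; apply/funext=> theta; rewrite mulN1r addNr.
- by move=> c x0; apply/funext=> theta; rewrite mulrC.
- by apply/funext=> theta; rewrite mul0r !mulr0.
- by apply/funext=> theta; rewrite e2 !add0r mulrN1 addrN.
- apply/funext=> theta; rewrite [X in X + _]mulrC e2 mulr0 !add0r.
  by rewrite mulrN1 addrN.
Qed.

Section Podles.
Variables (R : realType) (q s : R).

Definition peqb (x y : pterm R) : bool := `[< peq q s x y >].

Lemma peqb_refl : reflexive peqb.
Proof. by move=> x; apply/asboolP; exact: peq_refl. Qed.

Lemma peqb_sym : symmetric peqb.
Proof.
by move=> x y; apply/asboolP/asboolP => /peq_sym.
Qed.

Lemma peqb_trans : transitive peqb.
Proof.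
by move=> y x z /asboolP xy /asboolP yz; apply/asboolP; exact: peq_trans xy yz.
Qed.

Canonical peq_equiv := EquivRel peqb peqb_refl peqb_sym peqb_trans.

Definition podles := {eq_quot peq_equiv}.

HB.instance Definition _ := Choice.on podles.
HB.instance Definition _ := Quotient.on podles.

Lemma podlesP (x y : pterm R) : \pi_podles x = \pi_podles y <-> peq q s x y.
Proof.
split=> [/eqquotP/asboolP //|h]; by apply/eqquotP/asboolP.
Qed.

Lemma peq_repr (x : pterm R) : peq q s (repr (\pi_podles x)) x.
Proof. by apply/podlesP; rewrite reprK. Qed.

Definition pcst (c : R[i]) : podles := \pi_podles (TCst c).
Definition padd (a b : podles) : podles := \pi_podles (TAdd (repr a) (repr b)).
Definition pmul (a b : podles) : podles := \pi_podles (TMul (repr a) (repr b)).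
Definition popp (a : podles) : podles := pmul (pcst (- 1)) a.
Definition pscale (c : R[i]) (a : podles) : podles := pmul (pcst c) a.

Definition pstar (a : podles) : podles := \pi_podles (tstar (repr a)).

Definition podA : podles := \pi_podles TA.
Definition podB : podles := \pi_podles TB.

Lemma paddE x y : padd (\pi_podles x) (\pi_podles y) = \pi_podles (TAdd x y).
Proof. by apply/podlesP; apply: peq_add; exact: peq_repr. Qed.

Lemma pmulE x y : pmul (\pi_podles x) (\pi_podles y) = \pi_podles (TMul x y).
Proof. by apply/podlesP; apply: peq_mul; exact: peq_repr. Qed.

Lemma pstarE x : pstar (\pi_podles x) = \pi_podles (tstar x).
Proof. by apply/podlesP; apply: peq_star; exact: peq_repr. Qed.

Lemma podlesW (P : podles -> Prop) : (forall x, P (\pi_podles x)) -> forall a, P a.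
Proof. by move=> h a; rewrite -[a]reprK. Qed.

Let paddA : associative padd.
Proof.
elim/podlesW=> x; elim/podlesW=> y; elim/podlesW=> z.
by rewrite !paddE; apply/podlesP; exact: peq_addA.
Qed.

Let paddC : commutative padd.
Proof.
elim/podlesW=> x; elim/podlesW=> y.
by rewrite !paddE; apply/podlesP; exact: peq_addC.
Qed.

Let padd0 : left_id (pcst 0) padd.
Proof. by elim/podlesW=> x; rewrite paddE; apply/podlesP; exact: peq_add0. Qed.

Let paddN : left_inverse (pcst 0) popp padd.
Proof.
by elim/podlesW=> x; rewrite /popp pmulE paddE; apply/podlesP; exact: peq_addN.
Qed.

HB.instance Definition _ :=
  GRing.isZmodule.Build podles paddA paddC padd0 paddN.

Let pmulA : associative pmul.
Proof.
elim/podlesW=> x; elim/podlesW=> y; elim/podlesW=> z.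
by rewrite !pmulE; apply/podlesP; exact: peq_mulA.
Qed.

Let pmul1l : left_id (pcst 1) pmul.
Proof. by elim/podlesW=> x; rewrite pmulE; apply/podlesP; exact: peq_mul1. Qed.

Let pmul1r : right_id (pcst 1) pmul.
Proof.
elim/podlesW=> x; rewrite pmulE; apply/podlesP.
by apply: peq_trans (peq_mul1 q s x); apply: peq_sym; exact: peq_cstC.
Qed.

Let pmulDl : left_distributive pmul padd.
Proof.
elim/podlesW=> x; elim/podlesW=> y; elim/podlesW=> z.
by rewrite !(pmulE, paddE); apply/podlesP; exact: peq_mulDl.
Qed.

Let pmulDr : right_distributive pmul padd.
Proof.
elim/podlesW=> x; elim/podlesW=> y; elim/podlesW=> z.
by rewrite !(pmulE, paddE); apply/podlesP; exact: peq_mulDr.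
Qed.

Let pcst1_neq0 : pcst 1 != pcst 0.
Proof.
apply/eqP => /podlesP /tsymbol_peq /(congr1 (fun f => f 0)) /= /eqP.
by rewrite oner_eq0.
Qed.

HB.instance Definition _ := GRing.Zmodule_isNzRing.Build podles
  pmulA pmul1l pmul1r pmulDl pmulDr pcst1_neq0.

Let pcstM c d : pcst (c * d) = pmul (pcst c) (pcst d).
Proof. by rewrite pmulE; apply/podlesP; exact: peq_cstM. Qed.

Let pcstD c d : pcst (c + d) = padd (pcst c) (pcst d).
Proof. by rewrite paddE; apply/podlesP; exact: peq_cstD. Qed.

Let pcstC c a : pmul (pcst c) a = pmul a (pcst c).
Proof.
by move: a; elim/podlesW=> x; rewrite !pmulE; apply/podlesP; exact: peq_cstC.
Qed.

Let pscaleA c d a : pscale c (pscale d a) = pscale (c * d) a.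
Proof. by rewrite /pscale pcstM pmulA. Qed.

Let pscale1 : left_id 1 pscale. Proof. exact: pmul1l. Qed.

Let pscaleDr : right_distributive pscale +%R.
Proof. by move=> c a b; exact: pmulDr. Qed.

Let pscaleDl a : {morph pscale^~ a : c d / c + d}.
Proof. by move=> c d; rewrite /pscale pcstD; exact: pmulDl. Qed.

HB.instance Definition _ := GRing.Zmodule_isLmodule.Build R[i] podles
  pscaleA pscale1 pscaleDr pscaleDl.

Let pscaleAl c (a b : podles) : c *: (a * b) = (c *: a) * b.
Proof. exact: pmulA. Qed.

HB.instance Definition _ :=
  GRing.LSemiModule_isLSemiAlgebra.Build R[i] podles pscaleAl.

Let pscaleAr c (a b : podles) : c *: (a * b) = a * (c *: b).
Proof.
change (pmul (pcst c) (pmul a b) = pmul a (pmul (pcst c) b)).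
by rewrite !pmulA pcstC.
Qed.

HB.instance Definition _ :=
  GRing.LSemiAlgebra_isSemiAlgebra.Build R[i] podles pscaleAr.

Lemma pi_TCst c : \pi_podles (TCst c) = c *: (1 : podles).
Proof.
by rewrite -[RHS]/(pmul (pcst c) (pcst 1)) -pcstM mulr1.
Qed.

Lemma pi_TAdd x y : \pi_podles (TAdd x y) = \pi_podles x + \pi_podles y.
Proof. by rewrite -paddE. Qed.

Lemma pi_TMul x y : \pi_podles (TMul x y) = \pi_podles x * \pi_podles y.
Proof. by rewrite -pmulE. Qed.

Lemma tstarK (x : pterm R) : tstar (tstar x) = x.
Proof. by elim: x => //= [c|x -> y ->|x -> y ->] //; rewrite conjCK. Qed.

Lemma pstarK : involutive pstar.
Proof. by elim/podlesW=> x; rewrite !pstarE tstarK. Qed.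

Lemma pstarD (a b : podles) : pstar (a + b) = pstar a + pstar b.
Proof.
move: a b; elim/podlesW=> x; elim/podlesW=> y.
by rewrite -pi_TAdd !pstarE /= pi_TAdd.
Qed.

Lemma pstarM (a b : podles) : pstar (a * b) = pstar b * pstar a.
Proof.
move: a b; elim/podlesW=> x; elim/podlesW=> y.
by rewrite -pi_TMul !pstarE /= pi_TMul.
Qed.

Lemma pstarZ c (a : podles) : pstar (c *: a) = Num.conj c *: pstar a.
Proof.
by rewrite -[a in LHS]mul1r scalerAl -pi_TCst pstarM pstarE /= pi_TCst
  -scalerAr mulr1.
Qed.

Lemma pstar_podA : pstar podA = podA.
Proof. by rewrite /podA pstarE. Qed.

Lemma pi_TBs : \pi_podles TBs = pstar podB.
Proof. by rewrite /podB pstarE. Qed.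

Lemma podles_AB : podA * podB = (q ^+ 2)%:C *: (podB * podA).
Proof.
rewrite /podA /podB -!pi_TMul -[X in _ *: X]mul1r scalerAl -pi_TCst -pi_TMul.
by apply/podlesP; exact: peq_AB.
Qed.

Lemma podles_BBs :
  podB * pstar podB + (podA + ((s ^+ 2)%:C)%:A) * (podA - 1) = 0.
Proof.
have -> : podA - 1 = podA + (- 1)%:A :> podles by rewrite scaleN1r.
have -> : 0 = \pi_podles (TCst 0) by rewrite pi_TCst scale0r.
rewrite -pi_TBs /podA /podB -!pi_TCst -!(pi_TAdd, pi_TMul).
by apply/podlesP; exact: peq_BBs.
Qed.

Lemma podles_BsB :
  pstar podB * podB + ((q ^+ 2)%:C *: podA + ((s ^+ 2)%:C)%:A)
    * ((q ^+ 2)%:C *: podA - 1) = 0.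
Proof.
have /podlesP := peq_BsB q s.
rewrite !(pi_TAdd, pi_TMul, pi_TCst) pi_TBs scale0r => e; rewrite -[RHS]e.
by rewrite scaleN1r -!scalerAl !mul1r.
Qed.

End Podles.

Arguments podA {R q s}.
Arguments podB {R q s}.

(** [sigma_s]: the unique *-morphism with [A |-> 0] and [B |-> s u]. *)
Section CircleSymbol.
Variables (R : realType) (q s : R).
Implicit Types a b : podles q s.

Definition circle_symbol a : R -> R[i] := tsymbol s (repr a).

Lemma circle_symbolE (x : pterm R) :
  circle_symbol (\pi_(podles q s) x) = tsymbol s x.
Proof. exact/tsymbol_peq/peq_repr. Qed.

Lemma circle_symbol_poly a : circle_poly (circle_symbol a).
Proof.
rewrite /circle_symbol; elim: (repr a) => /=.
- exact: circle_poly_cst.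
- by apply: circle_poly_mul; [exact: circle_poly_cst|exact: circle_poly_u].
- apply: circle_poly_mul; first exact: circle_poly_cst.
  by apply: circle_poly_conj; exact: circle_poly_u.
- exact: circle_poly_cst.
- by move=> x hx y hy; exact: circle_poly_add.
- by move=> x hx y hy; exact: circle_poly_mul.
Qed.

Lemma circle_symbolA : circle_symbol podA = fun=> 0.
Proof. by rewrite circle_symbolE. Qed.

Lemma circle_symbolB :
  circle_symbol podB = fun theta => s%:C * circle_u theta.
Proof. by rewrite circle_symbolE. Qed.

Lemma circle_symbol1 : circle_symbol 1 = fun=> 1.
Proof. by rewrite circle_symbolE. Qed.

Lemma circle_symbolD a b : circle_symbol (a + b) =
  fun theta => circle_symbol a theta + circle_symbol b theta.
Proof.
move: a b; elim/podlesW=> x; elim/podlesW=> y.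
by rewrite -pi_TAdd !circle_symbolE.
Qed.

Lemma circle_symbolM a b : circle_symbol (a * b) =
  fun theta => circle_symbol a theta * circle_symbol b theta.
Proof.
move: a b; elim/podlesW=> x; elim/podlesW=> y.
by rewrite -pi_TMul !circle_symbolE.
Qed.

Lemma circle_symbolZ c a : circle_symbol (c *: a) =
  fun theta => c * circle_symbol a theta.
Proof.
by rewrite -[a in LHS]mul1r scalerAl -pi_TCst circle_symbolM circle_symbolE.
Qed.

Lemma circle_symbol_star a : circle_symbol (pstar a) =
  fun theta => Num.conj (circle_symbol a theta).
Proof.
move: a; elim/podlesW=> x; rewrite pstarE !circle_symbolE.
by apply/funext => theta; exact: tsymbol_star.
Qed.

End CircleSymbol.

Definition circle_integral (R : realType) (f : R -> R[i]) : R[i] :=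
  Rintegral lebesgue_measure `[0, 2 * pi] (fun theta => complex.Re (f theta))
  +i* Rintegral lebesgue_measure `[0, 2 * pi] (fun theta => complex.Im (f theta)).

(** Inner products are linear in the first argument. *)
Section Hilbert.
Variables (R : realType) (H : lmodType R[i]) (ip : {dot H for Num.conj}).

Definition dot_complete : Prop :=
  forall u : nat -> H,
    (forall e : R, 0 < e -> exists n, forall i j, (n <= i)%N -> (n <= j)%N ->
      ip (u i - u j) (u i - u j) < e%:C) ->
    exists v, forall e : R, 0 < e -> exists n, forall i, (n <= i)%N ->
      ip (u i - v) (u i - v) < e%:C.

Definition orthonormal_basis (I : eqType) (e : I -> H) : Prop :=
  (forall i j, ip (e i) (e j) = (i == j)%:R) /\
  (forall v, (forall i, ip v (e i) = 0) -> v = 0).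

Definition bounded_op (T : H -> H) : Prop :=
  linear T /\ exists c : R, forall v, ip (T v) (T v) <= c%:C * ip v v.

(** [D], with domain [dom], is densely defined and equal to its adjoint. The
    second clause makes [dom] a subspace, so the first one says that it is
    dense. *)
Definition self_adjoint (dom : set H) (D : H -> H) : Prop :=
  (forall v, (forall x, dom x -> ip x v = 0) -> v = 0) /\
  (forall y w, (dom y /\ D y = w) <->
    (forall x, dom x -> ip (D x) y = ip x w)).

(** [x ^ z] for real [x > 0]. *)
Definition cpow (x : R) (z : R[i]) : R[i] :=
  (expR (complex.Re z * ln x))%:C * circle_u (complex.Im z * ln x).

(** [P] is the bounded operator [|D| ^ z]: when [D (D v) = mu^2 v], i.e.
    [|D| v = mu v], functional calculus gives [P v = mu ^ z v]. This
    determines [P] when [H] has a basis of such eigenvectors with [mu > 0]. *)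
Definition is_abs_power (dom : set H) (D : H -> H) (z : R[i]) (P : H -> H)
    : Prop :=
  bounded_op P /\
  forall (v : H) (mu : R), 0 < mu -> dom v -> dom (D v) ->
    D (D v) = (mu ^+ 2)%:C *: v -> P v = cpow mu z *: v.

(** The unordered sum of the diagonal entries of [T] in the basis [e]
    converges to [t]. *)
Definition has_trace (I : choiceType) (e : I -> H) (T : H -> H) (t : R[i])
    : Prop :=
  summability.partial_sum (fun i => ip (T (e i)) (e i) : R[i]^o)
    @ summability.totally --> (t : R[i]^o).

Definition star_rep (q s : R) (rho : podles q s -> H -> H) : Prop :=
  [/\ forall a, bounded_op (rho a),
      forall v, rho 1 v = v,
      forall c a b v, rho (c *: a + b) v = c *: rho a v + rho b v,
      forall a b v, rho (a * b) v = rho a (rho b v) &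
      forall a v w, ip (rho a v) w = ip v (rho (pstar a) w)].

End Hilbert.

Section Meromorphic.
Variable R : realType.
Implicit Types (F : R[i] -> R[i]) (c : nat -> R[i]).

(** On some punctured disc around [p],
    [F z = \sum_n c n * (z - p) ^ (n - k - 1)]. *)
Definition laurent_at F (p : R[i]) (k : nat) c : Prop :=
  exists2 r : R, 0 < r & forall z : R[i], 0 < `|z - p| < r%:C ->
    series (fun n => c n * (z - p) ^+ n : R[i]^o) @ \oo
      --> ((z - p) ^+ k.+1 * F z : R[i]^o).

Definition meromorphic F : Prop := forall p, exists k c, laurent_at F p k c.

Definition is_residue F (p rho : R[i]) : Prop :=
  exists k c, laurent_at F p k c /\ c k = rho.

End Meromorphic.

Section Podles_rep.
Variables (R : realType) (q s : R).

Definition qnum (x : R) : R := (q `^ x - q `^ (- x)) / (q - q^-1).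
Local Notation "[[ x ]]" := (qnum x).

Definition alpha (M l : R) : R :=
  [[2 * l]]^-1
  * Num.sqrt ([[2]] * [[l + M]] * [[l - M]]
              / ([[2 * l - 1]] * [[2 * l + 1]]))
  * Num.sqrt ((q `^ (l + M) + q `^ (- (l + M)) * s ^+ 2)
              * (q `^ (l - M) * s ^+ 2 + q `^ (- (l - M)))).

Definition beta (M l : R) : R :=
  (([[2 * l]] - q `^ (l + M + 1) * [[2]] * [[l - M]]) * (1 - s ^+ 2)
   + q * [[2]] * [[2 * M]] * s ^+ 2)
  / (q ^+ 2 * [[2 * l]] * [[2 * l + 2]]).

Definition x_1 : podles q s := (Num.sqrt (q * [[2]]))%:C *: podB.
Definition x_0 : podles q s :=
  (1 - s ^+ 2)%:C%:A - (q * [[2]])%:C *: podA.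

(** The pairs [(l, m)] with [l - |N| \in nat] and [m] in
    [{-l, -l + 1, ..., l}]; they are the same for [N] and [- N]. *)
Definition lm_index (N : R) : Type :=
  {lm : R * R | [&& lm.1 - `|N| \is a Num.nat,
                    lm.2 + lm.1 \is a Num.nat & lm.2 <= lm.1]}.

Definition signed (N : R) (b : bool) : R := if b then N else - N.

Section Formulas.
Variables (N : R) (H : lmodType R[i]) (ket : bool * lm_index N -> H).

(** [|l, m; M>] with [M = signed N b], and [0] outside of the index set. *)
Definition ket0 (b : bool) (l m : R) : H :=
  if insub (l, m) is Some i then ket (b, i : lm_index N) else 0.

Definition rep_formulas (rho : podles q s -> H -> H) : Prop :=
  forall (b : bool) (i : lm_index N),
  let M := signed N b in let l := (val i).1 in let m := (val i).2 in
  rho x_1 (ket (b, i)) =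
      (q `^ (- l + m) * Num.sqrt ([[l + m + 1]] * [[l + m + 2]])
        * alpha M (l + 1))%:C *: ket0 b (l + 1) (m + 1)
    - (q `^ (m + 2) * Num.sqrt ([[2]] * [[l - m]] * [[l + m + 1]])
        * beta M l)%:C *: ket0 b l (m + 1)
    - (q `^ (l + m + 1) * Num.sqrt ([[l - m]] * [[l - m - 1]])
        * alpha M l)%:C *: ket0 b (l - 1) (m + 1)
  /\
  rho x_0 (ket (b, i)) =
      (q `^ m * Num.sqrt ([[2]] * [[l - m + 1]] * [[l + m + 1]])
        * alpha M (l + 1))%:C *: ket0 b (l + 1) m
    + (([[2 * l]] - q `^ (l + m + 1) * [[2]] * [[l - m]])
        * beta M l)%:C *: ket0 b l m
    + (q `^ m * Num.sqrt ([[2]] * [[l - m]] * [[l + m]])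
        * alpha M l)%:C *: ket0 b (l - 1) m.

Definition dirac_formula (dom : set H) (D : H -> H) : Prop :=
  forall (b : bool) (i : lm_index N),
    dom (ket (b, i)) /\
    D (ket (b, i)) = ((val i).1 - `|N| + 1)%:C *: ket (~~ b, i).

End Formulas.

End Podles_rep.

(** [F] is a meromorphic function on the complex plane which is
    [z |-> Tr (rho a |D| ^ (- z))] on the half-plane [Re z > 2]. *)
Definition zeta_extension (R : realType) (q s : R) (H : lmodType R[i])
    (ip : {dot H for Num.conj}) (I : choiceType) (e : I -> H)
    (rho : podles q s -> H -> H) (absDpow : R[i] -> H -> H) (a : podles q s)
    (F : R[i] -> R[i]) : Prop :=
  meromorphic F /\
  forall z, 2 < complex.Re z ->
    has_trace ip e (fun v => rho a (absDpow (- z) v)) (F z).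

(* Main.v *)
(** The diagonal of [a |D|^{-z}] is summed level by level, at [l = |N| + n]. The
    algebra is spanned by the monomials [A^j B^k] and [A^j B^{*k}]; those with
    [k > 0] shift the weight [m] and have zero diagonal, while their symbols have
    zero mean. In the coordinates [(n, k = l + m)], [A] acts as a Jacobi matrix along
    the lines [n - k = const], and its entries converge, exponentially fast in [n] and
    uniformly in [k], to limits that decay exponentially in [k]. Hence for [j > 0]
    the trace of [A^j] over level [n] is a constant plus a rapidly decreasing term,
    while for [1] it is [2 (2 n + 2 |N| + 1)]. So the level traces of any [a] are
    [4 c0 (n + 1) + c1 + eps n], with [c0] the mean of the symbol of [a] and [eps]
    rapidly decreasing, and the zeta function of [a] is
    [4 c0 zeta (z - 1) + c1 zeta z] plus an entire function, with residue [4 c0] at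
    [z = 2]. *)
Require Import Defs.
From mathcomp Require Import all_boot all_order all_algebra.
From mathcomp Require Import sesquilinear all_classical all_reals all_analysis.
From mathcomp Require Import complex.
From mathcomp Require Import ring lra zify.

Set Implicit Arguments.
Unset Strict Implicit.
Unset Printing Implicit Defensive.

Import Order.TTheory GRing.Theory Num.Theory.
Import numFieldNormedType.Exports.

Local Open Scope classical_set_scope.
Local Open Scope ring_scope.
Local Open Scope complex_scope.

(** * Series *)

(** The residue is claimed for every meromorphic extension. It is read off locally: 2 lies on the
    boundary of the half-plane where the trace converges, and a Laurent expansion at 2 is determined
    by its values on a real segment to the right of 2. Analyticity is expressed by summable Taylor
    coefficients, and zeta is continued one unit strip at a time, by expanding (n + 2)^(1 - z) in
    powers of 1 / (n + 1). The obstacle in the representation is uniformity. The error in n must be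
    controlled for all k at once, since a level has about 2 n values of k, and the control must
    survive the square roots in the off-diagonal entries, whose radicands can tend to 0. The squared
    entries converge at rate q^(2 n); the square root is only Hoelder continuous of exponent 1/2, so
    the entries converge at rate q^n, which still beats the number of terms. Decay of the limits in
    k then makes the level traces of positive powers of A converge, instead of growing like n. *)

Section RealSums.
Variable R : realType.
Implicit Types (u v : nat -> R) (a : nat -> nat -> R) (M l : R).

Definition rsum u l := series u @ \oo --> l.

Lemma rsum_unique u l l' : rsum u l -> rsum u l' -> l = l'.
Proof. by move=> h h'; apply: (cvg_unique (@Rhausdorff R) h h'). Qed.

Lemma rsumD u v l l' : rsum u l -> rsum v l' -> rsum (fun i => u i + v i) (l + l').
Proof.
move=> h h'; rewrite /rsum.
have -> : series (fun i => u i + v i) = series u + series v.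
  by apply/funext => n; rewrite /series /= big_split.
exact: cvgD.
Qed.

Lemma rsumZ (c : R) u l : rsum u l -> rsum (fun i => c * u i) (c * l).
Proof.
move=> h; rewrite /rsum.
have -> : series (fun i => c * u i) = (fun n => c * series u n).
  by apply/funext => n; rewrite /series /= mulr_sumr.
by apply: cvgM => //; exact: cvg_cst.
Qed.

Lemma rsumB u v l l' : rsum u l -> rsum v l' -> rsum (fun i => u i - v i) (l - l').
Proof.
move=> h h'; have := rsumD h (rsumZ (c := -1) h').
rewrite mulN1r; congr (rsum _ _); apply/funext=> i; by rewrite mulN1r.
Qed.

Lemma rsum_S u l : rsum (fun i => u i.+1) l -> rsum u (u 0%N + l).
Proof.
move=> h; rewrite /rsum -cvg_shiftS.
have -> : [sequence series u n.+1]_n = (fun n => u 0%N + series (fun i => u i.+1) n).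
  by apply/funext => n; rewrite /series /= big_nat_recl.
by apply: cvgD => //; exact: cvg_cst.
Qed.

Lemma rsum_le u l M : rsum u l -> (forall n, series u n <= M) -> l <= M.
Proof.
by move=> h hM; apply: (ler_cvg_to h (cvg_cst M)); near=> n; exact: hM.
Unshelve. all: by end_near. Qed.

Lemma rsum_ge_series u l N : (forall i, 0 <= u i) -> rsum u l -> series u N <= l.
Proof.
move=> u0 h; apply: (ler_cvg_to (cvg_cst (series u N)) h); near=> n.
apply: nondecreasing_series => //; near: n; exact: nbhs_infty_ge.
Unshelve. all: by end_near. Qed.

Lemma rsum_bounded u M : (forall i, 0 <= u i) -> (forall n, series u n <= M) ->
  exists2 l, rsum u l & l <= M.
Proof.
move=> u0 hM; have h : cvgn (series u).
  apply: nondecreasing_is_cvgn; first exact: nondecreasing_series.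
  by exists M => _ [n _ <-]; exact: hM.
by exists (limn (series u)) => //; apply: (rsum_le h).
Qed.

Lemma rsum_sum a (r : nat -> R) N : (forall i, rsum (a i) (r i)) ->
  rsum (fun j => \sum_(0 <= i < N) a i j) (\sum_(0 <= i < N) r i).
Proof.
move=> h; elim: N => [|N IH].
  rewrite big_nil; rewrite /rsum.
  have -> : series (fun j => \sum_(0 <= i < 0) a i j) = (fun=> 0).
    by apply/funext => n; rewrite /series /= big1 // => i _; rewrite big_nil.
  exact: cvg_cst.
rewrite big_nat_recr //=; have := rsumD IH (h N); congr (rsum _ _).
by apply/funext => j; rewrite big_nat_recr.
Qed.

(** A finite sum of columns is the limit of sums over finite rectangles, and each rectangle lies
    below a partial sum of the row totals. *)
Lemma interchange_le a (r c : nat -> R) M : (forall i j, 0 <= a i j) ->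
  (forall i, rsum (a i) (r i)) -> (forall j, rsum (a^~ j) (c j)) ->
  (forall N, series r N <= M) -> forall J, series c J <= M.
Proof.
move=> a0 hr hc hM J.
have := rsum_sum (a := fun j i => a i j) (N := J) hc; move/rsum_le; apply => N.
apply: le_trans (hM N); rewrite /series /=; apply: ler_sum => i _.
by apply: rsum_ge_series.
Qed.

(** Tonelli: [interchange_le] for [a] and for its transpose bounds each total by the other. *)
Lemma rsum_interchange_ge0 a (r c : nat -> R) M : (forall i j, 0 <= a i j) ->
  (forall i, rsum (a i) (r i)) -> (forall j, rsum (a^~ j) (c j)) ->
  (forall N, series r N <= M) -> exists2 S, rsum r S & rsum c S.
Proof.
move=> a0 hr hc hM.
have r0 i : 0 <= r i.
  have := rsum_ge_series 0%N (a0 i) (hr i); by rewrite /series /= big_nil.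
have c0 i : 0 <= c i.
  have := rsum_ge_series 0%N (a0^~ i) (hc i); by rewrite /series /= big_nil.
have [S hS _] := rsum_bounded r0 hM.
have cS : forall n, series c n <= S.
  by apply: (interchange_le a0 hr hc) => N; exact: rsum_ge_series.
have [S' hS' SS'] := rsum_bounded c0 cS.
exists S => //; suff -> : S = S' by [].
apply/eqP; rewrite eq_le SS' andbT; apply: (rsum_le hS) => N.
by apply: (@interchange_le (fun j i => a i j) c r) => // J; exact: rsum_ge_series.
Qed.

(** The series is the difference of those of [|u| + u] and [|u|], which are nonnegative and converge
    by monotonicity. *)
Lemma rsum_abs u M : (forall n, series (fun i => `|u i|) n <= M) ->
  exists2 l, rsum u l & `|l| <= M.
Proof.
move=> hM.
have [l1 h1 l1M] := rsum_bounded (fun i => normr_ge0 (u i)) hM.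
have M0 : forall n, series (fun i => `|u i| + u i) n <= 2 * M.
  move=> n; apply: le_trans (_ : 2 * series (fun i => `|u i|) n <= _).
    rewrite /series /= mulr_sumr; apply: ler_sum => i _.
    by rewrite mulr2n mulrDl mul1r lerD2l ler_norm.
  by rewrite ler_pM2l.
have p0 i : 0 <= `|u i| + u i by rewrite -lerBlDr sub0r -normrN ler_norm.
have [l2 h2 _] := rsum_bounded p0 M0.
have h : rsum u (l2 - l1).
  have := rsumB h2 h1; congr (rsum _ _); apply/funext => i; by rewrite addrC addKr.
exists (l2 - l1) => //; rewrite ler_norml; apply/andP; split.
  rewrite lerNl; have := rsumZ (c := -1) h; rewrite mulN1r => /rsum_le; apply => n.
  apply: le_trans (hM n); rewrite /series /=; apply: ler_sum => i _.
  by rewrite mulN1r -normrN ler_norm.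
apply: (rsum_le h) => n; apply: le_trans (hM n).
by rewrite /series /=; apply: ler_sum => i _; exact: ler_norm.
Qed.

(** Fubini, reduced to the nonnegative case by the splitting [(|a| + a) - |a|]. *)
Lemma rsum_interchange a (r c : nat -> R) M :
  (forall N J, \sum_(0 <= i < N) \sum_(0 <= j < J) `|a i j| <= M) ->
  (forall i, rsum (a i) (r i)) -> (forall j, rsum (a^~ j) (c j)) ->
  exists2 S, rsum r S & rsum c S.
Proof.
move=> hM hr hc.
have rowM i : exists2 l, rsum (fun j => `|a i j|) l & l <= M.
  apply: rsum_bounded => // J; apply: le_trans (hM i.+1 J).
  by rewrite big_nat_recr //= lerDr; do 2! apply: sumr_ge0 => ? _.
have colM j : exists2 l, rsum (fun i => `|a i j|) l & l <= M.
  apply: rsum_bounded => // N; apply: le_trans (hM N j.+1).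
  rewrite /series /=; apply: ler_sum => i _; rewrite big_nat_recr //= lerDr.
  by apply: sumr_ge0 => ? _.
have [r1 hr1] : exists r1, forall i, rsum (fun j => `|a i j|) (r1 i).
  by exists (fun i => s2val (cid2 (rowM i))) => i; case: cid2.
have [c1 hc1] : exists c1, forall j, rsum (fun i => `|a i j|) (c1 j).
  by exists (fun i => s2val (cid2 (colM i))) => i; case: cid2.
have r1M N : series r1 N <= M.
  apply: (rsum_le (rsum_sum (N := N) hr1)) => J; rewrite /series /= exchange_big /=.
  exact: hM.
have [S1 S1r S1c] := rsum_interchange_ge0 (fun i j => normr_ge0 (a i j)) hr1 hc1 r1M.
pose b i j := `|a i j| + a i j.
have b0 i j : 0 <= b i j by rewrite -lerBlDr sub0r -normrN ler_norm.
have hbr i : rsum (b i) (r1 i + r i) by apply: rsumD.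
have hbc j : rsum (b^~ j) (c1 j + c j) by apply: rsumD.
have bM N : series (fun i => r1 i + r i) N <= 2 * M.
  apply: le_trans (_ : 2 * series r1 N <= _); last by rewrite ler_pM2l.
  rewrite /series /= mulr_sumr; apply: ler_sum => i _.
  rewrite mulr2n mulrDl mul1r lerD2l.
  apply: (rsum_le (hr i)) => n; apply: le_trans (rsum_ge_series n _ (hr1 i)) => //.
  by rewrite /series /=; apply: ler_sum => j _; exact: ler_norm.
have [S2 S2r S2c] := rsum_interchange_ge0 b0 hbr hbc bM.
exists (S2 - S1).
  by have := rsumB S2r S1r; congr (rsum _ _); apply/funext => i; rewrite addrC addKr.
by have := rsumB S2c S1c; congr (rsum _ _); apply/funext => i; rewrite addrC addKr.
Qed.

End RealSums.

(** * Complex series: absolute convergence, interchange, Cauchy products *)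

Section ComplexSums.
Variable R : realType.
Local Notation C := R[i].
Implicit Types (u v : nat -> C) (a : nat -> nat -> C) (z w l : C).

(** The norm of [R[i]] takes values in [R[i]]; its real part lets estimates be carried out in the
    ordered field [R]. *)
Definition nrm z : R := complex.Re `|z|.

Lemma nrmE z : `|z| = (nrm z)%:C.
Proof. by rewrite /nrm normc_def. Qed.

Lemma nrm_ge0 z : 0 <= nrm z.
Proof. by rewrite /nrm normc_def /= sqrtr_ge0. Qed.

Lemma nrmM z w : nrm (z * w) = nrm z * nrm w.
Proof. by apply: (@complexI R); rewrite rmorphM /= -!nrmE normrM. Qed.

Lemma nrmX z n : nrm (z ^+ n) = nrm z ^+ n.
Proof. by apply: (@complexI R); rewrite rmorphXn /= -!nrmE normrX. Qed.

Lemma nrmN z : nrm (- z) = nrm z.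
Proof. by rewrite /nrm normrN. Qed.

Lemma nrmV z : nrm z^-1 = (nrm z)^-1.
Proof. by apply: (@complexI R); rewrite fmorphV /= -!nrmE normfV. Qed.

Lemma nrm0 : nrm 0 = 0.
Proof. by rewrite /nrm normr0. Qed.

Lemma nrm1 : nrm 1 = 1.
Proof. by rewrite /nrm normr1. Qed.

Lemma nrmR (x : R) : nrm x%:C = `|x|.
Proof. by rewrite /nrm normc_def /= expr0n addr0 sqrtr_sqr. Qed.

Lemma nrm_eq0 z : (nrm z == 0) = (z == 0).
Proof. by rewrite -(normr_eq0 z) nrmE eq_complex /= eqxx andbT. Qed.

Lemma nrmD z w : nrm (z + w) <= nrm z + nrm w.
Proof. by have := ler_normD z w; rewrite !nrmE -rmorphD /= lecR. Qed.

Lemma nrmB z w : nrm (z - w) <= nrm z + nrm w.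
Proof. by rewrite -(nrmN w) nrmD. Qed.

Lemma nrm_sum I (r : seq I) (P : pred I) (F : I -> C) :
  nrm (\sum_(i <- r | P i) F i) <= \sum_(i <- r | P i) nrm (F i).
Proof.
elim/big_ind2 : _ => //; first by rewrite nrm0.
by move=> x x' y y' h h'; apply: le_trans (nrmD _ _) _; exact: lerD.
Qed.

Lemma nrm_Re z : `|complex.Re z| <= nrm z.
Proof.
rewrite /nrm normc_def /= -sqrtr_sqr ler_sqrt ?lerDl ?sqr_ge0 //.
by rewrite addr_ge0 // sqr_ge0.
Qed.

Lemma nrm_Im z : `|complex.Im z| <= nrm z.
Proof.
rewrite /nrm normc_def /= -sqrtr_sqr ler_sqrt ?lerDr ?sqr_ge0 //.
by rewrite addr_ge0 // sqr_ge0.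
Qed.

Lemma nrm_le_ReIm z : nrm z <= `|complex.Re z| + `|complex.Im z|.
Proof.
rewrite {1}[z]complexE; apply: le_trans (nrmD _ _) _.
by rewrite nrmM !nrmR [nrm 'i]/nrm normc_def /= expr0n expr1n add0r sqrtr1 mul1r.
Qed.

Lemma ReD z w : complex.Re (z + w) = complex.Re z + complex.Re w.
Proof. by case: z w => a b [c d]. Qed.
Lemma ImD z w : complex.Im (z + w) = complex.Im z + complex.Im w.
Proof. by case: z w => a b [c d]. Qed.
Lemma ReN z : complex.Re (- z) = - complex.Re z. Proof. by case: z. Qed.
Lemma ImN z : complex.Im (- z) = - complex.Im z. Proof. by case: z. Qed.
Lemma ReM z w : complex.Re (z * w) =
  complex.Re z * complex.Re w - complex.Im z * complex.Im w.
Proof. by case: z w => a b [c d]. Qed.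
Lemma ImM z w : complex.Im (z * w) =
  complex.Re z * complex.Im w + complex.Im z * complex.Re w.
Proof. by case: z w => a b [c d]. Qed.

Lemma Re_sum I (r : seq I) (P : pred I) (F : I -> C) :
  complex.Re (\sum_(i <- r | P i) F i) = \sum_(i <- r | P i) complex.Re (F i).
Proof. by apply: (big_morph _ ReD). Qed.
Lemma Im_sum I (r : seq I) (P : pred I) (F : I -> C) :
  complex.Im (\sum_(i <- r | P i) F i) = \sum_(i <- r | P i) complex.Im (F i).
Proof. by apply: (big_morph _ ImD). Qed.

Lemma ReIm_eq z w :
  complex.Re z = complex.Re w -> complex.Im z = complex.Im w -> z = w.
Proof. by case: z w => a b [c d] /= -> ->. Qed.

(** Stated on real and imaginary parts so that the results on real double series apply; [csumP]
    gives the usual form. *)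
Definition csum u l :=
  rsum (fun i => complex.Re (u i)) (complex.Re l) /\
  rsum (fun i => complex.Im (u i)) (complex.Im l).

Lemma csum_unique u l l' : csum u l -> csum u l' -> l = l'.
Proof.
by move=> [h1 h2] [h3 h4]; apply: ReIm_eq;
  [exact: rsum_unique h1 h3|exact: rsum_unique h2 h4].
Qed.

Lemma csumD u v l l' : csum u l -> csum v l' -> csum (fun i => u i + v i) (l + l').
Proof.
move=> [h1 h2] [h3 h4]; split.
  by rewrite ReD (_ : (fun i => _) = fun i => complex.Re (u i) + complex.Re (v i));
    [exact: rsumD|apply/funext => i; rewrite ReD].
by rewrite ImD (_ : (fun i => _) = fun i => complex.Im (u i) + complex.Im (v i));
    [exact: rsumD|apply/funext => i; rewrite ImD].
Qed.

Lemma csumZ z u l : csum u l -> csum (fun i => z * u i) (z * l).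
Proof.
move=> [h1 h2]; split.
  rewrite ReM (_ : (fun i => _) = fun i => complex.Re z * complex.Re (u i)
    - complex.Im z * complex.Im (u i)); last by apply/funext => i; rewrite ReM.
  by apply: rsumB; exact: rsumZ.
rewrite ImM (_ : (fun i => _) = fun i => complex.Re z * complex.Im (u i)
    + complex.Im z * complex.Re (u i)); last by apply/funext => i; rewrite ImM.
by apply: rsumD; exact: rsumZ.
Qed.

Lemma csumB u v l l' : csum u l -> csum v l' -> csum (fun i => u i - v i) (l - l').
Proof.
move=> h h'; have := csumD h (csumZ (-1) h').
by rewrite mulN1r; congr (csum _ _); apply/funext => i; rewrite mulN1r.
Qed.

Lemma csum_S u l : csum (fun i => u i.+1) l -> csum u (u 0%N + l).
Proof. by move=> [h1 h2]; split; rewrite ?ReD ?ImD; apply: rsum_S. Qed.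

Lemma csum_shift u l n : csum (fun i => u (i + n)%N) l ->
  csum u (\sum_(0 <= i < n) u i + l).
Proof.
elim: n l => [|n IH] l h.
  rewrite big_nil add0r; move: h; congr (csum _ _).
  by apply/funext => i; rewrite addn0.
rewrite big_nat_recr //= -addrA; apply: IH.
have := @csum_S (fun i => u (i + n)%N) l; rewrite add0n; apply.
by move: h; congr (csum _ _); apply/funext => i; rewrite addnS addSn.
Qed.

Lemma csum0 : csum (fun=> 0) 0.
Proof.
rewrite /csum /=; suff h : rsum (fun=> 0 : R) 0 by [].
rewrite /rsum (_ : series _ = fun=> 0); first exact: cvg_cst.
by apply/funext => n; rewrite /series /= big1.
Qed.

Lemma csum_fin u n : (forall i, (n <= i)%N -> u i = 0) ->
  csum u (\sum_(0 <= i < n) u i).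
Proof.
move=> h; rewrite -[X in csum _ X]addr0; apply: csum_shift.
rewrite (_ : (fun i => _) = fun=> 0); first exact: csum0.
by apply/funext => i; rewrite h // leq_addl.
Qed.

Definition summ u (M : R) := forall n, \sum_(0 <= i < n) nrm (u i) <= M.

Lemma csum_abs u M : summ u M -> exists2 l, csum u l & nrm l <= M.
Proof.
move=> hM.
have [x hx _] : exists2 l, rsum (fun i => complex.Re (u i)) l & `|l| <= M.
  apply: rsum_abs => n; apply: le_trans (hM n); apply: ler_sum => i _; exact: nrm_Re.
have [y hy _] : exists2 l, rsum (fun i => complex.Im (u i)) l & `|l| <= M.
  apply: rsum_abs => n; apply: le_trans (hM n); apply: ler_sum => i _; exact: nrm_Im.
exists (x +i* y) => //; set l := x +i* y.
have hl : csum u l by [].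
case: (eqVneq l 0) => [->|l0].
  by rewrite nrm0; apply: le_trans (hM 0%N); rewrite big_nil.
(* rotate [l] to the positive real axis *)
have nl : 0 < nrm l by rewrite lt_def nrm_ge0 nrm_eq0 l0.
have [h _] := csumZ ((nrm l)%:C / l) hl.
rewrite mulfVK //= in h.
apply: (rsum_le h) => n; apply: le_trans (hM n); rewrite /series /=.
apply: ler_sum => i _; apply: le_trans (ler_norm _) _; apply: le_trans (nrm_Re _) _.
rewrite nrmM nrmM nrmV nrmR ger0_norm ?nrm_ge0 // mulfV ?mul1r //.
exact: lt0r_neq0.
Qed.

Lemma csum_nrm u l M : csum u l -> summ u M -> nrm l <= M.
Proof. by move=> h /csum_abs[l' h' hM]; rewrite (csum_unique h h'). Qed.

Lemma csum_interchange a (r c : nat -> C) (M : R) :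
  (forall N J, \sum_(0 <= i < N) \sum_(0 <= j < J) nrm (a i j) <= M) ->
  (forall i, csum (a i) (r i)) -> (forall j, csum (a^~ j) (c j)) ->
  exists2 S, csum r S & csum c S.
Proof.
move=> hM hr hc.
have [x xr xc] := @rsum_interchange R (fun i j => complex.Re (a i j))
  (fun i => complex.Re (r i)) (fun i => complex.Re (c i)) M
  (fun N J => le_trans (ler_sum _ (fun i _ => ler_sum _ (fun j _ => nrm_Re _))) (hM N J))
  (fun i => (hr i).1) (fun i => (hc i).1).
have [y yr yc] := @rsum_interchange R (fun i j => complex.Im (a i j))
  (fun i => complex.Im (r i)) (fun i => complex.Im (c i)) M
  (fun N J => le_trans (ler_sum _ (fun i _ => ler_sum _ (fun j _ => nrm_Im _))) (hM N J))
  (fun i => (hr i).2) (fun i => (hc i).2).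
by exists (x +i* y).
Qed.

Definition conv u v n := \sum_(0 <= i < n.+1) u i * v (n - i)%N.

(** Cauchy product: summation is interchanged in the triangular array [a i j = u i * v (j - i)],
    whose row sums are [u i * l'] and whose column sums are [conv u v j]. *)
Lemma csum_conv u v l l' (M M' : R) : summ u M -> summ v M' -> csum u l -> csum v l' ->
  csum (conv u v) (l * l') /\ summ (conv u v) (M * M').
Proof.
move=> uM vM hu hv.
pose a i j := if (i <= j)%N then u i * v (j - i)%N else 0.
have M0 : 0 <= M by apply: le_trans (uM 0%N); rewrite big_nil.
have M'0 : 0 <= M' by apply: le_trans (vM 0%N); rewrite big_nil.
have rowb i J : \sum_(0 <= j < J) nrm (a i j) <= nrm (u i) * M'.
  case: (leqP J i) => Ji.
    rewrite big1_seq ?mulr_ge0 ?nrm_ge0 // => j; rewrite mem_index_iota andTb => /andP[_ jJ].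
    by rewrite /a leqNgt (leq_trans jJ Ji) nrm0.
  rewrite (big_cat_nat (n := i)) //=; last exact: ltnW.
  rewrite big1_seq ?add0r; last first.
    move=> j; rewrite mem_index_iota andTb => /andP[_ jJ].
    by rewrite /a leqNgt jJ nrm0.
  rewrite -[index_iota i J]/(index_iota (0 + i) J) big_addn; apply: le_trans (_ : \sum_(0 <= j < J - i) nrm (u i) * nrm (v j) <= _).
    by apply: ler_sum => j _; rewrite /a leq_addl nrmM addnK.
  by rewrite -mulr_sumr ler_wpM2l ?nrm_ge0.
have hM N J : \sum_(0 <= i < N) \sum_(0 <= j < J) nrm (a i j) <= M * M'.
  apply: le_trans (ler_sum _ (fun i _ => rowb i J)) _.
  by rewrite -mulr_suml ler_wpM2r.
have hr i : csum (a i) (u i * l').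
  have := @csum_shift (a i) (u i * l') i.
  rewrite big1_seq ?add0r; last first.
    move=> j; rewrite mem_index_iota andTb => /andP[_ jJ].
    by rewrite /a leqNgt jJ.
  apply; have := csumZ (u i) hv; congr (csum _ _).
  by apply/funext => j; rewrite /a leq_addl addnK.
have ca j : \sum_(0 <= i < j.+1) a i j = conv u v j.
  by apply: eq_big_nat => i /andP[_ ij]; rewrite /a -ltnS ij.
have hc j : csum (a^~ j) (conv u v j).
  rewrite -ca; apply: csum_fin => i ji.
  by rewrite /a leqNgt ji.
have [S Sr Sc] := csum_interchange hM hr hc.
split.
  suff -> : l * l' = S by [].
  apply: (csum_unique _ Sr); rewrite mulrC.
  have := csumZ l' hu; congr (csum _ _); apply/funext => i; exact: mulrC.
move=> n; apply: le_trans (hM n n); rewrite exchange_big /=.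
apply: ler_sum_nat => j /andP[_ jn]; rewrite -ca.
apply: le_trans (nrm_sum _ _ _) _.
rewrite [leRHS](big_cat_nat (n := j.+1)) //= lerDl.
by apply: sumr_ge0 => i _; exact: nrm_ge0.
Qed.

Lemma csumP u l : csum u l <-> forall e : R, 0 < e -> exists N, forall n, (N <= n)%N ->
  nrm (l - \sum_(0 <= i < n) u i) < e.
Proof.
split=> [[h1 h2] e e0|h].
  have e2 : 0 < e / 2 by rewrite divr_gt0.
  have /cvgrPdist_lt/(_ _ e2)[N1 _ H1] := h1.
  have /cvgrPdist_lt/(_ _ e2)[N2 _ H2] := h2.
  exists (maxn N1 N2) => n; rewrite geq_max => /andP[n1 n2].
  apply: le_lt_trans (nrm_le_ReIm _) _; rewrite [e]splitr ReD ImD ReN ImN Re_sum Im_sum.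
  apply: ltrD; first exact: H1. exact: H2.
split; apply/cvgrPdist_lt => e e0; have [N hN] := h e e0; exists N => // n /= Nn.
  apply: le_lt_trans (hN n Nn); apply: le_trans (nrm_Re _).
  by rewrite ReD ReN Re_sum.
apply: le_lt_trans (hN n Nn); apply: le_trans (nrm_Im _).
by rewrite ImD ImN Im_sum.
Qed.

Lemma csum_tail u l n : csum u l ->
  csum (fun i => u (i + n)%N) (l - \sum_(0 <= i < n) u i).
Proof.
move=> /csumP h; apply/csumP => e e0; have [N hN] := h e e0; exists N => m Nm.
have := hN (m + n)%N (leq_trans Nm (leq_addr _ _)).
rewrite [in X in nrm X < _ -> _](big_cat_nat (n := n)) ?leq_addl //=.
rewrite -[index_iota n (m + n)]/(index_iota (0 + n) (m + n)) big_addn addnK.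
by rewrite opprD addrA.
Qed.

End ComplexSums.

(** * Wiener norms *)

Section Wiener.
Variable R : realType.
Local Notation C := R[i].
Implicit Types (f g : C -> C) (p z w l : C) (rho M : R).

(* A quantitative form of analyticity which, unlike differentiability, passes to
   infinite sums by interchanging two absolutely convergent series: the Taylor
   series of [f] at [p] has norm at most [M] in the Wiener algebra of the closed
   disc of radius [rho]. *)
Definition wiener p rho f M := exists2 c : nat -> C,
  summ (fun j => c j * rho%:C ^+ j) M &
  forall z, nrm (z - p) <= rho -> csum (fun j => c j * (z - p) ^+ j) (f z).

Lemma wiener_ge0 p rho f M : wiener p rho f M -> 0 <= M.
Proof. by move=> [c hM _]; have := hM 0%N; rewrite big_nil. Qed.

Lemma wiener_eq p rho f g M : wiener p rho f M ->
  (forall z, nrm (z - p) <= rho -> f z = g z) -> wiener p rho g M.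
Proof. by move=> [c hM h] e; exists c => // z hz; rewrite -e //; exact: h. Qed.

Lemma wiener_le p rho f M M' : wiener p rho f M -> M <= M' -> wiener p rho f M'.
Proof. by move=> [c hM h] MM'; exists c => // n; exact: le_trans (hM n) MM'. Qed.

Lemma summ_le_pow (c : nat -> C) rho M z : nrm z <= rho ->
  summ (fun j => c j * rho%:C ^+ j) M -> summ (fun j => c j * z ^+ j) M.
Proof.
move=> hz hM n; apply: le_trans (hM n); apply: ler_sum => j _.
rewrite !nrmM !nrmX ler_wpM2l ?nrm_ge0 // lerXn2r ?nnegrE ?nrm_ge0 //.
by apply: le_trans hz _; rewrite nrmR ler_norm.
Qed.

Lemma wiener_nrm p rho f M z : wiener p rho f M -> nrm (z - p) <= rho -> nrm (f z) <= M.
Proof. by move=> [c hM h] hz; apply: (csum_nrm (h z hz)); exact: summ_le_pow hM. Qed.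

Lemma wiener_sub p rho rho' f M : wiener p rho f M -> 0 <= rho' <= rho -> wiener p rho' f M.
Proof.
move=> [c hM h] /andP[r0 rr]; exists c.
  by apply: summ_le_pow hM; rewrite nrmR ger0_norm.
by move=> z hz; apply: h; exact: le_trans hz rr.
Qed.

Lemma wiener_translate p rho f M w :
  wiener (p + w) rho f M -> wiener p rho (fun z => f (z + w)) M.
Proof.
move=> [c hM h]; exists c => // z hz.
have e : z + w - (p + w) = z - p by rewrite opprD addrACA subrr addr0.
by have := h (z + w); rewrite e; apply.
Qed.

Lemma wiener_cst p rho w : wiener p rho (fun=> w) (nrm w).
Proof.
exists (fun j => if j is 0 then w else 0).
  case=> [|n]; first by rewrite big_nil nrm_ge0.
  rewrite big_nat_recl //= expr0 mulr1 big1 ?addr0 // => i _.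
  by rewrite mul0r nrm0.
move=> z _; have := @csum_fin R (fun j => (if j is 0 then w else 0) * (z - p) ^+ j) 1%N.
by rewrite big_nat1 expr0 mulr1; apply; case=> // n _; rewrite mul0r.
Qed.

Lemma wiener_id p rho : 0 <= rho -> wiener p rho id (nrm p + rho).
Proof.
move=> r0; exists (fun j => if j is 0 then p else (j == 1)%:R).
  case=> [|[|n]]; first by rewrite big_nil addr_ge0 ?nrm_ge0.
    by rewrite big_nat1 expr0 mulr1 lerDl.
  rewrite !big_nat_recl //= expr0 mulr1 big1 ?addr0; last first.
    by move=> i _; rewrite mul0r nrm0.
  by rewrite mul1r expr1 nrmR ger0_norm.
move=> z _; have := @csum_fin R (fun j => (if j is 0 then p else (j == 1)%:R) * (z - p) ^+ j) 2%N.
rewrite big_nat_recr //= big_nat1 expr0 mulr1 mul1r expr1 [p + _]addrC subrK; apply.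
by case=> [|[]] // n _; rewrite mul0r.
Qed.

Lemma wienerD p rho f g M M' : wiener p rho f M -> wiener p rho g M' ->
  wiener p rho (fun z => f z + g z) (M + M').
Proof.
move=> [c hM hc] [d dM hd]; exists (fun j => c j + d j).
  move=> n; apply: le_trans (lerD (hM n) (dM n)); rewrite -big_split /=.
  by apply: ler_sum => j _; rewrite mulrDl nrmD.
move=> z hz; have := csumD (hc z hz) (hd z hz); congr (csum _ _).
by apply/funext => j; rewrite mulrDl.
Qed.

Lemma wienerM p rho f g M M' : 0 <= rho -> wiener p rho f M -> wiener p rho g M' ->
  wiener p rho (fun z => f z * g z) (M * M').
Proof.
move=> r0 [c hM hc] [d dM hd]; exists (conv c d).
  have [x hx _] := csum_abs hM; have [y hy _] := csum_abs dM.
  have [_] := csum_conv hM dM hx hy.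
  move=> h n; apply: le_trans (h n); rewrite le_eqVlt; apply/orP; left; apply/eqP.
  apply: eq_bigr => j _; rewrite /conv mulr_suml; congr nrm.
  apply: eq_big_nat => i /andP[_ ij]; rewrite mulrACA -exprD subnKC //.
move=> z hz.
have [h _] := csum_conv (summ_le_pow hz hM) (summ_le_pow hz dM) (hc z hz) (hd z hz).
move: h; congr (csum _ _); apply/funext => j; rewrite /conv mulr_suml.
by apply: eq_big_nat => i /andP[_ ij]; rewrite mulrACA -exprD subnKC.
Qed.

Lemma wienerZ p rho f M w : wiener p rho f M -> wiener p rho (fun z => w * f z) (nrm w * M).
Proof.
move=> [c hM hc]; exists (fun j => w * c j).
  move=> n; apply: le_trans (ler_wpM2l (nrm_ge0 w) (hM n)); rewrite mulr_sumr.
  by apply: ler_sum => j _; rewrite -mulrA nrmM.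
move=> z hz; have := csumZ w (hc z hz); congr (csum _ _).
by apply/funext => j; rewrite mulrA.
Qed.

Lemma wienerB p rho f g M M' : wiener p rho f M -> wiener p rho g M' ->
  wiener p rho (fun z => f z - g z) (M + M').
Proof.
move=> hf hg; have := wienerD hf (wienerZ (-1) hg); rewrite nrmN nrm1 mul1r.
by move/wiener_eq; apply => z _; rewrite mulN1r.
Qed.

Lemma wienerX p rho f M n : 0 <= rho -> wiener p rho f M ->
  wiener p rho (fun z => f z ^+ n) (M ^+ n).
Proof.
move=> r0 h; elim: n => [|n IH].
  by have := wiener_cst p rho 1; rewrite nrm1 expr0.
rewrite exprS; apply: wiener_eq (wienerM r0 h IH) _ => z _; by rewrite exprS.
Qed.

Lemma wiener_bigsum p rho (F : nat -> C -> C) (M : nat -> R) m n :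
  (forall i, (m <= i < n)%N -> wiener p rho (F i) (M i)) ->
  wiener p rho (fun z => \sum_(m <= i < n) F i z) (\sum_(m <= i < n) M i).
Proof.
elim: n => [|n IH] h.
  rewrite big_geq //; apply: wiener_eq (wiener_le (wiener_cst p rho 0) _) _.
    by rewrite nrm0.
  by move=> z _; rewrite big_geq.
case: (leqP m n) => mn; last first.
  rewrite big_geq //; apply: wiener_eq (wiener_le (wiener_cst p rho 0) _) _.
    by rewrite nrm0.
  by move=> z _; rewrite big_geq.
rewrite big_nat_recr //=; apply: wiener_eq (wienerD (IH _) (h n _)) _.
- by move=> i /andP[mi ni]; apply: h; rewrite mi ltnW.
- by rewrite mn /=.
- by move=> z _; rewrite big_nat_recr.
Qed.

(** The Weierstrass theorem in this setting: the Taylor coefficients of the sum are the sums of the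
    Taylor coefficients, by interchange of summation. *)
Lemma wiener_series p rho (F : nat -> C -> C) (Mn : nat -> R) (G : C -> C) M :
  0 <= rho -> (forall n, wiener p rho (F n) (Mn n)) ->
  (forall N, \sum_(0 <= n < N) Mn n <= M) ->
  (forall z, nrm (z - p) <= rho -> csum (fun n => F n z) (G z)) ->
  wiener p rho G M.
Proof.
move=> r0 hF hM hG.
pose c n := s2val (cid2 (hF n)).
have cM n : summ (fun j => c n j * rho%:C ^+ j) (Mn n) by rewrite /c; case: cid2.
have hc n z : nrm (z - p) <= rho -> csum (fun j => c n j * (z - p) ^+ j) (F n z).
  by rewrite /c; case: cid2 => ? ? h; exact: h.
have Mn0 n : 0 <= Mn n by exact: wiener_ge0 (hF n).
have dbl N J : \sum_(0 <= n < N) \sum_(0 <= j < J) nrm (c n j * rho%:C ^+ j) <= M.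
  apply: le_trans (hM N); apply: ler_sum => n _; exact: cM.
have colb j : exists l, csum (fun n => c n j * rho%:C ^+ j) l.
  have [|l h _] := @csum_abs R (fun n => c n j * rho%:C ^+ j) M; last by exists l.
  move=> N; apply: le_trans (dbl N j.+1); apply: ler_sum => n _.
  rewrite big_nat_recr //= lerDr; apply: sumr_ge0 => ? _; exact: nrm_ge0.
have [d hd] : exists d : nat -> C,
    forall j, csum (fun n => c n j * rho%:C ^+ j) (d j * rho%:C ^+ j) /\
      (0 < rho -> csum (fun n => c n j) (d j)).
  (* On a disc of radius 0 the weights [rho ^ j] with [j > 0] vanish, so only the constant
     coefficient can be recovered; the others are set to 0. *)
  case: (eqVneq rho 0) => [->|rho0].
    exists (fun j => if j is 0 then sval (cid (colb 0%N)) else 0) => j.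
    rewrite ltxx; split => //; case: j => [|j]; last first.
      rewrite mul0r exprS mul0r (_ : (fun n => _) = fun=> 0); first exact: csum0.
      by apply/funext => n; rewrite mulr0.
    by case: cid => l /=; rewrite !expr0 mulr1.
  exists (fun j => sval (cid (colb j)) / rho%:C ^+ j) => j; case: cid => l /= h.
  have rj : rho%:C ^+ j != 0.
    by rewrite expf_neq0 //; apply: contra rho0 => /eqP[->].
  rewrite mulfVK //; split => // _; have := csumZ (rho%:C ^+ j)^-1 h.
  by rewrite mulrC; congr (csum _ _); apply/funext => n; rewrite mulrC mulfK.
exists d.
  move=> J; have [S1 S1h] : exists c1 : nat -> R, forall j,
      rsum (fun n => nrm (c n j * rho%:C ^+ j)) (c1 j).
    have h j : exists2 l, rsum (fun n => nrm (c n j * rho%:C ^+ j)) l & l <= M.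
      apply: rsum_bounded => [?|N]; first exact: nrm_ge0.
      apply: le_trans (dbl N j.+1); apply: ler_sum => n _.
      rewrite big_nat_recr //= lerDr; apply: sumr_ge0 => ? _; exact: nrm_ge0.
    by exists (fun j => s2val (cid2 (h j))) => j; case: cid2.
  apply: le_trans (_ : \sum_(0 <= j < J) S1 j <= _).
    apply: ler_sum => j _; apply: (csum_nrm (hd j).1) => N.
    by apply: rsum_ge_series (S1h j) => n; exact: nrm_ge0.
  have := rsum_sum (a := fun j n => nrm (c n j * rho%:C ^+ j)) (N := J) S1h.
  move/rsum_le; apply => N; rewrite /series /=; exact: dbl.
move=> z hz.
have [] := @csum_interchange R (fun n j => c n j * (z - p) ^+ j) (fun n => F n z)
  (fun j => d j * (z - p) ^+ j) M.
- move=> N J; apply: le_trans (hM N); apply: ler_sum => n _.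
  exact: (summ_le_pow hz (cM n)).
- by move=> n; exact: hc.
- move=> j; have [h1 h2] := hd j.
  case: (eqVneq rho 0) => [e|rho0].
    move: h1; rewrite e; suff -> : z - p = 0%:C by [].
    by apply/eqP; rewrite -nrm_eq0 eq_le nrm_ge0 andbT -e.
  have := csumZ ((z - p) ^+ j) (h2 _); rewrite mulrC lt_def rho0 r0 => /(_ isT).
  by congr (csum _ _); apply/funext => n; rewrite mulrC.
move=> S hS hS'; by rewrite (csum_unique (hG z hz) hS).
Qed.

Lemma wiener_series_exists p rho (F : nat -> C -> C) (Mn : nat -> R) M z :
  (forall n, wiener p rho (F n) (Mn n)) ->
  (forall N, \sum_(0 <= n < N) Mn n <= M) -> nrm (z - p) <= rho ->
  exists2 l, csum (fun n => F n z) l & nrm l <= M.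
Proof.
move=> hF hM hz; apply: csum_abs => N; apply: le_trans (hM N).
by apply: ler_sum => n _; exact: wiener_nrm (hF n) hz.
Qed.

End Wiener.

(** * The complex exponential and its power series *)

Section ComplexExp.
Variable R : realType.
Local Notation C := R[i].
Implicit Types (p z w l : C) (x y t : R).

Definition cexp z : C := (expR (complex.Re z))%:C * circle_u (complex.Im z).

Lemma circle_uD x y : circle_u (x + y) = circle_u x * circle_u y.
Proof.
apply: ReIm_eq; first by rewrite ReM /= cosD.
by rewrite ImM /= sinD; ring.
Qed.

Lemma circle_u0 : circle_u (0 : R) = 1.
Proof. by apply: ReIm_eq => /=; rewrite ?cos0 ?sin0. Qed.

Lemma cexpD z w : cexp (z + w) = cexp z * cexp w.
Proof. by rewrite /cexp ReD ImD expRD circle_uD rmorphM mulrACA. Qed.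

Lemma cexp0 : cexp 0 = 1.
Proof. by rewrite /cexp /= expR0 circle_u0 mulr1. Qed.

Lemma nrm_circle_u x : nrm (circle_u x) = 1.
Proof. by rewrite /nrm normc_def /= cos2Dsin2 sqrtr1. Qed.

Lemma nrm_cexp z : nrm (cexp z) = expR (complex.Re z).
Proof. by rewrite /cexp nrmM nrmR nrm_circle_u mulr1 ger0_norm ?expR_ge0. Qed.

Definition exp_term z (j : nat) : C := z ^+ j / (j`!)%:R.

Lemma factC_neq0 j : (j`!)%:R != 0 :> C.
Proof. by rewrite pnatr_eq0 -lt0n fact_gt0. Qed.

Lemma nrm_nat n : nrm (n%:R : C) = n%:R.
Proof. by rewrite -(rmorph_nat (real_complex R)) nrmR normr_nat. Qed.

Lemma nrm_exp_term z j : nrm (exp_term z j) = exp_coeff (nrm z) j.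
Proof. by rewrite /exp_term nrmM nrmX nrmV nrm_nat. Qed.

Lemma rsum_expR x : rsum (exp_coeff x) (expR x).
Proof. exact: is_cvg_series_exp_coeff. Qed.

Lemma summ_exp_term z : summ (exp_term z) (expR (nrm z)).
Proof.
move=> n; have -> : \sum_(0 <= i < n) nrm (exp_term z i) = series (exp_coeff (nrm z)) n.
  by apply: eq_bigr => i _; rewrite nrm_exp_term.
apply: (rsum_ge_series n _ (@rsum_expR (nrm z))) => i; apply: exp_coeff_ge0.
exact: nrm_ge0.
Qed.

Lemma conv_exp_term z w : conv (exp_term z) (exp_term w) = exp_term (z + w).
Proof.
apply/funext => n; rewrite /conv /exp_term addrC exprDn mulr_suml big_mkord.
apply: eq_bigr => i _; have i_n : (i <= n)%N by rewrite -ltnS.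
rewrite -mulr_natl -(bin_fact i_n) !natrM.
have := factC_neq0 i; have := factC_neq0 (n - i).
have : 'C(n, i)%:R != 0 :> C by rewrite pnatr_eq0 -lt0n bin_gt0.
move: (w ^+ (n - i)) (z ^+ i) => a b h1 h2 h3; field.
by rewrite h1 h2 h3.
Qed.

Lemma csum_exp_term_real x : csum (exp_term x%:C) (expR x)%:C.
Proof.
have e j : exp_term x%:C j = (exp_coeff x j)%:C.
  by rewrite /exp_term /exp_coeff /= rmorphM /= rmorphXn /= fmorphV /= rmorph_nat.
split => /=.
  by rewrite (_ : (fun i => _) = exp_coeff x); [exact: rsum_expR|apply/funext => j; rewrite e].
rewrite (_ : (fun i => _) = fun=> 0); last by apply/funext => j; rewrite e.
by have [] := @csum0 R.
Qed.

Lemma iX_even k : ('i : C) ^+ k.*2 = ((-1) ^+ k)%:C.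
Proof. by rewrite -muln2 mulnC exprM sqr_i rmorphXn /= rmorphN1. Qed.

Lemma csum_exp_term_imag y : csum (exp_term (0 +i* y)) (circle_u y).
Proof.
have e j : exp_term (0 +i* y) j = cos_coeff y j +i* sin_coeff y j.
  have -> : exp_term (0 +i* y) j = (y ^+ j / j`!%:R)%:C * 'i ^+ j.
    rewrite /exp_term (_ : 0 +i* y = y%:C * 'i); last by apply: ReIm_eq; rewrite ?ReM ?ImM /=; ring.
    by rewrite exprMn rmorphM /= rmorphXn /= fmorphV /= rmorph_nat mulrAC.
  have ej : 'i ^+ j = (if odd j then 0 +i* (-1) ^+ j.-1./2 else (-1) ^+ j./2 +i* 0) :> C.
    rewrite -{1 3 4}[j]odd_double_half; case: (odd j).
      by rewrite add1n exprS iX_even -[_.+1.-1]/(j./2.*2) doubleK; apply: ReIm_eq; rewrite ?ReM ?ImM /=; ring.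
    by rewrite add0n iX_even doubleK.
  rewrite cos_coeffE sin_coeffE /= ej; case: (odd j);
    by apply: ReIm_eq; rewrite ?ReM ?ImM /= ?exprnP; ring.
split => /=.
  rewrite (_ : (fun i => _) = cos_coeff y); last by apply/funext => j; rewrite e.
  by rewrite /rsum unlock; exact: is_cvg_series_cos_coeff.
rewrite (_ : (fun i => _) = sin_coeff y); last by apply/funext => j; rewrite e.
by rewrite /rsum unlock; exact: is_cvg_series_sin_coeff.
Qed.

Lemma csum_cexp z : csum (exp_term z) (cexp z).
Proof.
have [] := csum_conv (@summ_exp_term (complex.Re z)%:C) (@summ_exp_term (0 +i* complex.Im z))
  (csum_exp_term_real _) (csum_exp_term_imag _).
rewrite conv_exp_term => + _; congr (csum (exp_term _) _).
by apply: ReIm_eq => /=; rewrite ?addr0 ?add0r.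
Qed.

(** Expanding at [p] factors out [exp (p t)], and the bound is the maximum of the modulus on the
    disc. For [t = - ln (n + 1)] it becomes the norm of [(n + 1) ^ (- z)] with no loss in the
    exponent. *)
Lemma wiener_cexp p rho t : 0 <= rho ->
  wiener p rho (fun z => cexp (z * t%:C)) (expR (complex.Re p * t + rho * `|t|)).
Proof.
move=> r0; exists (fun j => cexp (p * t%:C) * (t%:C ^+ j / (j`!)%:R)).
  move=> n; apply: le_trans (_ : expR (complex.Re p * t) * expR (nrm (rho%:C * t%:C)) <= _).
    apply: le_trans (ler_wpM2l (expR_ge0 _) (summ_exp_term _ n)); rewrite mulr_sumr.
    apply: ler_sum => j _; rewrite -mulrA nrmM nrm_cexp ReM /= mulr0 subr0.
    by rewrite [t%:C ^+ j / _ * _]mulrC mulrA -exprMn.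
  by rewrite -expRD nrmM !nrmR (ger0_norm r0).
move=> z hz; have := csumZ (cexp (p * t%:C)) (csum_cexp ((z - p) * t%:C)).
rewrite -cexpD -mulrDl subrKC; congr (csum _ _); apply/funext => j.
by rewrite /exp_term exprMn; ring.
Qed.

End ComplexExp.

(** * The functions (n + 1) ^ (- z) *)

Section Powers.
Variable R : realType.
Local Notation C := R[i].
Implicit Types (p z w : C) (x y rho M : R) (n : nat).

(* [npw n z = (n + 1) ^ (- z)] *)
Definition npw n z : C := cexp (z * (- ln n.+1%:R)%:C).
Definition rpw n x : R := expR (- (x * ln n.+1%:R)).

Lemma nrm_npw n z : nrm (npw n z) = rpw n (complex.Re z).
Proof. by rewrite /npw nrm_cexp ReM /= mulr0 subr0 mulrN. Qed.

Lemma npwD n z w : npw n (z + w) = npw n z * npw n w.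
Proof. by rewrite /npw mulrDl cexpD. Qed.

Lemma rpwD n x y : rpw n (x + y) = rpw n x * rpw n y.
Proof. by rewrite /rpw -expRD mulrDl opprD. Qed.

Lemma rpw_gt0 n x : 0 < rpw n x. Proof. exact: expR_gt0. Qed.
Lemma rpw_ge0 n x : 0 <= rpw n x. Proof. exact: expR_ge0. Qed.

Lemma rpw_real n x : npw n x%:C = (rpw n x)%:C.
Proof.
rewrite /npw /cexp /rpw ReM ImM /= !mulr0 !mul0r subr0 addr0 circle_u0 mulr1.
by rewrite mulrN.
Qed.

Lemma rpw_nat n k : rpw n k%:R = n.+1%:R ^- k.
Proof.
by rewrite /rpw expRN expRM_natl lnK ?posrE.
Qed.

Lemma npw_nat n k : npw n k%:R = (n.+1%:R ^- k)%:C.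
Proof. by rewrite -rpw_nat -rpw_real rmorph_nat. Qed.

Lemma rpw0l x : rpw 0 x = 1.
Proof. by rewrite /rpw ln1 mulr0 oppr0 expR0. Qed.

(** A discrete integral comparison: [exp x >= 1 + x] gives first
    [ln ((n + 2) / (n + 1)) >= 1 / (n + 2)], then the claim. Telescoping bounds the sum of
    [rpw n (y + 1)]. *)
Lemma rpw_telescope n y : 0 < y ->
  y * rpw n.+1 (y + 1) <= rpw n y - rpw n.+1 y.
Proof.
move=> y0; rewrite rpwD (_ : 1 = 1%:R) // rpw_nat expr1.
set L := ln n.+2%:R - ln n.+1%:R : R.
have -> : rpw n y = rpw n.+1 y * expR (y * L).
  by rewrite /rpw -expRD /L; congr expR; ring.
have n2 : 0 < n.+2%:R :> R by [].
have hL : n.+2%:R^-1 <= L.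
  have := expR_ge1Dx (- L); rewrite /L opprB expRD expRN !lnK ?posrE //.
  have -> : n.+1%:R / n.+2%:R = 1 - n.+2%:R^-1 :> R.
    by move: n2; rewrite -(natr1 n.+1) => n2; field; exact: lt0r_neq0.
  by move: (ln _) (ln _) (_^-1) => b c d; lra.
rewrite -[X in _ <= _ - X]mulr1 -mulrBr mulrCA ler_wpM2l ?rpw_ge0 //.
apply: le_trans (_ : y * L <= _); first by rewrite ler_wpM2l // ltW.
by rewrite lerBrDl expR_ge1Dx.
Qed.

Lemma rpw_summable x : 1 < x -> exists M, forall N, \sum_(0 <= n < N) rpw n x <= M.
Proof.
move=> x1; pose y := x - 1; have y0 : 0 < y by rewrite subr_gt0.
exists (1 + y^-1) => -[|N].
  by rewrite big_nil addr_ge0 // invr_ge0 ltW.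
rewrite big_nat_recl // rpw0l lerD2l -(ler_pM2l y0) mulfV ?gt_eqF // mulr_sumr.
have -> : x = y + 1 by rewrite subrK.
apply: le_trans (_ : \sum_(0 <= n < N) (rpw n y - rpw n.+1 y) <= _).
  by apply: ler_sum => n _; exact: rpw_telescope.
rewrite (telescope_sumr_eq (fun n => - rpw n y)) //.
  by rewrite rpw0l opprK addrC lerBlDr lerDl rpw_ge0.
by move=> k _; rewrite opprK addrC.
Qed.

Lemma wiener_npw p rho n : 0 <= rho ->
  wiener p rho (npw n) (rpw n (complex.Re p - rho)).
Proof.
move=> r0; have := wiener_cexp p (- ln n.+1%:R) r0; rewrite normrN ger0_norm.
  by move/wiener_le; apply; rewrite /rpw ler_expR le_eqVlt; apply/orP; left; apply/eqP; ring.
by rewrite ln_ge0 // ler1n.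
Qed.

End Powers.

(** * Expansion of (1 + x) ^ w *)

Section LogExpansion.
Variable R : realType.
Local Notation C := R[i].
Implicit Types (g h : R -> R) (b c : nat -> R) (x y : R).

(** An asymptotic expansion at 0 whose remainder is controlled on all of [(0, 1]]. It is used at
    [x = 1 / (n + 1)], and [n = 0] gives the boundary point 1, where the power series of
    [ln (1 + x)] no longer converges absolutely. *)
Definition expansion g b := forall J, exists K, forall x, 0 < x <= 1 ->
  `|g x - \sum_(0 <= i < J) b i * x ^+ i| <= K * x ^+ J.

Definition rconv b c n := \sum_(0 <= i < n.+1) b i * c (n - i)%N.

Lemma expr_le_le1 x J n : 0 < x <= 1 -> (J <= n)%N -> x ^+ n <= x ^+ J.
Proof. by move=> /andP[x0 x1] Jn; rewrite ler_wiXn2l // ltW. Qed.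

Lemma poly_bound b J x : 0 < x <= 1 ->
  `|\sum_(0 <= i < J) b i * x ^+ i| <= \sum_(0 <= i < J) `|b i|.
Proof.
move=> /andP[x0 x1]; apply: le_trans (ler_norm_sum _ _ _) _.
apply: ler_sum => i _; rewrite normrM ler_piMr // normrX exprn_ile1 //.
by rewrite ger0_norm // ltW.
Qed.

Lemma expansionM g h b c : expansion g b -> expansion h c -> expansion (fun x => g x * h x) (rconv b c).
Proof.
move=> hg hh J; have [K hK] := hg J; have [L hL] := hh J.
have [L0 hL0] := hh 0%N.
pose p := \poly_(i < J) b i; pose q := \poly_(i < J) c i.
pose r n := (p * q)`_n.
have pE x : p.[x] = \sum_(0 <= i < J) b i * x ^+ i by rewrite horner_poly big_mkord.
have qE x : q.[x] = \sum_(0 <= i < J) c i * x ^+ i by rewrite horner_poly big_mkord.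
(* The product of the truncations also has terms of degree from [J] on; for [x <= 1] they are
   absorbed into the remainder. *)
have pqE x : p.[x] * q.[x] = \sum_(0 <= i < J) rconv b c i * x ^+ i
    + \sum_(J <= i < J + J) r i * x ^+ i.
  rewrite -hornerM (@horner_coef_wide _ (J + J)%N); last first.
    apply: leq_trans (size_polyMleq _ _) _; rewrite -subn1 leq_subLR.
    by rewrite (leq_trans (leq_add (size_poly _ _) (size_poly _ _))) // leq_addl.
  rewrite -(big_mkord xpredT (fun i => r i * x ^+ i)).
  rewrite (big_cat_nat (n := J)) ?leq_addr //=; congr (_ + _).
  apply: eq_big_nat => n /andP[_ nJ]; congr (_ * _).
  rewrite /r coefM /rconv big_mkord; apply: eq_bigr => i _.
  have iJ : (i < J)%N by apply: leq_trans nJ; exact: ltn_ord.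
  have niJ : (n - i < J)%N by apply: leq_ltn_trans nJ; exact: leq_subr.
  by rewrite !coef_poly iJ niJ.
exists (K * L0 + (\sum_(0 <= i < J) `|b i|) * L + \sum_(J <= i < J + J) `|r i|).
move=> x x01; have [x0 x1] := andP x01.
have -> : g x * h x - \sum_(0 <= i < J) rconv b c i * x ^+ i =
   (g x - p.[x]) * h x + p.[x] * (h x - q.[x]) + \sum_(J <= i < J + J) r i * x ^+ i.
  have -> : \sum_(0 <= i < J) rconv b c i * x ^+ i =
    p.[x] * q.[x] - \sum_(J <= i < J + J) r i * x ^+ i by rewrite pqE addrK.
  ring.
have xJ : 0 <= x ^+ J by rewrite exprn_ge0 // ltW.
rewrite [leRHS]mulrDl [X in _ <= X + _]mulrDl.
apply: le_trans (ler_normD _ _) _; apply: lerD.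
  apply: le_trans (ler_normD _ _) _; apply: lerD; rewrite normrM.
    rewrite mulrAC; apply: ler_pM => //; first by rewrite pE; exact: hK.
    by have := hL0 x x01; rewrite big_nil subr0 mulr1.
  rewrite -mulrA; apply: ler_pM => //; last by rewrite qE; exact: hL.
  by rewrite pE; exact: poly_bound.
apply: le_trans (ler_norm_sum _ _ _) _; rewrite mulr_suml.
apply: ler_sum_nat => i /andP[Ji _]; rewrite normrM ler_wpM2l //.
by rewrite ger0_norm ?exprn_ge0 ?(ltW x0) // expr_le_le1.
Qed.

Definition ln_coef i : R := if i is i'.+1 then (-1) ^+ i' / i%:R else 0.

(** By the geometric sum, [ln (1 + y)] minus its Taylor polynomial has derivative
    [(- y) ^ J / (1 + y)]; the mean value theorem on [[0, x]] then gives the constant 1. *)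
Lemma expansion_ln : expansion (fun x => ln (1 + x)) ln_coef.
Proof.
case=> [|J]; exists 1 => x /andP[x0 x1].
  rewrite big_nil subr0 mulr1 ger0_norm; last by rewrite ln_ge0 // lerDl ltW.
  by apply: le_trans x1; apply: le_ln1Dx; apply: lt_trans x0.
pose p := \poly_(i < J.+1) ln_coef i.
have dp y : 0 <= y -> (1 + y)^-1 - p^`().[y] = (- y) ^+ J / (1 + y).
  move=> y0; have y1 : 1 + y != 0 by rewrite lt0r_neq0 // ltr_pwDl.
  have -> : p^`() = \poly_(i < J) (-1) ^+ i.
    apply/polyP => i; rewrite coef_deriv !coef_poly ltnS; case: ifP => // _.
      by rewrite /ln_coef -[_ *+ i.+1]mulr_natr mulfVK.
    by rewrite mul0rn.
  rewrite horner_poly.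
  have -> : \sum_(i < J) (-1) ^+ i * y ^+ i = (1 - (- y) ^+ J) / (1 + y).
    have := subrX1 (- y) J.
    under eq_bigr do rewrite -mulN1r exprMn; rewrite -[- y]mulN1r exprMn => e.
    apply: (mulIf y1); rewrite mulfVK //; move: e; set S := \sum_(i < J) _; lra.
  by field.
pose f := (fun y => ln (1 + y)) - (fun y => p.[y]).
have df y : 0 <= y -> is_derive y 1 f ((1 + y)^-1 - p^`().[y]).
  move=> y0; apply: is_deriveB; last exact: is_derive_poly.
  have -> : (fun y => ln (1 + y)) = @ln R \o (fun y => 1 + y) by [].
  rewrite -[(1 + y)^-1]mulr1; apply: is_derive1_comp.
    by apply: is_derive1_ln; rewrite ltr_pwDl.
  have -> : (fun y => 1 + y) = (cst 1 + id : R -> R) by [].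
  by rewrite -[X in is_derive _ _ _ X]add0r; apply: is_deriveD.
have [||z] := @MVT R f (fun y => (1 + y)^-1 - p^`().[y]) 0 x x0.
- by move=> y; rewrite in_itv /= => /andP[/ltW y0 _]; exact: df.
- apply: derivable_within_continuous => y; rewrite in_itv /= => /andP[y0 _].
  by have [] := df y y0.
rewrite in_itv /= => /andP[z0 zx].
have fE y : f y = ln (1 + y) - p.[y] by [].
have p0 : p.[0] = 0 by rewrite horner_coef0 coef_poly.
rewrite !fE p0 addr0 ln1 !subr0 (dp z (ltW z0)) horner_poly.
rewrite -(big_mkord xpredT (fun i => ln_coef i * x ^+ i)) => ->.
have zp : 0 < 1 + z by rewrite ltr_pwDl // ltW.
rewrite mul1r exprSr normrM (ger0_norm (ltW x0)); apply: ler_wpM2r; first exact: ltW.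
rewrite normrM normrX normrN (ger0_norm (ltW z0)) normfV (ger0_norm (ltW zp)).
rewrite ler_pdivrMr //.
apply: le_trans (_ : x ^+ J * 1 <= _).
  by rewrite mulr1; apply: lerXn2r; rewrite ?nnegrE; apply: ltW.
apply: ler_wpM2l; first by apply: exprn_ge0; exact: ltW.
by rewrite lerDl ltW.
Qed.

(** The coefficients of [ln (1 + x) ^ j / j!]; [lnX_coef j i] is the signed Stirling number of the
    first kind [s(i, j)] divided by [i!]. *)
Fixpoint lnX_coef j : nat -> R :=
  if j is j'.+1 then (fun i => rconv (lnX_coef j') ln_coef i / j%:R)
  else (fun i => (i == 0)%:R).

Lemma expansion_lnX j : expansion (fun x => ln (1 + x) ^+ j / j`!%:R) (lnX_coef j).
Proof.
elim: j => [|j IH] J.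
  exists 1 => x /andP[x0 x1]; rewrite expr0 fact0 divr1 mul1r; case: J => [|J].
    by rewrite big_nil subr0 normr1 expr0.
  rewrite big_nat_recl //= mul1r expr0 big1 ?addr0 ?subrr ?normr0 ?exprn_ge0 ?ltW //.
  by move=> i _; rewrite mul0r.
have [K hK] := expansionM IH expansion_ln J; exists (K / j.+1%:R) => x x01.
have -> : ln (1 + x) ^+ j.+1 / j.+1`!%:R - \sum_(0 <= i < J) lnX_coef j.+1 i * x ^+ i =
  (ln (1 + x) ^+ j / j`!%:R * ln (1 + x)
    - \sum_(0 <= i < J) rconv (lnX_coef j) ln_coef i * x ^+ i) / j.+1%:R.
  rewrite mulrBl; congr (_ - _).
    by rewrite exprSr factS natrM invfM; ring.
  by rewrite mulr_suml; apply: eq_bigr => i _; rewrite /= mulrAC.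
by rewrite normrM normfV normr_nat [leRHS]mulrAC ler_wpM2r ?invr_ge0 // hK.
Qed.

Lemma lnX_coef_small j i : (i < j)%N -> lnX_coef j i = 0.
Proof.
elim: j i => [//|j IH] i ij /=; rewrite /rconv big1_seq ?mul0r // => k.
rewrite mem_index_iota /= => ki; case: (ltnP k j) => kj; first by rewrite IH ?mul0r.
by rewrite (_ : (i - k)%N = 0%N) ?mulr0 //; apply/eqP; rewrite subn_eq0 (leq_trans _ kj).
Qed.

Lemma lnX_coef11 : lnX_coef 1 1 = 1.
Proof.
rewrite /= /rconv !big_nat_recl // big_nil /ln_coef /= subn0 expr0; by field.
Qed.

End LogExpansion.

(** * Binomial expansion of (1 + x) ^ (1 - z), uniformly in z *)

Section BinomialExpansion.
Variable R : realType.
Local Notation C := R[i].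
Implicit Types (p z w : C) (x t rho : R).

(** The binomial coefficient of [w] over [i] as a polynomial in [w], that is, the coefficient of
    [x ^ i] in [exp (w ln (1 + x))]. *)
Definition binom_poly i w : C := \sum_(0 <= j < i.+1) (lnX_coef R j i)%:C * w ^+ j.

Definition binom_rem J x w : C :=
  cexp (w * (ln (1 + x))%:C) - \sum_(0 <= i < J) binom_poly i w * (x ^+ i)%:C.

Lemma binom_poly0 w : binom_poly 0 w = 1.
Proof. by rewrite /binom_poly big_nat1 expr0 mulr1. Qed.

Lemma binom_poly1 w : binom_poly 1 w = w.
Proof. by rewrite /binom_poly big_nat_recl // big_nat1 lnX_coef11 mul1r expr1 mul0r add0r. Qed.

Lemma wiener_1B p rho : 0 <= rho -> wiener p rho (fun z => 1 - z) (1 + (nrm p + rho)).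
Proof.
by move=> r0; have := wienerB (wiener_cst p rho 1) (wiener_id p r0); rewrite nrm1.
Qed.

Lemma wiener_binom_poly p rho i : 0 <= rho -> exists K, wiener p rho (fun z => binom_poly i (1 - z)) K.
Proof.
move=> r0; eexists; apply: wiener_bigsum => j _; apply: wienerZ.
exact: wienerX (wiener_1B p r0).
Qed.

(** Since [0 <= ln (1 + x) <= x <= 1], a factor [x ^ J] comes out of every term of degree at least
    [J]; the rest is dominated by the series of [exp B]. *)
Lemma wiener_exp_tail p rho J : 0 <= rho -> exists K, forall x, 0 < x <= 1 ->
  wiener p rho (fun z => cexp ((1 - z) * (ln (1 + x))%:C) -
    \sum_(0 <= j < J) exp_term ((1 - z) * (ln (1 + x))%:C) j) (K * x ^+ J).
Proof.
move=> r0; set B := 1 + (nrm p + rho).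
have B0 : 0 <= B by rewrite /B !addr_ge0 // nrm_ge0.
exists (expR B) => x /andP[x0 x1]; set t := ln (1 + x).
have t0 : 0 <= t by rewrite ln_ge0 // lerDl ltW.
have tx : t <= x by apply: le_ln1Dx; apply: lt_trans x0.
apply: (@wiener_series R p rho (fun n z => exp_term ((1 - z) * t%:C) (n + J)%N)
  (fun n => B ^+ (n + J) * (t ^+ (n + J) / (n + J)`!%:R))) => //.
- move=> n; have := wienerM r0 (wienerX (n + J) r0 (wiener_1B p r0))
    (wiener_cst p rho (t%:C ^+ (n + J) / (n + J)`!%:R)).
  rewrite nrmM nrmV nrmX nrmR nrm_nat (ger0_norm t0); move/wiener_eq; apply => z _.
  by rewrite /exp_term exprMn mulrA.
- move=> N; apply: le_trans (_ : \sum_(0 <= n < N) (x ^+ J * exp_coeff B (n + J)%N) <= _).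
    apply: ler_sum => n _; rewrite /exp_coeff /= mulrCA.
    apply: ler_wpM2r; first by rewrite divr_ge0 ?exprn_ge0.
    rewrite exprD -[leRHS]mul1r ler_pM ?exprn_ge0 //.
      by rewrite exprn_ile1 // (le_trans tx).
    by apply: lerXn2r; rewrite ?nnegrE // ltW.
  rewrite -mulr_sumr mulrC; apply: ler_wpM2r.
    by apply: exprn_ge0; exact: ltW.
  apply: le_trans (rsum_ge_series (N + J)%N _ (@rsum_expR _ B)); last first.
    by move=> i; exact: exp_coeff_ge0.
  rewrite [leRHS](big_cat_nat (n := J)) ?leq_addl //=.
  rewrite -[index_iota J (N + J)]/(index_iota (0 + J) (N + J)) big_addn addnK.
  by rewrite lerDr sumr_ge0 // => i _; exact: exp_coeff_ge0.
- move=> z _; exact: csum_tail (csum_cexp _).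
Qed.

(** The remainder splits into the tail of the exponential series from degree [J] on and, for each
    [j < J], the error in the expansion of [ln (1 + x) ^ j / j!]. *)
Lemma wiener_binom_rem p rho J : 0 <= rho -> exists K, forall x, 0 < x <= 1 ->
  wiener p rho (fun z => binom_rem J x (1 - z)) (K * x ^+ J).
Proof.
move=> r0; have [K hK] := wiener_exp_tail p J r0; set B := 1 + (nrm p + rho).
have [L hL] : exists L : nat -> R, forall j x, 0 < x <= 1 ->
    `|ln (1 + x) ^+ j / j`!%:R - \sum_(0 <= i < J) lnX_coef R j i * x ^+ i| <= L j * x ^+ J.
  by exists (fun j => sval (cid (@expansion_lnX R j J))) => j; case: cid.
exists (K + \sum_(0 <= j < J) B ^+ j * L j) => x x01.
have B0 : 0 <= B by rewrite /B !addr_ge0 // nrm_ge0.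
pose d j := ln (1 + x) ^+ j / j`!%:R - \sum_(0 <= i < J) lnX_coef R j i * x ^+ i.
have h2 : wiener p rho (fun z => \sum_(0 <= j < J) (1 - z) ^+ j * (d j)%:C)
    (\sum_(0 <= j < J) B ^+ j * L j * x ^+ J).
  apply: wiener_bigsum => j _; rewrite -mulrA.
  apply: wiener_le (wienerM r0 (wienerX j r0 (wiener_1B p r0)) (wiener_cst p rho (d j)%:C)) _.
  by rewrite nrmR ler_wpM2l ?exprn_ge0 // hL.
rewrite mulrDl mulr_suml; apply: wiener_eq (wienerD (hK x x01) h2) _ => z _ /=.
set w := 1 - z; rewrite /binom_rem -addrA; congr (_ + _).
rewrite addrC -sumrB.
have -> : \sum_(0 <= i < J) binom_poly i w * (x ^+ i)%:C =
    \sum_(0 <= j < J) w ^+ j * (\sum_(0 <= i < J) lnX_coef R j i * x ^+ i)%:C.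
  under [RHS]eq_bigr do rewrite rmorph_sum mulr_sumr.
  rewrite [RHS]exchange_big /=; apply: eq_big_nat => i /andP[_ iJ].
  rewrite [RHS](big_cat_nat (n := i.+1)) //= [X in _ = _ + X]big1_seq ?addr0; last first.
    move=> j; rewrite mem_index_iota /= => /andP[ij _].
    by rewrite lnX_coef_small // mul0r rmorph0 mulr0.
  rewrite /binom_poly mulr_suml; apply: eq_bigr => j _; rewrite rmorphM /=; ring.
rewrite -sumrN; apply: eq_bigr => j _; rewrite /d rmorphB /= mulrBr.
have -> : exp_term (w * (ln (1 + x))%:C) j = w ^+ j * (ln (1 + x) ^+ j / j`!%:R)%:C.
  by rewrite /exp_term exprMn rmorphM /= rmorphXn /= fmorphV /= rmorph_nat mulrA.
by rewrite addrAC subrr add0r.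
Qed.

Lemma binom_rem0 J x : binom_rem J.+1 x 0 = 0.
Proof.
rewrite /binom_rem mul0r cexp0 big_nat_recl // binom_poly0 expr0 mulr1 big1 ?addr0 ?subrr // => i _.
rewrite /binom_poly big1_seq ?mul0r // => -[|j] _.
  by rewrite (_ : lnX_coef R 0 i.+1 = 0) // mul0r.
by rewrite exprS mul0r mulr0.
Qed.

Lemma binom_remS J x w : binom_rem J x w = binom_rem J.+1 x w + binom_poly J w * (x ^+ J)%:C.
Proof. by rewrite /binom_rem big_nat_recr //= opprD addrA subrK. Qed.

End BinomialExpansion.

(** * Limits of complex series, telescoping and geometric sums *)

Section ComplexLimits.
Variable R : realType.
Local Notation C := R[i].
Implicit Types (u : nat -> C) (z w l : C) (e : R).

Lemma cvg_csum u l : (series (u : nat -> C^o) @ \oo --> (l : C^o)) <-> csum u l.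
Proof.
split=> [h|/csumP h].
  apply/csumP => e e0.
  have e0' : 0 < e%:C by rewrite ltcR.
  have /cvgrPdist_lt/(_ _ e0')[N _ H] := h.
  exists N => n Nn; have := H n Nn; by rewrite /= nrmE ltcR.
apply/cvgrPdist_lt => e e0.
have eR : e = (complex.Re e)%:C by rewrite RRe_real // gtr0_real.
have e0' : 0 < complex.Re e by move: e0; rewrite {1}eR ltcR.
have [N hN] := h _ e0'; exists N => // n /= Nn.
by rewrite nrmE eR ltcR; exact: hN.
Qed.

Definition csum_lim u : C := xget 0 [set l | csum u l].

Lemma csum_limE u l : csum u l -> csum_lim u = l.
Proof.
move=> h; have hl : [set l | csum u l] l by [].
by apply: (csum_unique _ h); have := xgetPex 0 (ex_intro _ l hl).
Qed.

Lemma csum_telescope (f : nat -> C) :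
  (forall e, 0 < e -> exists N, forall n, (N <= n)%N -> nrm (f n) < e) ->
  csum (fun n => f n.+1 - f n) (- f 0%N).
Proof.
move=> h; apply/csumP => e e0; have [N hN] := h e e0; exists N => n Nn.
by rewrite (telescope_sumr f) // opprB addrA addNr add0r nrmN; exact: hN.
Qed.

Lemma rpw_lt n y e : 0 < y -> 0 < e -> expR (- ln e / y) < n.+1%:R -> rpw n y < e.
Proof.
move=> y0 e0 h; rewrite -[ltRHS](lnK e0) /rpw ltr_expR ltrNl mulrC.
rewrite -ltr_pdivrMr // -ltr_expR lnK ?posrE //.
Qed.

Lemma rpw_cvg0 y e : 0 < y -> 0 < e -> exists N, forall n, (N <= n)%N -> rpw n y < e.
Proof.
move=> y0 e0; exists (Num.truncn (expR (- ln e / y))) => n Nn; apply: rpw_lt => //.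
apply: lt_le_trans (truncnS_gt _) _; by rewrite ler_nat ltnS.
Qed.

Lemma csum_geometric w : nrm w < 1 -> csum (fun j => w ^+ j) (1 - w)^-1.
Proof.
move=> w1; have w1' : 1 - w != 0.
  by apply: contraTneq w1 => /eqP; rewrite subr_eq0 => /eqP <-; rewrite nrm1 ltxx.
have H : csum (fun j => w ^+ j.+1 - w ^+ j) (- 1).
  rewrite -(expr0 w); apply: csum_telescope => e e0.
  have : `|nrm w| < 1 by rewrite ger0_norm ?nrm_ge0.
  move=> /(cvg_geometric 1) /cvgrPdist_lt /(_ e e0) [N _ hN]; exists N => n Nn.
  have := hN n Nn; rewrite /= sub0r normrN nrmX mul1r.
  by rewrite ger0_norm // exprn_ge0 // nrm_ge0.
have := csumZ (- (1 - w)^-1) H; rewrite mulrN1 opprK; congr (csum _ _).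
apply/funext => j; by rewrite exprS; field.
Qed.

End ComplexLimits.

(** * Meromorphic continuation of the zeta function *)

Section Meromorphy.
Variable R : realType.
Local Notation C := R[i].
Implicit Types (f g : C -> C) (p z w : C) (rho M : R).

(** The Wiener form of [laurent_at]. The exponent [k.+1] is taken from there, so even a regular
    function is multiplied by a factor [z - p]. *)
Definition mero_at f p := exists rho k h M,
  [/\ 0 < rho, wiener p rho h M &
   forall z, 0 < nrm (z - p) <= rho -> h z = (z - p) ^+ k.+1 * f z].

Lemma min_le_l (x y : R) : 0 < x -> 0 < y -> 0 <= Num.min x y <= x.
Proof. by move=> x0 y0; rewrite le_min ge_min lexx andbT; apply/andP; split; exact: ltW. Qed.

Lemma min_le_r (x y : R) : 0 < x -> 0 < y -> 0 <= Num.min x y <= y.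
Proof. by move=> x0 y0; rewrite minC min_le_l. Qed.

Lemma mero_at_eq f g p e : 0 < e ->
  (forall z, 0 < nrm (z - p) <= e -> f z = g z) -> mero_at f p -> mero_at g p.
Proof.
move=> e0 fg [rho [k [h [M [r0 hM hf]]]]].
exists (Num.min rho e), k, h, M; split; first by rewrite lt_min r0.
  by apply: wiener_sub hM _; exact: min_le_l.
move=> z /andP[z0]; rewrite le_min => /andP[zr ze].
by rewrite hf ?z0 // fg // z0.
Qed.

Lemma mero_at_wiener f p rho M : 0 < rho -> wiener p rho f M -> mero_at f p.
Proof.
move=> r0 hf; exists rho, 0%N, (fun z => (z - p) * f z), ((nrm p + rho + nrm p) * M).
split => //.
apply: wienerM hf; first exact: ltW.
by apply: wienerB; [exact/wiener_id/ltW|exact: wiener_cst].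
Qed.

Lemma mero_at_cst w p : mero_at (fun=> w) p.
Proof. exact: (mero_at_wiener ltr01 (wiener_cst p 1 w)). Qed.

Lemma wiener_subX p rho n : 0 <= rho -> exists M, wiener p rho (fun z => (z - p) ^+ n) M.
Proof.
move=> r0; eexists; apply: wienerX => //.
by apply: wienerB; [exact: wiener_id|exact: wiener_cst].
Qed.

Lemma mero_atM f g p : mero_at f p -> mero_at g p -> mero_at (fun z => f z * g z) p.
Proof.
move=> [r [k [h [M [r0 hM hf]]]]] [r' [k' [h' [M' [r'0 hM' hg]]]]].
pose m := Num.min r r'.
have m0 : 0 < m by rewrite lt_min r0.
exists m, (k + k').+1, (fun z => h z * h' z), (M * M'); split => //.
  apply: wienerM; first exact: ltW.
    by apply: wiener_sub hM _; exact: min_le_l.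
  by apply: wiener_sub hM' _; exact: min_le_r.
move=> z /andP[z0]; rewrite le_min => /andP[zr zr'].
by rewrite hf ?z0 // hg ?z0 // mulrACA -exprD addSn addnS.
Qed.

Lemma mero_atD f g p : mero_at f p -> mero_at g p -> mero_at (fun z => f z + g z) p.
Proof.
move=> [r [k [h [M [r0 hM hf]]]]] [r' [k' [h' [M' [r'0 hM' hg]]]]].
pose m := Num.min r r'.
have m0 : 0 < m by rewrite lt_min r0.
have [L hL] := wiener_subX p k'.+1 (ltW m0).
have [L' hL'] := wiener_subX p k.+1 (ltW m0).
exists m, (k + k').+1, (fun z => (z - p) ^+ k'.+1 * h z + (z - p) ^+ k.+1 * h' z),
  (L * M + L' * M'); split => //.
  apply: wienerD; apply: wienerM => //; try exact: ltW.
    by apply: wiener_sub hM _; exact: min_le_l.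
  by apply: wiener_sub hM' _; exact: min_le_r.
move=> z /andP[z0]; rewrite le_min => /andP[zr zr'].
rewrite hf ?z0 // hg ?z0 // !mulrA -!exprD !addnS !addSn [(k' + k)%N]addnC.
by rewrite -mulrDr.
Qed.

Lemma mero_at_sum (F : nat -> C -> C) m n p :
  (forall i, (m <= i < n)%N -> mero_at (F i) p) ->
  mero_at (fun z => \sum_(m <= i < n) F i z) p.
Proof.
elim: n => [|n IH] h.
  apply: (mero_at_eq ltr01 _ (mero_at_cst 0 p)) => z _; by rewrite big_geq.
case: (leqP m n) => mn; last first.
  by apply: (mero_at_eq ltr01 _ (mero_at_cst 0 p)) => z _; rewrite big_geq.
have h1 : mero_at (fun z => \sum_(m <= i < n) F i z) p.
  by apply: IH => i /andP[mi ni]; apply: h; rewrite mi ltnW.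
have h2 : mero_at (F n) p by apply: h; rewrite mn /=.
by apply: (mero_at_eq ltr01 _ (mero_atD h1 h2)) => z _; rewrite big_nat_recr.
Qed.

Lemma mero_at_translate f p w : mero_at f (p + w) -> mero_at (fun z => f (z + w)) p.
Proof.
move=> [r [k [h [M [r0 hM hf]]]]].
exists r, k, (fun z => h (z + w)), M; split => //; first exact: wiener_translate.
have e z : z - p = z + w - (p + w) by rewrite opprD addrACA subrr addr0.
by move=> z; rewrite e => /hf.
Qed.

(** A geometric series in [(z - p) / d] with [d = p - w]; up to half the distance to [w] its ratio
    is at most 1/2, whence the norm [2 / |d|]. *)
Lemma wiener_inv p w : p != w -> exists2 rho, 0 < rho &
  exists M, wiener p rho (fun z => (z - w)^-1) M.
Proof.
move=> pw; set d := p - w; have d0 : d != 0 by rewrite subr_eq0.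
have nd : 0 < nrm d by rewrite lt_def nrm_eq0 d0 nrm_ge0.
exists (nrm d / 2); first by rewrite divr_gt0.
exists ((nrm d)^-1 * 2); apply: (@wiener_eq R p _ (fun z => d^-1 * (1 - - ((z - p) / d))^-1)); last first.
  move=> z hz; rewrite -invfM mulrBr mulr1 mulrN opprK mulrCA mulfV // mulr1.
  by rewrite /d addrC addrA subrK.
have := @wienerZ R p (nrm d / 2) (fun z => (1 - - ((z - p) / d))^-1) 2 d^-1.
rewrite nrmV; apply.
exists (fun j => (- d^-1) ^+ j).
  move=> n; apply: le_trans (_ : \sum_(0 <= j < n) (2^-1 : R) ^+ j <= _).
    apply: ler_sum => j _; rewrite -exprMn nrmX nrmM nrmN nrmV nrmR.
    rewrite ger0_norm ?divr_ge0 ?nrm_ge0 // mulrA mulVf ?mul1r //.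
    exact: lt0r_neq0.
  have := subrX1 (2^-1 : R) n; rewrite big_mkord => e.
  have : 0 <= (2^-1 : R) ^+ n by rewrite exprn_ge0.
  move: e; set S := \sum_(i < n) _; set T := _ ^+ n; lra.
move=> z hz; have := @csum_geometric R (- ((z - p) / d)).
have h : nrm (- ((z - p) / d)) < 1.
  rewrite nrmN nrmM nrmV ltr_pdivrMr // mul1r; apply: le_lt_trans hz _.
  by rewrite ltr_pdivrMr // mulr_natr mulr2n ltrDl.
move/(_ h); congr (csum _ _); apply/funext => j; rewrite -exprMn; congr (_ ^+ j).
by rewrite mulNr mulrC.
Qed.

Lemma mero_at_inv w p : mero_at (fun z => (z - w)^-1) p.
Proof.
case: (eqVneq p w) => [->|/wiener_inv[rho r0 [M hM]]]; last exact: mero_at_wiener hM.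
exists 1, 0%N, (fun=> 1), (nrm 1); split => //; first exact: wiener_cst.
move=> z /andP[z0 _]; rewrite expr1 mulfV //; apply: contraTneq z0 => ->.
by rewrite nrm0 ltxx.
Qed.

Lemma mero_at_binom_poly p i : mero_at (fun z => binom_poly i (1 - z)) p.
Proof.
have [M hM] := wiener_binom_poly p i ler01; exact: (mero_at_wiener ltr01 hM).
Qed.

Lemma mero_at_laurent f p : mero_at f p -> exists k c, laurent_at f p k c.
Proof.
move=> [r [k [h [M [r0 [c cM hc] hf]]]]]; exists k, c, r => // z.
rewrite nrmE !ltcR => /andP[z0 zr]; apply/cvg_csum; rewrite -hf ?z0 ?ltW //.
by apply: hc; exact: ltW.
Qed.

End Meromorphy.

(** * The Riemann zeta function and its pole at 1 *)

Section Zeta.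
Variable R : realType.
Local Notation C := R[i].
Implicit Types (p z w : C) (rho M : R).

Definition zeta_series z : C := if 1 < complex.Re z then csum_lim (npw (R := R) ^~ z) else 0.

(** The error of the [J]-term binomial expansion of [(n + 2) ^ (1 - z)] around [n + 1]. It has order
    [n ^ (1 - Re z - J)], hence the condition [2 < Re z + J] for summability. *)
Definition zrem J n z : C := npw n (z - 1) * binom_rem J n.+1%:R^-1 (1 - z).

Definition zrem_series J z : C := csum_lim (zrem J ^~ z).

Lemma ReB z w : complex.Re (z - w) = complex.Re z - complex.Re w.
Proof. by rewrite ReD ReN. Qed.

Lemma Re1 : complex.Re (1 : C) = 1. Proof. by []. Qed.

Lemma Re_nat n : complex.Re (n%:R : C) = n%:R.
Proof. by rewrite -(rmorph_nat (real_complex R)). Qed.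

Lemma zeta_series_wiener p : 1 < complex.Re p -> exists rho M,
  [/\ 0 < rho, wiener p rho zeta_series M &
   forall z, nrm (z - p) <= rho -> csum (npw (R := R) ^~ z) (zeta_series z)].
Proof.
move=> p1; pose rho := (complex.Re p - 1) / 2.
have r0 : 0 < rho by rewrite divr_gt0 // subr_gt0.
have [|M hM] := @rpw_summable R (complex.Re p - rho); first by rewrite /rho; lra.
have hw n := wiener_npw p n (ltW r0).
have hs z : nrm (z - p) <= rho -> csum (npw (R := R) ^~ z) (zeta_series z).
  move=> hz; have [l hl _] := wiener_series_exists hw hM hz.
  have z1 : 1 < complex.Re z.
    have := le_trans (nrm_Re _) hz; rewrite ReB ler_norml => /andP[h _].
    by move: h; rewrite /rho; lra.
  by rewrite /zeta_series z1 (csum_limE hl).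
exists rho, M; split => //; apply: (wiener_series (ltW r0) hw hM) => z hz.
exact: hs.
Qed.

Lemma csum_zeta_series z : 1 < complex.Re z -> csum (npw (R := R) ^~ z) (zeta_series z).
Proof.
by move=> /zeta_series_wiener[rho [M [r0 _]]]; apply; rewrite subrr nrm0 ltW.
Qed.

Lemma invSn_itv n : 0 < (n.+1%:R^-1 : R) <= 1.
Proof. by rewrite invr_gt0 ltr0Sn /= invf_le1 // ler1n. Qed.

Lemma zrem_wiener J p : 2 < complex.Re p + J%:R -> exists rho M,
  [/\ 0 < rho, wiener p rho (zrem_series J) M &
   forall z, nrm (z - p) <= rho -> csum (zrem J ^~ z) (zrem_series J z)].
Proof.
move=> p2; pose rho := (complex.Re p + J%:R - 2) / 2.
have r0 : 0 < rho by rewrite divr_gt0 // subr_gt0.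
have [K hK] := wiener_binom_rem p J (ltW r0).
have [|M hM] := @rpw_summable R (complex.Re p - 1 - rho + J%:R).
  by rewrite /rho; lra.
have hw n : wiener p rho (zrem J n) (K * rpw n (complex.Re p - 1 - rho + J%:R)).
  have h1 : wiener p rho (fun z => npw n (z - 1)) (rpw n (complex.Re p - 1 - rho)).
    by apply: wiener_translate; rewrite -Re1 -ReB; exact/wiener_npw/ltW.
  apply: wiener_le (wienerM (ltW r0) h1 (hK _ (invSn_itv n))) _.
  by rewrite (rpwD n _ J%:R) rpw_nat exprVn mulrCA.
have K0 : 0 <= K by have := wiener_ge0 (hw 0%N); rewrite rpw0l mulr1.
have hM' N : \sum_(0 <= n < N) K * rpw n (complex.Re p - 1 - rho + J%:R) <= K * M.
  by rewrite -mulr_sumr ler_wpM2l.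
have hs z : nrm (z - p) <= rho -> csum (zrem J ^~ z) (zrem_series J z).
  move=> hz; have [l hl _] := wiener_series_exists hw hM' hz.
  by rewrite /zrem_series (csum_limE hl).
exists rho, (K * M); split => //; apply: (wiener_series (ltW r0) hw hM') => z hz.
exact: hs.
Qed.

Lemma csum_zrem J z : 2 < complex.Re z + J%:R -> csum (zrem J ^~ z) (zrem_series J z).
Proof.
by move=> /zrem_wiener[rho [M [r0 _]]]; apply; rewrite subrr nrm0 ltW.
Qed.

Lemma invSn_npw n i : ((n.+1%:R^-1 : R) ^+ i)%:C = npw n i%:R.
Proof. by rewrite npw_nat exprVn. Qed.

Lemma npw_succ n w : npw n.+1 w = npw n w * cexp (- w * (ln (1 + n.+1%:R^-1))%:C).
Proof.
rewrite /npw -cexpD; congr cexp; rewrite mulNr -mulrN -mulrDr; congr (_ * _).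
rewrite -!rmorphN -rmorphD; congr (_%:C) => /=.
have n0 : 0 < n.+1%:R :> R by [].
have -> : n.+2%:R = n.+1%:R * (1 + n.+1%:R^-1) :> R.
  by rewrite mulrDr mulr1 mulfV ?lt0r_neq0 // natr1.
by rewrite lnM ?opprD // posrE // addr_gt0 // invr_gt0.
Qed.

Lemma csum_big (u : nat -> nat -> C) (l : nat -> C) m n :
  (forall i, (m <= i < n)%N -> csum (u i) (l i)) ->
  csum (fun k => \sum_(m <= i < n) u i k) (\sum_(m <= i < n) l i).
Proof.
elim: n => [|n IH] h.
  rewrite big_geq // (_ : (fun k => _) = fun=> 0); first exact: csum0.
  by apply/funext => k; rewrite big_geq.
case: (leqP m n) => mn; last first.
  rewrite big_geq // (_ : (fun k => _) = fun=> 0); first exact: csum0.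
  by apply/funext => k; rewrite big_geq.
rewrite big_nat_recr //= (_ : (fun k => _) = fun k => \sum_(m <= i < n) u i k + u n k).
  apply: csumD; last by apply: h; rewrite mn /=.
  by apply: IH => i /andP[mi ni]; apply: h; rewrite mi ltnW.
by apply/funext => k; rewrite big_nat_recr.
Qed.

(* telescoping [(n+2)^(1-z) - (n+1)^(1-z)] and expanding the differences *)
Lemma zeta_series_eq J z : 1 < complex.Re z -> (2 <= J)%N ->
  (z - 1) * zeta_series z =
  1 + \sum_(2 <= i < J) binom_poly i (1 - z) * zeta_series (z + i%:R - 1) + zrem_series J z.
Proof.
move=> z1 J2.
have h0 : csum (fun n => npw n.+1 (z - 1) - npw n (z - 1)) (- 1).
  have := @csum_telescope R (fun n => npw n (z - 1)).
  have -> : npw 0 (z - 1) = 1 by rewrite /npw ln1 oppr0 rmorph0 mulr0 cexp0.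
  apply => e e0.
  have z10 : 0 < complex.Re (z - 1) by rewrite ReB subr_gt0.
  have [N hN] := rpw_cvg0 z10 e0; exists N => n Nn; rewrite nrm_npw; exact: hN.
have h1 : csum (fun n => (1 - z) * npw n z) ((1 - z) * zeta_series z).
  by apply: csumZ; exact: csum_zeta_series.
have h2 : csum (fun n => \sum_(2 <= i < J) binom_poly i (1 - z) * npw n (z + i%:R - 1))
    (\sum_(2 <= i < J) binom_poly i (1 - z) * zeta_series (z + i%:R - 1)).
  apply: csum_big => i /andP[i2 _]; apply: csumZ; apply: csum_zeta_series.
  rewrite ReB ReD Re_nat Re1; have : 2 <= i%:R :> R by rewrite ler_nat.
  by move=> ?; lra.
have h3 : csum (zrem J ^~ z) (zrem_series J z).
  apply: csum_zrem; have : 2 <= J%:R :> R by rewrite ler_nat.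
  by move=> ?; lra.
have := csumD (csumD h1 h2) h3.
have -> : (fun n => (1 - z) * npw n z +
    \sum_(2 <= i < J) binom_poly i (1 - z) * npw n (z + i%:R - 1) + zrem J n z) =
    (fun n => npw n.+1 (z - 1) - npw n (z - 1)).
  apply/funext => n; rewrite npw_succ opprB /zrem /binom_rem.
  set E := cexp _; set P := npw n (z - 1).
  have -> : \sum_(0 <= i < J) binom_poly i (1 - z) * (n.+1%:R^-1 ^+ i)%:C =
     1 + ((1 - z) * npw n 1 + \sum_(2 <= i < J) binom_poly i (1 - z) * npw n i%:R).
    case: J J2 {h2 h3} => [|[|J]] // _; rewrite big_ltn // big_ltn // binom_poly0 binom_poly1 expr0 mulr1.
    rewrite invSn_npw; congr (1 + (_ + _)); apply: eq_bigr => i _.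
    by rewrite invSn_npw.
  have -> : npw n z = P * npw n 1 by rewrite /P -npwD subrK.
  have -> : \sum_(2 <= i < J) binom_poly i (1 - z) * npw n (z + i%:R - 1) =
     P * \sum_(2 <= i < J) binom_poly i (1 - z) * npw n i%:R.
    rewrite mulr_sumr; apply: eq_bigr => i _; rewrite /P [RHS]mulrCA -npwD.
    by congr (_ * npw n _); ring.
  set S := \sum_(2 <= i < J) _; ring.
move=> h4; have := csum_unique h0 h4.
set S := \sum_(2 <= i < J) _ => e.
have -> : (z - 1) * zeta_series z = - ((1 - z) * zeta_series z) by ring.
apply/eqP; rewrite -subr_eq0; apply/eqP; move: e.
set X := (1 - z) * zeta_series z; set Y := zrem_series J z => e.
have -> : - X - (1 + S + Y) = - (1 + (X + S + Y)) by ring.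
by rewrite -e subrr oppr0.
Qed.

(** Takes one more term of the expansion out of the remainder; this is why continuations built with
    different numbers of terms agree. *)
Lemma rsumS_shift J z : 2 < complex.Re z + J%:R ->
  zrem_series J z = binom_poly J (1 - z) * zeta_series (z + J%:R - 1) + zrem_series J.+1 z.
Proof.
move=> zJ; apply: csum_limE.
have h1 : csum (fun n => binom_poly J (1 - z) * npw n (z + J%:R - 1))
    (binom_poly J (1 - z) * zeta_series (z + J%:R - 1)).
  by apply: csumZ; apply: csum_zeta_series; rewrite ReB ReD Re_nat Re1; lra.
have h2 : csum (zrem J.+1 ^~ z) (zrem_series J.+1 z).
  by apply: csum_zrem; rewrite -natr1; lra.
have := csumD h1 h2; congr (csum _ _); apply/funext => n.
rewrite /zrem [in RHS]binom_remS [RHS]mulrDr [RHS]addrC; congr (_ + _).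
by rewrite [RHS]mulrCA invSn_npw -npwD; congr (_ * npw n _); ring.
Qed.

(* [zetaK K] continues [zeta_series] to the half-plane [1 - K < Re z]. *)
Fixpoint zetaK (K : nat) z : C :=
  if K is K'.+1 then
    (1 + \sum_(2 <= i < K.+2) binom_poly i (1 - z) * zetaK K' (z + i%:R - 1)
       + zrem_series K.+2 z) / (z - 1)
  else zeta_series z.

Arguments zetaK : simpl never.

Lemma zetaKS K z : zetaK K.+1 z =
  (1 + \sum_(2 <= i < K.+3) binom_poly i (1 - z) * zetaK K (z + i%:R - 1)
     + zrem_series K.+3 z) / (z - 1).
Proof. by []. Qed.

Lemma zeta_series_div J z : 1 < complex.Re z -> (2 <= J)%N -> zeta_series z =
  (1 + \sum_(2 <= i < J) binom_poly i (1 - z) * zeta_series (z + i%:R - 1) + zrem_series J z) / (z - 1).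
Proof.
move=> z1 J2; rewrite -zeta_series_eq // mulrC mulrA mulVf ?mul1r // subr_eq0.
by apply: contraTneq z1 => ->; rewrite Re1 ltxx.
Qed.

(** The two claims are proved together: raising [K] adds one summand, and [rsumS_shift] accounts for
    it only once [zetaK] is known to be the convergent series at that argument. *)
Lemma zetaK_cons K :
  (forall z, 1 < complex.Re z + K%:R -> zetaK K.+1 z = zetaK K z) /\
  (forall z, 1 < complex.Re z -> zetaK K z = zeta_series z).
Proof.
elim: K => [|K [IH1 IH2]].
  by split => // z; rewrite addr0 zetaKS -/(zeta_series _) => z1; exact/esym/zeta_series_div.
have h2 z : 1 < complex.Re z -> zetaK K.+1 z = zeta_series z.
  by move=> z1; rewrite IH1 ?IH2 // ltr_wpDr.
split => // z zK; rewrite zetaKS [RHS]zetaKS; congr (_ / _).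
rewrite [in LHS]big_nat_recr // [X in _ = _ + X]rsumS_shift; last first.
  by move: zK; rewrite -!natr1; lra.
(* The sum starts at [i = 2], so the shift by [i - 1] gains at least one unit, which pays for the
   passage from [K.+1] to [K]. *)
have Ri (i : nat) : (2 <= i)%N -> 1 < complex.Re (z + i%:R - 1) + K%:R.
  move=> i2; rewrite ReB ReD Re_nat Re1.
  have : 2 <= i%:R :> R by rewrite ler_nat.
  by move: zK; rewrite -natr1; lra.
rewrite [RHS]addrA; congr (_ + _); rewrite [LHS]addrA; congr (1 + _ + _).
  by apply: eq_big_nat => i /andP[i2 _]; rewrite IH1 // Ri.
congr (_ * _); apply: h2; rewrite ReB ReD Re_nat Re1.
by move: zK; rewrite -!natr1; have : 0 <= K%:R :> R by []; lra.
Qed.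

Lemma zetaK_le K L z : (K <= L)%N -> 1 < complex.Re z + K%:R -> zetaK L z = zetaK K z.
Proof.
move=> /subnK <-; elim: (L - K)%N => [//|n IH] zK.
rewrite addSn (zetaK_cons _).1 ?IH //; apply: lt_le_trans zK _.
by rewrite lerD2l ler_nat leq_addl.
Qed.

Lemma zetaK_mero K p : 1 < complex.Re p + K%:R -> mero_at (zetaK K) p.
Proof.
elim: K p => [|K IH] p pK.
  move: pK; rewrite addr0 => /zeta_series_wiener[rho [M [r0 hM _]]]; exact: mero_at_wiener hM.
apply: mero_atM; last exact: mero_at_inv.
apply: mero_atD; last first.
  have [|rho [M [r0 hM _]]] := @zrem_wiener K.+3 p; last exact: mero_at_wiener hM.
  by move: pK; rewrite -!natr1; lra.
apply: mero_atD; first exact: mero_at_cst.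
apply: mero_at_sum => i /andP[i2 _]; apply: mero_atM; first exact: mero_at_binom_poly.
rewrite (_ : (fun z => _) = fun z => zetaK K (z + (i%:R - 1))); last first.
  by apply/funext => z; rewrite addrA.
apply: mero_at_translate; apply: IH; rewrite ReD ReB Re_nat Re1.
have : 2 <= i%:R :> R by rewrite ler_nat.
by move: pK; rewrite -natr1; lra.
Qed.

(** All [K] with [1 < Re z + K] give the same value, by [zetaE]; this is one admissible choice. *)
Definition zeta z : C := zetaK (Num.truncn (3 - complex.Re z)) z.

Lemma zetaE K z : 1 < complex.Re z + K%:R -> zeta z = zetaK K z.
Proof.
move=> zK; rewrite /zeta; set L := Num.truncn _.
have zL : 1 < complex.Re z + L%:R.
  by have := truncnS_gt (3 - complex.Re z); rewrite -/L -natr1; lra.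
case: (leqP L K) => h; first by rewrite -(zetaK_le h zL).
by rewrite (zetaK_le (ltnW h) zK).
Qed.

Lemma zeta_zeta_series z : 1 < complex.Re z -> zeta z = zeta_series z.
Proof. by move=> z1; rewrite (zetaE (K := 0)) // addr0. Qed.

Lemma zeta_mero p : mero_at zeta p.
Proof.
(* Large enough for the same [K] to serve on the whole disc of radius 1 around [p]. *)
pose K := Num.truncn (4 - complex.Re p).
have pK : 3 < complex.Re p + K%:R.
  by have := truncnS_gt (4 - complex.Re p); rewrite -/K -natr1; lra.
apply: (mero_at_eq ltr01 _ (zetaK_mero (K := K) (p := p) _)); last by lra.
move=> z /andP[_ z1]; rewrite (zetaE (K := K)) //.
have := le_trans (nrm_Re _) z1; rewrite ReB ler_norml => /andP[h _]; lra.
Qed.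

(** With [J = 2] the sum in the functional relation is empty and
    [(z - 1) * zeta z = 1 + zrem_series 2 z]. The remainder vanishes at [z = 1], where the exponent
    [1 - z] is 0. *)
Lemma zeta_pole : exists rho M h,
  [/\ 0 < rho, wiener 1 rho h M,
      (forall z, 0 < nrm (z - 1) <= rho -> h z = (z - 1) * zeta z) & h 1 = 1].
Proof.
have [|rho [M [r0 hM hs]]] := @zrem_wiener 2 1; first by rewrite Re1; lra.
pose h z := 1 + zrem_series 2 z.
have r1 : wiener 1 rho h (nrm 1 + M) by apply: wienerD => //; exact: wiener_cst.
have h0 : (0 : R) < 2^-1 by rewrite invr_gt0.
exists (Num.min rho 2^-1), (nrm 1 + M), h; split.
- by rewrite lt_min r0.
- by apply: wiener_sub r1 _; exact: min_le_l.
- move=> z; rewrite le_min => /and3P[z0 zr z2].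
  have z1 : 2^-1 <= complex.Re z.
    have := le_trans (nrm_Re _) z2; rewrite ReB Re1 ler_norml => /andP[h1 _]; lra.
  rewrite (zetaE (K := 1)); last by lra.
  rewrite zetaKS mulrC mulfVK; last by rewrite -nrm_eq0 gt_eqF.
  by rewrite /h (rsumS_shift (J := 2)) ?big_nat1 ?addrA //; lra.
rewrite /h -[RHS]addr0; congr (_ + _); apply: csum_limE.
rewrite (_ : zrem 2 ^~ 1 = fun=> 0); first exact: csum0.
by apply/funext => n; rewrite /zrem !subrr binom_rem0 mulr0.
Qed.

End Zeta.

(** * Residues of Dirichlet series *)

Section PowerSeriesUniqueness.
Variable R : realType.
Local Notation C := R[i].
Implicit Types (u e : nat -> C) (F h : C -> C) (p z w l : C) (r t rho M : R).

Lemma csum_bounded u l : csum u l -> exists M, forall n, nrm (u n) <= M.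
Proof.
move=> /csumP/(_ 1 ltr01)[N hN].
exists (2 + \sum_(0 <= i < N) nrm (u i)) => n; case: (ltnP n N) => nN.
  apply: le_trans (_ : \sum_(0 <= i < N) nrm (u i) <= _); last by rewrite lerDr.
  rewrite (big_cat_nat (n := n.+1)) //= big_nat_recr //= -addrA.
  rewrite addrCA lerDl addr_ge0 // sumr_ge0 // => i _; exact: nrm_ge0.
apply: ler_wpDr; first by apply: sumr_ge0 => i _; exact: nrm_ge0.
have h1 := hN n nN; have h2 := hN n.+1 (leqW nN).
have -> : u n = (l - \sum_(0 <= i < n) u i) - (l - \sum_(0 <= i < n.+1) u i).
  by rewrite big_nat_recr //=; ring.
by apply: le_trans (nrmB _ _) _; lra.
Qed.

(** Convergence at one point [t0] bounds the terms by [M]. At [t0 * x] the terms after the first are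
    at most [M x ^ n], so they add up to at most [2 M x], which is arbitrarily small. *)
Lemma pseries0_coef0 e r : 0 < r ->
  (forall t, 0 < t < r -> csum (fun n => e n * t%:C ^+ n) 0) -> e 0%N = 0.
Proof.
move=> r0 h; pose t0 := r / 2.
have t00 : 0 < t0 by rewrite divr_gt0.
have t0r : 0 < t0 < r by rewrite t00 /t0; lra.
have [M hM] := csum_bounded (h t0 t0r).
have M0 : 0 <= M by apply: le_trans (hM 0%N); exact: nrm_ge0.
have key x : 0 < x <= 2^-1 -> nrm (e 0%N) <= 2 * M * x.
  move=> /andP[x0 x1]; have tr : 0 < t0 * x < r.
    rewrite mulr_gt0 //=; apply: le_lt_trans (_ : t0 < _); last by case/andP: t0r.
    by rewrite ler_piMr ?(ltW t00) //; lra.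
  have := csum_tail 1 (h _ tr); rewrite big_nat1 expr0 mulr1 sub0r => hs.
  rewrite -nrmN; apply: (csum_nrm hs) => n.
  apply: le_trans (_ : M * x * \sum_(0 <= i < n) x ^+ i <= _).
    rewrite mulr_sumr; apply: ler_sum => i _.
    rewrite rmorphM exprMn mulrA nrmM [nrm (_%:C ^+ _)]nrmX nrmR (gtr0_norm x0) addn1.
    rewrite -[leRHS]mulrA -exprS; apply: ler_wpM2r; last exact: hM.
    by apply: exprn_ge0; exact: ltW.
  rewrite mulrAC [2 * M]mulrC [X in _ <= X]mulrAC.
  rewrite -mulrA -[leRHS]mulrA; apply: ler_wpM2l => //.
  rewrite mulrC; apply: ler_wpM2l; first exact: ltW.
  have := subrX1 x n; rewrite big_mkord => eq1.
  have : 0 <= x ^+ n by rewrite exprn_ge0 // ltW.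
  have S0 : 0 <= \sum_(i < n) x ^+ i by apply: sumr_ge0 => i _; rewrite exprn_ge0 // ltW.
  move: eq1 S0; set S := \sum_(i < n) _; set T := x ^+ n => eq1 S0 T0.
  have xS : 0 <= (2^-1 - x) * S by rewrite mulr_ge0 // subr_ge0.
  have {}eq1 : T - 1 = x * S - S by rewrite eq1; ring.
  have {}xS : 0 <= 2^-1 * S - x * S by rewrite -mulrBl.
  move: eq1 xS; set Y := x * S; lra.
apply/eqP; rewrite -nrm_eq0 eq_le nrm_ge0 andbT leNgt; apply/negP => e0.
(* Chosen so that [2 M x] is smaller than [|e 0|], against [key]. *)
pose x := Num.min 2^-1 (nrm (e 0%N) / (2 * (2 * M + 1))).
have d0 : 0 < 2 * (2 * M + 1) by lra.
have h20 : (0 : R) < 2^-1 by rewrite invr_gt0.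
have x0 : 0 < x by rewrite lt_min h20 divr_gt0.
have := key x; rewrite x0 /= ge_min lexx => /(_ isT).
apply/negP; rewrite -ltNge.
have xle : x <= nrm (e 0%N) / (2 * (2 * M + 1)) by rewrite ge_min lexx orbT.
have : x * (2 * (2 * M + 1)) <= nrm (e 0%N) by rewrite -ler_pdivlMr.
by nra.
Qed.

Lemma pseries0_coef e r : 0 < r ->
  (forall t, 0 < t < r -> csum (fun n => e n * t%:C ^+ n) 0) -> forall n, e n = 0.
Proof.
move=> r0 h n; elim/ltn_ind: n => n IH.
apply: (@pseries0_coef0 (fun i => e (i + n)%N) r r0) => t tr.
have tn : t%:C ^+ n != 0.
  by rewrite expf_neq0 // eq_complex /= eqxx andbT gt_eqF //; case/andP: tr.
have := csumZ (t%:C ^+ n)^-1 (csum_tail n (h t tr)).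
rewrite big1_seq ?subrr ?mulr0; last first.
  by move=> i; rewrite mem_index_iota /= => /IH ->; rewrite mul0r.
congr (csum _ _); apply/funext => i; by rewrite exprD; field.
Qed.

(** An arbitrary extension is known only to the right of [p]. At the points [p + t] both the
    coefficients [c] and the Taylor coefficients of [(z - p) ^ k * h] represent
    [(z - p) ^ k.+1 * F], so they coincide, and those of index [k] are [c k] and [h p]. *)
Lemma laurent_residue F p k c h rho M : laurent_at F p k c ->
  0 < rho -> wiener p rho h M ->
  (forall z, complex.Re p < complex.Re z -> nrm (z - p) <= rho ->
     h z = (z - p) * F z) -> c k = h p.
Proof.
move=> [r r0 hF] rho0 [d dM hd] hh.
have -> : h p = d 0%N.
  have pp : nrm (p - p) <= rho by rewrite subrr nrm0 ltW.
  apply: (csum_unique (hd p pp)); rewrite subrr.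
  have := @csum_fin R (fun j => d j * 0 ^+ j) 1%N; rewrite big_nat1 expr0 mulr1; apply.
  by case=> // n _; rewrite exprS mul0r mulr0.
pose m := Num.min r rho; have m0 : 0 < m by rewrite lt_min r0.
pose d' n := if (n < k)%N then 0 else d (n - k)%N.
suff /(_ k) : forall n, c n - d' n = 0.
  by rewrite /d' ltnn subnn => /eqP; rewrite subr_eq0 => /eqP.
apply: (pseries0_coef m0) => t /andP[t0]; rewrite lt_min => /andP[tr trho].
pose z := p + t%:C; have zp : z - p = t%:C by rewrite /z addrC addrA addNr add0r.
have nz : nrm (z - p) = t by rewrite zp nrmR gtr0_norm.
have h1 : csum (fun n => c n * t%:C ^+ n) (t%:C ^+ k.+1 * F z).
  have := hF z; rewrite zp => h1; apply/cvg_csum; apply: h1.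
  by rewrite nrmE nrmR gtr0_norm // !ltcR t0.
have hz : h z = t%:C * F z.
  by rewrite -zp; apply: hh; rewrite ?nz ?ltW // /z ReD /= ltrDl.
have h2 : csum (fun n => d' n * t%:C ^+ n) (t%:C ^+ k.+1 * F z).
  have := @csum_shift R (fun n => d' n * t%:C ^+ n) (t%:C ^+ k.+1 * F z) k.
  rewrite big1_seq ?add0r; last first.
    by move=> i; rewrite mem_index_iota /= /d' => ->; rewrite mul0r.
  apply; rewrite exprSr -mulrA -hz.
  have hzr : nrm (z - p) <= rho by rewrite nz ltW.
  have := csumZ (t%:C ^+ k) (hd z hzr); rewrite zp; congr (csum _ _).
  apply/funext => n; rewrite /d' ltnNge leq_addl /= addnK exprD; ring.
have := csumB h1 h2; rewrite subrr; congr (csum _ _).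
by apply/funext => n; rewrite mulrBl.
Qed.

End PowerSeriesUniqueness.

(** * Dirichlet series with linear plus rapidly decreasing coefficients *)

Section DirichletSeries.
Variable R : realType.
Local Notation C := R[i].
Implicit Types (p z w : C) (u eps : nat -> C).

Definition rapid eps := forall J : nat, exists K, forall n, nrm (eps n) <= K * rpw n J%:R.

Definition dirichlet_series u z : C := csum_lim (fun n => u n * npw n z).

(** Rapid decrease compensates any negative real part: [J] is chosen so that the exponent
    [J + Re p - 1] on the unit disc around [p] exceeds 1. *)
Lemma dirichlet_series_wiener eps p : rapid eps -> exists M, wiener p 1 (dirichlet_series eps) M /\
  forall z, nrm (z - p) <= 1 -> csum (fun n => eps n * npw n z) (dirichlet_series eps z).
Proof.
move=> h; pose J := Num.truncn (3 - complex.Re p).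
have hJ : 2 < complex.Re p + J%:R.
  by have := truncnS_gt (3 - complex.Re p); rewrite -/J -natr1; lra.
have [K hK] := h J.
have [|M hM] := @rpw_summable R (J%:R + (complex.Re p - 1)); first by lra.
have K0 : 0 <= K by have := le_trans (nrm_ge0 _) (hK 0%N); rewrite rpw0l mulr1.
have hw n : wiener p 1 (fun z => eps n * npw n z) (K * rpw n (J%:R + (complex.Re p - 1))).
  apply: wiener_le (wienerZ (eps n) (wiener_npw p n ler01)) _.
  by rewrite (rpwD n J%:R) mulrA ler_wpM2r ?rpw_ge0.
have hM' N : \sum_(0 <= n < N) K * rpw n (J%:R + (complex.Re p - 1)) <= K * M.
  by rewrite -mulr_sumr ler_wpM2l.
have hs z : nrm (z - p) <= 1 -> csum (fun n => eps n * npw n z) (dirichlet_series eps z).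
  by move=> hz; have [l hl _] := wiener_series_exists hw hM' hz; rewrite /dirichlet_series (csum_limE hl).
by exists (K * M); split => //; apply: (wiener_series ler01 hw hM') => z; exact: hs.
Qed.

Definition zext (c0 c1 : C) eps z := c0 * zeta (z - 1) + c1 * zeta z + dirichlet_series eps z.

Lemma zext_mero c0 c1 eps p : rapid eps -> mero_at (zext c0 c1 eps) p.
Proof.
move=> h; have [M [hM _]] := dirichlet_series_wiener p h.
apply: mero_atD; last exact: mero_at_wiener hM.
apply: mero_atD; apply: mero_atM; try exact: mero_at_cst; last exact: zeta_mero.
exact/mero_at_translate/zeta_mero.
Qed.

Lemma csum_zext c0 c1 eps z : rapid eps -> 2 < complex.Re z ->
  csum (fun n => (c0 * n.+1%:R + c1 + eps n) * npw n z) (zext c0 c1 eps z).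
Proof.
move=> h z2; have [M [_ /(_ z)]] := dirichlet_series_wiener z h; rewrite subrr nrm0 => /(_ ler01) h3.
have r1 : 1 < complex.Re (z - 1) by rewrite ReB Re1; lra.
have r2 : 1 < complex.Re z by lra.
have := csumD (csumD (csumZ c0 (csum_zeta_series r1)) (csumZ c1 (csum_zeta_series r2))) h3.
rewrite -!zeta_zeta_series //; congr (csum _ _); apply/funext => n.
have -> : npw n (z - 1) = n.+1%:R * npw n z.
  have := npw_nat R n 1; rewrite expr1 => e1.
  have n0 : n.+1%:R != 0 :> C by rewrite pnatr_eq0.
  have -> : npw n z = npw n (z - 1) * npw n 1%:R by rewrite -npwD subrK.
  by rewrite e1 fmorphV /= rmorph_nat mulrCA mulfV ?mulr1.
ring.
Qed.

(** Of the three summands only [c0 * zeta (z - 1)] is singular at 2, and the residue 1 of [zeta] at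
    1 leaves [c0]. *)
Lemma zext_pole c0 c1 eps : rapid eps -> exists rho M h,
  [/\ 0 < rho, wiener 2 rho h M,
    (forall z, complex.Re (2 : C) < complex.Re z -> nrm (z - 2) <= rho ->
      h z = (z - 2) * zext c0 c1 eps z) & h 2 = c0].
Proof.
move=> he; have [r1 [M1 [h1 [r10 w1 e1 h11]]]] := zeta_pole R.
have [|r2 [M2 [r20 w2 _]]] := @zeta_series_wiener R 2; first by rewrite Re_nat; lra.
have [M3 [w3 _]] := dirichlet_series_wiener 2 he.
pose r := Num.min r1 (Num.min r2 1).
have r210 : 0 < Num.min r2 1 by rewrite lt_min r20 ltr01.
have r0 : 0 < r by rewrite lt_min r10.
have rr2 : 0 <= r <= r2.
  by rewrite ltW //= /r !ge_min lexx orbT.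
have rr3 : 0 <= r <= 1.
  by rewrite ltW //= /r !ge_min lexx !orbT.
have {}w2 := wiener_sub w2 rr2; have {}w3 := wiener_sub w3 rr3.
have {}w1 : wiener 2 r (fun z => h1 (z - 1)) M1.
  apply: wiener_translate; rewrite (_ : 2 - 1 = 1 :> C); last by ring.
  by apply: wiener_sub w1 _; exact: min_le_l.
have ws := wienerB (wiener_id 2 (ltW r0)) (wiener_cst 2 r (2 : C)).
pose h z := c0 * h1 (z - 1) + (z - 2) * (c1 * zeta_series z + dirichlet_series eps z).
have hw : wiener 2 r h (nrm c0 * M1 + (nrm 2 + r + nrm 2) * (nrm c1 * M2 + M3)).
  apply: (wienerD (wienerZ c0 w1)); apply: (wienerM (ltW r0) ws).
  exact: (wienerD (wienerZ c1 w2) w3).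
exists r, (nrm c0 * M1 + (nrm 2 + r + nrm 2) * (nrm c1 * M2 + M3)), h; split => //.
- move=> z; rewrite Re_nat => z2 zr.
  have z2n : z - 2 != 0.
    by apply: contraTneq z2 => /eqP; rewrite subr_eq0 => /eqP ->; rewrite Re_nat ltxx.
  rewrite /h /zext e1; last first.
    have -> : z - 1 - 1 = z - 2 by ring.
    rewrite lt_def nrm_ge0 nrm_eq0 z2n /=; apply: le_trans zr _.
    by rewrite ge_min lexx.
  rewrite (zeta_zeta_series (z := z)); last by lra.
  rewrite (_ : z - 1 - 1 = z - 2); last by ring.
  set a := zeta _; set b := zeta_series _; set d := dirichlet_series _ _; ring.
- rewrite /h subrr mul0r addr0 (_ : 2 - 1 = 1 :> C) ?h11 ?mulr1 //; ring.
Qed.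

Lemma dirichlet_residue c0 c1 eps F : rapid eps -> meromorphic F ->
  (forall z, 2 < complex.Re z -> F z = zext c0 c1 eps z) -> is_residue F 2 c0.
Proof.
move=> he /(_ 2)[k [c hc]] hF; have [r [M [h [r0 w e h2]]]] := zext_pole c0 c1 he.
exists k, c; split => //; rewrite -h2; apply: (laurent_residue hc r0 w) => z z2 zr.
by rewrite e // hF // -(Re_nat R 2).
Qed.

Lemma zext_meromorphic c0 c1 eps : rapid eps -> meromorphic (zext c0 c1 eps).
Proof. by move=> he p; exact/mero_at_laurent/zext_mero. Qed.

End DirichletSeries.

(** * A spanning set of the Podles sphere *)

Section PodlesSpan.
Variables (R : realType) (q s : R).
Hypothesis q0 : q != 0.
Local Notation P := (podles q s).
Local Notation A := (podA : P).
Local Notation B := (podB : P).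
Local Notation Bs := (pstar podB : P).
Implicit Types (a x y : P) (V : P -> Prop).

Definition lin_closed V := forall (c : R[i]) x y, V x -> V y -> V (c *: x + y).

Lemma lin_closed0 V x : lin_closed V -> V x -> V 0.
Proof. by move=> h hx; have := h (-1) x x hx hx; rewrite scaleN1r addNr. Qed.

Lemma lin_closedZ V c x : lin_closed V -> V x -> V (c *: x).
Proof. by move=> h hx; have h0 := lin_closed0 h hx; rewrite -[_ *: _]addr0; exact: h. Qed.

Lemma lin_closedD V x y : lin_closed V -> V x -> V y -> V (x + y).
Proof. by move=> h hx hy; rewrite -[x]scale1r; exact: h. Qed.

(** The linear span, encoded as membership in every linearly closed predicate that contains the
    monomials; instantiating [V] gives induction on the span. *)
Definition inspan a := forall V, lin_closed V ->
  (forall j k, V (A ^+ j * B ^+ k)) -> (forall j k, V (A ^+ j * Bs ^+ k)) -> V a.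

Lemma inspan_lin : lin_closed inspan.
Proof. by move=> c x y hx hy V lV h1 h2; apply: (lV); [exact: hx|exact: hy]. Qed.

Lemma inspan_B j k : inspan (A ^+ j * B ^+ k).
Proof. by move=> V _ h _. Qed.

Lemma inspan_Bs j k : inspan (A ^+ j * Bs ^+ k).
Proof. by move=> V _ _ h. Qed.

Lemma inspan_mul a : (forall j k, inspan (a * (A ^+ j * B ^+ k))) ->
  (forall j k, inspan (a * (A ^+ j * Bs ^+ k))) -> forall x, inspan x -> inspan (a * x).
Proof.
move=> h1 h2 x hx; apply: (hx (fun x => inspan (a * x))); [|exact: h1|exact: h2].
by move=> c y z hy hz; rewrite mulrDr -scalerAr; exact: inspan_lin.
Qed.

Let qq := (q ^+ 2)%:C : R[i].

Let qq0 : qq != 0.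
Proof. by rewrite /qq eq_complex /= eqxx andbT expf_neq0. Qed.

Lemma BsA : Bs * A = qq *: (A * Bs).
Proof.
have := congr1 (@pstar R q s) (podles_AB q s).
by rewrite pstarZ !pstarM pstar_podA conj_realC.
Qed.

Lemma BA : B * A = qq^-1 *: (A * B).
Proof. by rewrite podles_AB scalerA mulVf ?scale1r. Qed.

Lemma BAX j : B * A ^+ j = (qq^-1) ^+ j *: (A ^+ j * B).
Proof.
elim: j => [|j IH]; first by rewrite !expr0 mulr1 mul1r scale1r.
by rewrite !exprS [LHS]mulrA BA -scalerAl -[A * B * _]mulrA IH -scalerAr scalerA mulrA.
Qed.

Lemma BsAX j : Bs * A ^+ j = qq ^+ j *: (A ^+ j * Bs).
Proof.
elim: j => [|j IH]; first by rewrite !expr0 mulr1 mul1r scale1r.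
by rewrite !exprS [LHS]mulrA BsA -scalerAl -[A * Bs * _]mulrA IH -scalerAr scalerA mulrA.
Qed.

Lemma BBsE : B * Bs = (-1) *: A ^+ 2 + ((1 - s ^+ 2)%:C *: A + (s ^+ 2)%:C *: 1).
Proof.
have /eqP := podles_BBs q s; rewrite addr_eq0 => /eqP ->.
rewrite mulrDl !mulrBr !mulr1 -scalerAl mul1r -expr2 scaleN1r rmorphB /= scalerBl scale1r.
by rewrite !opprD !opprK; set x := _ *: A; set y := _ *: 1; set z := A ^+ 2;
  rewrite -!addrA; congr (_ + _); congr (_ + _).
Qed.

Lemma BsBE : Bs * B =
  (- qq ^+ 2) *: A ^+ 2 + ((qq * (1 - s ^+ 2)%:C) *: A + (s ^+ 2)%:C *: 1).
Proof.
have /eqP := podles_BsB q s; rewrite addr_eq0 => /eqP ->; rewrite -/qq.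
rewrite mulrDl !mulrBr !mulr1 -!scalerAl -!scalerAr mul1r -expr2 scalerA -expr2.
rewrite rmorphB /= mulrBr mulr1 scalerBl scaleNr scalerA [(s ^+ 2)%:C * qq]mulrC.
by rewrite !opprD !opprK -!addrA; congr (_ + _); congr (_ + _).
Qed.

Lemma quad_span j (w : P) (c1 c2 c3 : R[i]) V : lin_closed V ->
  (forall i, V (A ^+ i * w)) ->
  V (A ^+ j * (c1 *: A ^+ 2 + (c2 *: A + c3 *: 1)) * w).
Proof.
move=> lV hV; rewrite !mulrDr !mulrDl -!scalerAr -!scalerAl mulr1 -exprSr -exprD.
by apply: (lV) => //; apply: (lV) => //; exact: lin_closedZ.
Qed.

(** The span contains 1 and is stable under left multiplication by the generators: powers of [A] are
    moved to the left by q-commutation, and a product of [B] with its adjoint, in either order, is a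
    quadratic polynomial in [A]. *)
Lemma podles_span a : inspan a.
Proof.
have hA : forall x, inspan x -> inspan (A * x).
  by apply: inspan_mul => j k; rewrite mulrA -exprS; [exact: inspan_B|exact: inspan_Bs].
have hB : forall x, inspan x -> inspan (B * x).
  apply: inspan_mul => j k; rewrite mulrA BAX -scalerAl; apply: (lin_closedZ _ inspan_lin).
    by rewrite -mulrA -exprS; exact: inspan_B.
  case: k => [|k]; first by rewrite expr0 mulr1 -[B]expr1; exact: inspan_B.
  rewrite exprS mulrA -(mulrA _ B) BBsE; apply: quad_span; first exact: inspan_lin.
  by move=> i; exact: inspan_Bs.
have hBs : forall x, inspan x -> inspan (Bs * x).
  apply: inspan_mul => j k; rewrite mulrA BsAX -scalerAl; apply: (lin_closedZ _ inspan_lin).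
    case: k => [|k]; first by rewrite expr0 mulr1 -[Bs]expr1; exact: inspan_Bs.
    rewrite exprS mulrA -(mulrA _ Bs) BsBE; apply: quad_span; first exact: inspan_lin.
    by move=> i; exact: inspan_B.
  by rewrite -mulrA -exprS; exact: inspan_Bs.
have h1 : inspan 1 by have := inspan_B 0 0; rewrite !expr0 mulr1.
(* Induction on a term acting by left multiplication on an arbitrary element of the span; the claim
   is the action on 1. *)
rewrite -[a]mulr1; elim/podlesW : a 1 h1 => t.
elim: t => [||| c | t1 IH1 t2 IH2 | t1 IH1 t2 IH2] x hx.
- exact: hA.
- exact: hB.
- by rewrite pi_TBs; exact: hBs.
- by rewrite pi_TCst -scalerAl mul1r; exact: (lin_closedZ _ inspan_lin).
- by rewrite pi_TAdd mulrDl; apply: (lin_closedD inspan_lin); [exact: IH1|exact: IH2].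
- by rewrite pi_TMul -mulrA; apply: IH1; exact: IH2.
Qed.

End PodlesSpan.

(** * Mean values of trigonometric polynomials *)

Section CircleMean.
Variable R : realType.
Local Notation C := R[i].
Implicit Types (f : R -> C) (g F : R -> R) (c : C) (k : nat).
Local Notation mu := (@lebesgue_measure R).
Local Notation I2pi := (`[0%R, (2 * pi)%R]%classic : set R).

(** Integrability is carried along because additivity of the integral requires it. *)
Definition rmean g v := mu.-integrable I2pi (EFin \o g) /\ Rintegral mu I2pi g = v.

Definition cmean f c :=
  rmean (fun x => complex.Re (f x)) (2 * pi * complex.Re c) /\
  rmean (fun x => complex.Im (f x)) (2 * pi * complex.Im c).

Let mI : measurable (I2pi : set (measurableTypeR R)).
Proof. exact: measurable_itv. Qed.

Lemma rmeanD g1 g2 v1 v2 : rmean g1 v1 -> rmean g2 v2 ->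
  rmean (fun x => g1 x + g2 x) (v1 + v2).
Proof.
move=> [i1 <-] [i2 <-]; split; last exact: RintegralD.
exact: (integrableD mI i1 i2).
Qed.

Lemma rmeanZ r g v : rmean g v -> rmean (fun x => r * g x) (r * v).
Proof.
move=> [i1 <-]; split; last exact: RintegralZl.
exact: (integrableZl mI r i1).
Qed.

Lemma rmean_cst r : rmean (fun=> r) (2 * pi * r).
Proof.
split.
  apply: continuous_compact_integrable; first exact: segment_compact.
  by move=> x; exact: cvg_cst.
have h := lebesgue_measure_itv (`[0, 2 * pi] : interval R).
rewrite /= lte_fin mulr_gt0 ?pi_gt0 //= oppr0 adde0 in h.
rewrite Rintegral_cst // mulrC; congr (_ * _); exact: (congr1 fine h).
Qed.

Lemma rmean_derive g F : (forall x : R, is_derive x 1 F (g x)) ->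
  (forall x : R, derivable g x 1) -> rmean g (F (2 * pi) - F 0).
Proof.
move=> dF dg; have cg : {within I2pi, continuous g}.
  by apply: derivable_within_continuous => x _; exact: dg.
have cF x : {for x, continuous F}.
  by apply: differentiable_continuous; apply/derivable1_diffP; have [] := dF x.
split; first by apply: continuous_compact_integrable => //; exact: segment_compact.
rewrite /Rintegral (@continuous_FTC2 _ g F) //.
- by rewrite mulr_gt0 ?pi_gt0.
- split.
  + by move=> x _; have [] := dF x.
  + exact/cvg_at_right_filter/cF.
  + exact/cvg_at_left_filter/cF.
- by move=> x _; rewrite derive1E; have [_ ->] := dF x.
Qed.

Lemma is_derive_mulk k (x : R) : is_derive x 1 (fun y => k%:R * y : R) k%:R.
Proof.
have := is_derive_poly (k%:R *: 'X : {poly R}) x.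
rewrite derivZ derivX hornerZ hornerC mulr1.
by rewrite (_ : horner _ = fun y => k%:R * y) //; apply/funext => y; rewrite hornerZ hornerX.
Qed.

Lemma is_derive_sink k (x : R) :
  is_derive x 1 (fun y => sin (k%:R * y)) (cos (k%:R * x) * k%:R).
Proof.
by have := @is_derive1_comp R sin _ x _ _ (is_derive_sin _) (is_derive_mulk k x).
Qed.

Lemma is_derive_cosk k (x : R) :
  is_derive x 1 (fun y => cos (k%:R * y)) (- sin (k%:R * x) * k%:R).
Proof.
by have := @is_derive1_comp R cos _ x _ _ (is_derive_cos _) (is_derive_mulk k x).
Qed.

Lemma sin_2kpi k : sin (k%:R * (2 * pi)) = 0 :> R.
Proof.
elim: k => [|k IH]; first by rewrite mul0r sin0.
by rewrite -natr1 mulrDl mul1r [X in _ + X]mulr_natl sinD2pi.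
Qed.

Lemma cos_2kpi k : cos (k%:R * (2 * pi)) = 1 :> R.
Proof.
elim: k => [|k IH]; first by rewrite mul0r cos0.
by rewrite -natr1 mulrDl mul1r [X in _ + X]mulr_natl cosD2pi.
Qed.

Lemma rmean_cosk k : (0 < k)%N -> rmean (fun x => cos (k%:R * x)) 0.
Proof.
move=> k0; have k1 : k%:R != 0 :> R by rewrite pnatr_eq0 -lt0n.
have d (x : R) : derivable (fun y : R => cos (k%:R * y) * k%:R) x 1.
  by apply: derivableM; [have [] := is_derive_cosk k x|exact: derivable_cst].
have := rmeanZ k%:R^-1 (rmean_derive (is_derive_sink k) d).
rewrite sin_2kpi mulr0 sin0 subrr mulr0; congr (rmean _ _).
by apply/funext => x; field.
Qed.

Lemma rmean_sink k : (0 < k)%N -> rmean (fun x => sin (k%:R * x)) 0.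
Proof.
move=> k0; have k1 : k%:R != 0 :> R by rewrite pnatr_eq0 -lt0n.
have d (x : R) : derivable (fun y : R => - sin (k%:R * y) * k%:R) x 1.
  apply: derivableM; last exact: derivable_cst.
  by apply: derivableN; have [] := is_derive_sink k x.
have := rmeanZ (- k%:R^-1) (rmean_derive (is_derive_cosk k) d).
rewrite cos_2kpi mulr0 cos0 subrr mulr0; congr (rmean _ _).
by apply/funext => x; field.
Qed.

Lemma cmean_lin f f' c c' d : cmean f c -> cmean f' c' ->
  cmean (fun x => d * f x + f' x) (d * c + c').
Proof.
move=> [r1 i1] [r2 i2]; split.
  have := rmeanD (rmeanD (rmeanZ (complex.Re d) r1) (rmeanZ (- complex.Im d) i1)) r2.
  congr (rmean _ _); last by rewrite ReD ReM; ring.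
  by apply/funext => x; rewrite ReD ReM; ring.
have := rmeanD (rmeanD (rmeanZ (complex.Im d) r1) (rmeanZ (complex.Re d) i1)) i2.
congr (rmean _ _); last by rewrite ImD ImM; ring.
by apply/funext => x; rewrite ImD ImM; ring.
Qed.

Lemma cmean_cst c : cmean (fun=> c) c.
Proof. by split; exact: rmean_cst. Qed.

Lemma circle_uX k x : circle_u (x : R) ^+ k = circle_u (k%:R * x).
Proof.
elim: k => [|k IH]; first by rewrite expr0 mul0r circle_u0.
by rewrite exprSr IH -circle_uD -natr1 mulrDl mul1r.
Qed.

Lemma cmean_uX c k : (0 < k)%N -> cmean (fun x => c * circle_u x ^+ k) 0.
Proof.
move=> k0; have h : cmean (fun x => circle_u x ^+ k) 0.
  split; rewrite mulr0; under eq_fun do rewrite circle_uX; first exact: rmean_cosk.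
  exact: rmean_sink.
have := cmean_lin c h (cmean_cst 0); rewrite mulr0 addr0.
by congr (cmean _ _); apply/funext => x; rewrite addr0.
Qed.

Lemma cmean_conj f c : cmean f c -> cmean (fun x => Num.conj (f x)) (Num.conj c).
Proof.
move=> [r1 i1]; split.
  move: r1; congr (rmean _ _); last by case: (c).
  by apply/funext => x; case: (f x).
have := rmeanZ (-1) i1; congr (rmean _ _).
  by apply/funext => x; case: (f x) => a b /=; rewrite mulN1r.
by case: (c) => a b /=; ring.
Qed.

Lemma cmean_integral f c : cmean f c -> circle_integral f = (2 * pi)%:C * c.
Proof.
move=> [[_ h1] [_ h2]]; rewrite /circle_integral h1 h2.
by apply: ReIm_eq; rewrite ?ReM ?ImM /=; ring.
Qed.

End CircleMean.

(** * Exponentially convergent matrix entries *)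

Section ExponentialLimits.
Variable R : realType.
Implicit Types (F G : int -> int -> R) (f g : int -> R) (r C : R) (n k i : int).

(** Uniformity over all integers [k] permits summation over a level; boundedness of the limit makes
    the notion stable under products. *)
Definition conv_to r F f := exists C (n0 : int), forall n k, n0 <= n -> 0 <= n ->
  `|F n k - f k| <= C * r ^ n /\ `|f k| <= C.

Definition decays r f := exists C, forall k, `|f k| <= C * r ^ k.

Variable r : R.
Hypothesis r01 : 0 < r < 1.

Let r0 : 0 < r. Proof. by case/andP: r01. Qed.
Let r1 : r < 1. Proof. by case/andP: r01. Qed.

Lemma exprz_le1 n : 0 <= n -> r ^ n <= 1.
Proof. by case: n => // n _; rewrite -exprnP exprn_ile1 ?(ltW r0) ?(ltW r1). Qed.

Lemma exprz_wle n k : n <= k -> r ^ k <= r ^ n.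
Proof.
move=> nk; have -> : k = n + (k - n) by rewrite addrC subrK.
rewrite expfzDr ?gt_eqF // ler_piMr ?exprz_ge0 ?(ltW r0) //.
by apply: exprz_le1; rewrite subr_ge0.
Qed.

Lemma conv_toP F f : conv_to r F f -> exists C (n0 : int), [/\ 0 <= C,
  (forall n k, n0 <= n -> 0 <= n -> `|F n k - f k| <= C * r ^ n),
  (forall k, `|f k| <= C) &
  (forall n k, n0 <= n -> 0 <= n -> `|F n k| <= 2 * C)].
Proof.
move=> [C [n0 h]]; exists C, n0.
have hf k : `|f k| <= C.
  have [] := h (Num.max n0 0) k; rewrite ?le_max ?lexx ?orbT //.
have C0 : 0 <= C by apply: le_trans (hf 0).
split => //; first by move=> n k h1 h2; have [] := h n k h1 h2.
move=> n k h1 h2; have [h3 _] := h n k h1 h2.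
rewrite -[F n k](subrK (f k)) mulr2n mulrDl mul1r; apply: le_trans (ler_normD _ _) _.
apply: lerD => //; apply: le_trans h3 _; rewrite ler_piMr //; exact: exprz_le1.
Qed.

Lemma conv_to_eq F F' f : conv_to r F f -> (forall n k, F n k = F' n k) -> conv_to r F' f.
Proof. by move=> [C [n0 h]] e; exists C, n0 => n k; rewrite -e; exact: h. Qed.

Lemma conv_to_cst c : conv_to r (fun _ _ => c) (fun=> c).
Proof.
by exists `|c|, 0 => n k _ n0; rewrite subrr normr0 mulr_ge0 // exprz_ge0 // ltW.
Qed.

Lemma conv_to_pow c : conv_to r (fun n _ => c * r ^ n) (fun=> 0).
Proof.
exists `|c|, 0 => n k _ n0; rewrite subr0 normr0 normrM; split => //.
by rewrite (ger0_norm (exprz_ge0 n (ltW r0))).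
Qed.

Lemma conv_toD F G f g : conv_to r F f -> conv_to r G g ->
  conv_to r (fun n k => F n k + G n k) (fun k => f k + g k).
Proof.
move=> [C [n0 h]] [C' [n0' h']]; exists (C + C'), (Num.max n0 n0') => n k.
rewrite ge_max => /andP[n1 n2] n3; have [h1 h2] := h n k n1 n3.
have [h3 h4] := h' n k n2 n3; split.
  by rewrite opprD addrACA mulrDl; apply: le_trans (ler_normD _ _) _; exact: lerD.
by apply: le_trans (ler_normD _ _) _; exact: lerD.
Qed.

Lemma conv_toM F G f g : conv_to r F f -> conv_to r G g ->
  conv_to r (fun n k => F n k * G n k) (fun k => f k * g k).
Proof.
move=> /conv_toP[C [n0 [C0 h1 h2 h3]]] /conv_toP[D [m0 [D0 h4 h5 h6]]].
exists (C * (2 * D) + C * D), (Num.max n0 m0) => n k.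
rewrite ge_max => /andP[n1 n2] n3; split.
  have -> : F n k * G n k - f k * g k = (F n k - f k) * G n k + f k * (G n k - g k) by ring.
  apply: le_trans (ler_normD _ _) _; rewrite !normrM mulrDl; apply: lerD.
    by rewrite mulrAC; apply: ler_pM => //; [exact: h1|exact: h6].
  by rewrite -mulrA; apply: ler_pM => //; exact: h4.
apply: ler_wpDl; first by rewrite !mulr_ge0.
by rewrite normrM; apply: ler_pM.
Qed.

Lemma conv_toN F f : conv_to r F f -> conv_to r (fun n k => - F n k) (fun k => - f k).
Proof.
move=> [C [n0 h]]; exists C, n0 => n k n1 n2; rewrite -opprD !normrN; exact: h.
Qed.

Lemma conv_toV F f (d : R) : 0 < d -> conv_to r F f ->
  (exists m0, forall n k, m0 <= n -> 0 <= n -> d <= `|F n k|) -> (forall k, d <= `|f k|) ->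
  conv_to r (fun n k => (F n k)^-1) (fun k => (f k)^-1).
Proof.
move=> d0 /conv_toP[C [n0 [C0 h1 h2 h3]]] [m0 dF] df.
exists (C * (d * d)^-1 + d^-1), (Num.max n0 m0) => n k.
rewrite ge_max => /andP[n1 m1] n2; split.
  have F0 : F n k != 0 by rewrite -normr_gt0 (lt_le_trans d0) // dF.
  have f0 : f k != 0 by rewrite -normr_gt0 (lt_le_trans d0).
  have -> : (F n k)^-1 - (f k)^-1 = - (F n k - f k) / (F n k * f k) by field; rewrite F0 f0.
  rewrite normrM normfV normrN normrM mulrDl.
  apply: ler_wpDr; first by rewrite mulr_ge0 ?exprz_ge0 ?invr_ge0 ?ltW.
  rewrite mulrAC; apply: ler_pM => //; first exact: h1.
  rewrite lef_pV2 ?posrE ?mulr_gt0 //; last 2 first.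
    by rewrite normr_gt0. by rewrite normr_gt0.
  by apply: ler_pM; rewrite ?(ltW d0) ?dF ?df.
apply: ler_wpDl; first by rewrite mulr_ge0 // invr_ge0 mulr_ge0 // ltW.
by rewrite normfV lef_pV2 ?posrE // (lt_le_trans d0).
Qed.

Lemma conv_to_shift F f i : conv_to r F f ->
  conv_to r (fun n k => F (n + i) (k + i)) (fun k => f (k + i)).
Proof.
move=> /conv_toP[C [n0 [C0 h1 h2 _]]].
exists (C * r ^ i + C), (Num.max n0 0 - i) => n k; rewrite lerBlDr ge_max => /andP[n1 n2] n3.
have ri : 0 <= r ^ i by rewrite exprz_ge0 // ltW.
split; last by apply: ler_wpDl => //; rewrite mulr_ge0.
rewrite mulrDl; apply: ler_wpDr; first by rewrite mulr_ge0 // exprz_ge0 // ltW.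
by rewrite -mulrA [r ^ i * _]mulrC -expfzDr ?gt_eqF //; exact: h1.
Qed.

Lemma decays_shift f i : decays r f -> decays r (fun k => f (k + i)).
Proof.
move=> [C h]; exists (C * r ^ i) => k.
by rewrite -mulrA [r ^ i * _]mulrC -expfzDr ?gt_eqF.
Qed.

Lemma decaysD f g : decays r f -> decays r g -> decays r (fun k => f k + g k).
Proof.
move=> [C h] [D h']; exists (C + D) => k; rewrite mulrDl.
by apply: le_trans (ler_normD _ _) _; exact: lerD.
Qed.

Lemma decaysM F f g : decays r f -> conv_to r F g -> decays r (fun k => f k * g k).
Proof.
move=> [C h] /conv_toP[D [_ [D0 _ h2 _]]]; exists (C * D) => k.
by rewrite normrM mulrAC; apply: ler_pM.
Qed.

(* For the Jacobi matrix with diagonal [b] and off-diagonal [a] acting along the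
   line [(n + i, k + i)], the coefficient of its [j]-th power between the points
   [0] and [i] of that line. *)
Fixpoint jac (a b : int -> int -> R) (j : nat) (i n k : int) : R :=
  if j is j'.+1 then
    a (n + i + 1) (k + i + 1) * jac a b j' (i + 1) n k
    + b (n + i) (k + i) * jac a b j' i n k
    + a (n + i) (k + i) * jac a b j' (i - 1) n k
  else (i == 0)%:R.

(** Each step of the recursion multiplies by matrix entries, so the limit decays once [j > 0]. For
    [j = 0] it is a Kronecker delta constant in [k], the source of the linear growth of the trace of
    1. *)
Lemma jac_conv a b a' b' j : conv_to r a a' -> conv_to r b b' ->
  decays r a' -> decays r b' ->
  forall i, exists g, conv_to r (jac a b j i) g /\ ((0 < j)%N -> decays r g).
Proof.
move=> ca cb da db; elim: j => [|j IH] i.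
  by exists (fun=> (i == 0)%:R); split => //; exact: conv_to_cst.
have [g1 [c1 _]] := IH (i + 1); have [g2 [c2 _]] := IH i; have [g3 [c3 _]] := IH (i - 1).
have ca1 : conv_to r (fun n k => a (n + i + 1) (k + i + 1)) (fun k => a' (k + i + 1)).
  exact: (conv_to_shift i (conv_to_shift 1 ca)).
have da1 : decays r (fun k => a' (k + i + 1)).
  exact: (decays_shift i (decays_shift 1 da)).
eexists; split.
  exact: (conv_toD (conv_toD (conv_toM ca1 c1) (conv_toM (conv_to_shift i cb) c2))
    (conv_toM (conv_to_shift i ca) c3)).
move=> _; apply: decaysD; first apply: decaysD.
- exact: decaysM da1 c1.
- exact: decaysM (decays_shift i db) c2.
- exact: decaysM (decays_shift i da) c3.
Qed.

End ExponentialLimits.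

(** * The entries of A in lattice coordinates and their limits *)

Section MatrixEntries.
Variables (R : realType) (q : R).
Hypothesis q01 : 0 < q < 1.

Let q0 : 0 < q. Proof. by case/andP: q01. Qed.
Let q1 : q < 1. Proof. by case/andP: q01. Qed.
Let qn0 : q != 0. Proof. by rewrite gt_eqF. Qed.

(** The bracket [[x]] as a rational function of [Q = q ^ x]; the formulas of the representation thus
    become identities of rational functions. *)
Definition qn (Q : R) : R := (Q - Q^-1) / (q - q^-1).

Lemma qnumE x : qnum q x = qn (q `^ x).
Proof. by rewrite /qnum /qn powRN. Qed.

Lemma qd_lt0 : q - q^-1 < 0.
Proof. by rewrite subr_lt0 (lt_trans q1) // invf_gt1. Qed.

Lemma qnum_ge0 x : 0 <= x -> 0 <= qnum q x.
Proof.
move=> x0; have q01' : 0 < q <= 1 by rewrite q0 ltW.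
apply: mulr_le0; last by rewrite invr_le0 ltW // qd_lt0.
by rewrite subr_le0; apply: ger_powR => //; rewrite (le_trans _ x0) // oppr_le0.
Qed.

Lemma qnum2 : qnum q 2 = q + q^-1.
Proof.
rewrite qnumE /qn (_ : q `^ 2 = q ^+ 2); last by rewrite -powR_mulrn ?ltW.
have : q ^+ 2 - 1 != 0.
  by rewrite subr_eq0 lt_eqF // expr_lt1 // ltW.
move=> h; field; rewrite qn0 -expr2 h //.
Qed.

(** Here [X = q ^ l], [U = q ^ (l + m)], [W = q ^ M] and [t = [2]]. The right side separates a
    factor in [U], with a cutoff [1 - X ^ 4 / U ^ 2], from a factor that depends on [l] only and
    tends to [s ^ 2]. *)
Lemma offdiag_identity (s t X U W : R) : t != 0 -> X != 0 -> U != 0 -> W != 0 ->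
  q ^+ 2 - 1 != 0 -> 1 - X ^+ 4 != 0 -> q ^+ 2 - X ^+ 4 != 0 -> 1 - X ^+ 4 * q ^+ 2 != 0 ->
  (q * t) ^- 2 * ((U / X) ^+ 2 * (t * qn (X ^+ 2 / U) * qn U)
     * ((qn (X ^+ 2)) ^- 2 * (t * qn (X * W) * qn (X / W)
         / (qn (X ^+ 2 / q) * qn (X ^+ 2 * q)))
     * ((X * W + (X * W)^-1 * s ^+ 2) * (X / W * s ^+ 2 + (X / W)^-1)))) =
  U ^+ 2 / q ^+ 2 * ((1 - U ^+ 2) * (1 - X ^+ 4 / U ^+ 2)) *
    ((1 - X ^+ 2 * W ^+ 2) * (1 - X ^+ 2 / W ^+ 2) * (X ^+ 2 * W ^+ 2 + s ^+ 2)
       * (X ^+ 2 * s ^+ 2 / W ^+ 2 + 1)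
     / ((1 - X ^+ 4 / q ^+ 2) * (1 - X ^+ 4 * q ^+ 2) * (1 - X ^+ 4) ^+ 2)).
Proof.
move=> t0 X0 U0 W0 h1 h2 h3 h4; have e1 : X ^+ 2 * q * (X ^+ 2 * q) - 1 = - (1 - X ^+ 4 * q ^+ 2) by ring.
have e2 : (X * X) ^+ 2 + - q * q = - (q ^+ 2 - X ^+ 4) by ring.
have e3 : (X * X) ^+ 2 - 1 = - (1 - X ^+ 4) by ring.
by rewrite /qn; field; rewrite qn0 h2 h4 h3 W0 U0 X0 -expr2 h1 e1 e2 e3 !oppr_eq0 h2 h3 h4 t0.
Qed.

(** Same substitutions. On the right [U] enters only through [U ^ 2]; as [X] tends to 0, [psi] tends
    to [1 - s ^ 2] and the entry to [U ^ 2 * (1 - s ^ 2)]. *)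
Lemma diag_identity (s t X U W : R) : t != 0 -> X != 0 -> U != 0 -> W != 0 ->
  q ^+ 2 - 1 != 0 -> 1 - X ^+ 4 != 0 -> 1 - q ^+ 4 * X ^+ 4 != 0 ->
  let psi := ((1 - X ^+ 4) * (1 - s ^+ 2)
      - q * t * (X ^+ 2 * (W ^+ 2 - X ^+ 2)) * (1 - s ^+ 2)
      + (q^-1 - q) * q * t * qn (W ^+ 2) * s ^+ 2 * X ^+ 2) / (1 - q ^+ 4 * X ^+ 4) in
  ((1 - s ^+ 2) - (qn (X ^+ 2) - U * q * t * qn (X ^+ 2 / U)) *
     (((qn (X ^+ 2) - X * W * q * t * qn (X / W)) * (1 - s ^+ 2)
       + q * t * qn (W ^+ 2) * s ^+ 2) / (q ^+ 2 * qn (X ^+ 2) * qn (X ^+ 2 * q ^+ 2))))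
    / (q * t) =
  (1 - s ^+ 2 - psi) / (q * t) + (U ^+ 2 - X ^+ 4) * (psi / (1 - X ^+ 4)).
Proof.
move=> t0 X0 U0 W0 h1 h2 h3 psi.
have e1 : (q * X) ^+ 4 = q ^+ 4 * X ^+ 4 by ring.
have e2 : (X * q * (X * q)) ^+ 2 - 1 = - (1 - q ^+ 4 * X ^+ 4) by ring.
have e3 : (X * X) ^+ 2 - 1 = - (1 - X ^+ 4) by ring.
by rewrite /psi /qn; field; rewrite h2 e1 h3 qn0 -expr2 h1 W0 t0 X0 e2 e3 !oppr_eq0 h2 h3 U0.
Qed.

(** Hoelder continuity of exponent 1/2. A Lipschitz bound would fail near 0, and the radicands
    approach 0 for large [k], or for every [k] if [s = 0]. *)
Lemma sqrt_dist (x y : R) : 0 <= x -> 0 <= y ->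
  `|Num.sqrt x - Num.sqrt y| <= Num.sqrt `|x - y|.
Proof.
wlog xy : x y / y <= x => [hw|] x0 y0.
  case: (leP y x) => [/hw|/ltW /hw]; first exact.
  by rewrite distrC [`|x - y|]distrC; apply.
rewrite ger0_norm ?subr_ge0 ?ler_wsqrtr // ger0_norm ?subr_ge0 //.
rewrite lerBlDr -(@ler_pXn2r _ 2) ?nnegrE ?addr_ge0 ?sqrtr_ge0 // sqrrD.
rewrite !sqr_sqrtr ?subr_ge0 // addrAC subrK lerDl mulrn_wge0 // mulr_ge0 ?sqrtr_ge0.
Qed.

Variables (s nu M : R) (p : nat).
Hypothesis s01 : 0 <= s <= 1.
Hypothesis nu0 : 0 < nu.
Hypothesis pnu : p%:R = 2 * nu.
Hypothesis Mnu : `|M| = nu.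

Definition lval (n : int) : R := nu + n%:~R.
Definition mval (n k : int) : R := k%:~R - lval n.

(* [k = l + m] and [n = l - nu] *)
Definition in_lattice (n k : int) := [&& 0 <= n, 0 <= k & k <= 2 * n + p%:Z].

(** The coefficient of [A] between the points [(n - 1, k - 1)] and [(n, k)], in both directions. The
    condition says that both points belong to the lattice. *)
Definition entry_a (n k : int) : R :=
  if [&& 0 < n, 0 < k & k < 2 * n + p%:Z] then
    - (q * qnum q 2)^-1 * (q `^ (mval n k)
      * Num.sqrt (qnum q 2 * qnum q (lval n - mval n k) * qnum q (lval n + mval n k))
      * alpha q s M (lval n))
  else 0.

Definition entry_b (n k : int) : R :=
  if in_lattice n k then
    (1 - s ^+ 2 - (qnum q (2 * lval n)
       - q `^ (lval n + mval n k + 1) * qnum q 2 * qnum q (lval n - mval n k))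
       * beta q s M (lval n)) / (q * qnum q 2)
  else 0.

Definition lim_a (k : int) : R :=
  if 0 < k then - Num.sqrt ((q ^ k) ^+ 2 / q ^+ 2 * (1 - (q ^ k) ^+ 2) * s ^+ 2) else 0.

Definition lim_b (k : int) : R := if 0 <= k then (q ^ k) ^+ 2 * (1 - s ^+ 2) else 0.

Definition X2 (n : int) : R := q `^ (2 * nu) * (q ^+ 2) ^ n.

Let X (n : int) := q `^ (lval n).
Let W := q `^ M.

Let XE (n : int) : X n ^+ 2 = X2 n.
Proof.
rewrite /X /X2 /lval expr2 -powRD; last by rewrite qn0 implybT.
have -> : nu + n%:~R + (nu + n%:~R) = 2 * nu + (n * 2)%:~R by rewrite intrM; ring.
rewrite powRD; last by rewrite qn0 implybT.
by rewrite (powR_intmul _ (ltW q0)) [n * 2]mulrC -exprz_exp.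
Qed.

Let X0 (n : int) : 0 < X n. Proof. exact: powR_gt0. Qed.
Let W0 : 0 < W. Proof. exact: powR_gt0. Qed.

Let X2_gt0 (n : int) : 0 < X2 n. Proof. by rewrite -XE exprn_gt0. Qed.

Let q2_01 : 0 < q ^+ 2 < 1.
Proof. by rewrite exprn_gt0 //= expr_lt1 // ltW. Qed.

Let X2_le (n : int) : X2 n <= (q ^+ 2) ^ n.
Proof.
rewrite /X2 ler_piMl ?exprz_ge0 ?exprn_ge0 ?(ltW q0) //.
apply: (@le_trans _ _ (q `^ 0)); last by rewrite powRr0.
by apply: ger_powR; rewrite ?mulr_ge0 ?q0 ?(ltW q1) ?(ltW nu0).
Qed.

Let X2_lt (n : int) : 1 <= n -> X2 n <= q ^+ 2.
Proof.
by move=> n1; apply: le_trans (X2_le n) _; have := exprz_wle q2_01 n1.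
Qed.

Let X2_conv : conv_to (q ^+ 2) (fun n _ => X2 n) (fun=> 0).
Proof. exact: conv_to_pow. Qed.

Let qD x y : q `^ (x + y) = q `^ x * q `^ y.
Proof. by rewrite powRD // qn0 implybT. Qed.

Let qB x y : q `^ (x - y) = q `^ x / q `^ y.
Proof. by rewrite qD powRN. Qed.

Let q2l (n : int) : q `^ (2 * lval n) = X n ^+ 2.
Proof. by rewrite mulr_natl mulr2n qD expr2. Qed.

Let qk (n k : int) : q `^ (lval n + mval n k) = q ^ k.
Proof. by rewrite /mval addrC subrK powR_intmul // ltW. Qed.

Let qm (n k : int) : q `^ (mval n k) = q ^ k / X n.
Proof. by rewrite /mval qB powR_intmul // ltW. Qed.

Let qlm (n k : int) : q `^ (lval n - mval n k) = X n ^+ 2 / q ^ k.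
Proof.
by rewrite qB qm invf_div mulrA -expr2.
Qed.

Let U_gt0 (k : int) : 0 < q ^ k. Proof. exact: exprz_gt0. Qed.

Let t_gt0 : 0 < qnum q 2.
Proof. by rewrite qnum2 addr_gt0 // invr_gt0. Qed.

Let q21 : q ^+ 2 - 1 != 0.
Proof. by case/andP: q2_01 => _ h; rewrite subr_eq0 lt_eqF. Qed.

Let X2n0 (n : int) : X2 n != 0. Proof. by rewrite gt_eqF. Qed.

Let X4 (n : int) : X n ^+ 4 = X2 n ^+ 2. Proof. by rewrite -XE -exprM. Qed.

Let q_2lp (n k : int) : k < 2 * n + p%:Z -> 0 <= lval n - mval n k.
Proof.
move=> kn; rewrite /mval /lval.
have : k%:~R <= (2 * n + p%:Z)%:~R :> R by rewrite ler_int ltW.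
by rewrite intrD intrM /= (_ : p%:~R = 2 * nu) //; lra.
Qed.

Definition Phi (n : int) : R :=
  (1 - X2 n * W ^+ 2) * (1 - X2 n / W ^+ 2) * (X2 n * W ^+ 2 + s ^+ 2)
     * (X2 n * s ^+ 2 / W ^+ 2 + 1)
   / ((1 - X2 n ^+ 2 / q ^+ 2) * (1 - X2 n ^+ 2 * q ^+ 2) * (1 - X2 n ^+ 2) ^+ 2).

Definition asq (n k : int) : R :=
  (q ^ k) ^+ 2 / q ^+ 2 * ((1 - (q ^ k) ^+ 2) * (1 - X2 n ^+ 2 / (q ^ k) ^+ 2)) * Phi n.

Let X2bnd (n : int) : 0 < n -> X2 n ^+ 2 <= q ^+ 2 * q ^+ 2.
Proof.
move=> n1; rewrite expr2; apply: ler_pM; rewrite ?(ltW (X2_gt0 n)) //;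
  by apply: X2_lt; rewrite -gtz0_ge1.
Qed.

(** For [n > 0] one has [q ^ (2 l) <= q ^ 2], which makes all denominators nonzero; hence the
    entries are rewritten from level 1 on. *)
Let den (n : int) : 0 < n -> [/\ 1 - X2 n ^+ 2 != 0, q ^+ 2 - X2 n ^+ 2 != 0 &
  1 - X2 n ^+ 2 * q ^+ 2 != 0].
Proof.
move=> /X2bnd h; have := q2_01; have h0 : 0 < X2 n ^+ 2 by rewrite exprn_gt0.
move: h h0; set y := X2 n ^+ 2; set z := q ^+ 2 => h h0 /andP[z0 z1].
have zz : z * z < z by rewrite gtr_pMr.
have yz : y * z < y by rewrite gtr_pMr.
by split; rewrite subr_eq0 gt_eqF //; lra.
Qed.

Lemma lval_M (n : int) : 0 <= n -> 0 <= lval n + M /\ 0 <= lval n - M.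
Proof.
move=> n0; have : 0 <= n%:~R :> R by rewrite ler0z.
have : `|M| <= nu by rewrite Mnu.
by rewrite ler_norml /lval => /andP[h1 h2] h3; lra.
Qed.

(** The entry is nonpositive, so it suffices to compare squares, where the three square roots
    disappear and [offdiag_identity] applies. *)
Lemma entry_aE (n k : int) : 0 < n -> 0 < k -> k < 2 * n + p%:Z ->
  0 <= asq n k /\ entry_a n k = - Num.sqrt (asq n k).
Proof.
move=> n0 k0 kn; have [h2 h3 h4] := den n0; have [l1 l2] := lval_M (ltW n0).
have l3 := q_2lp kn.
have n1 : 1 <= n%:~R :> R by rewrite ler1z -gtz0_ge1.
have k1 : 0 <= k%:~R :> R by rewrite ler0z ltW.
set e := - entry_a n k.
have hl : 0 <= lval n + mval n k by rewrite /mval addrC subrK.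
have e0 : 0 <= e.
  rewrite /e /entry_a n0 k0 kn /= mulNr opprK; apply: mulr_ge0.
    by rewrite invr_ge0 mulr_ge0 // ltW.
  apply: mulr_ge0; first by rewrite mulr_ge0 ?powR_ge0 ?sqrtr_ge0.
  rewrite /alpha !mulr_ge0 ?sqrtr_ge0 // invr_ge0 qnum_ge0 // mulr_ge0 //.
  by rewrite /lval addr_ge0 ?(ltW nu0) // (le_trans ler01).
suff h : e ^+ 2 = asq n k.
  by rewrite -h sqr_ge0 sqrtr_sqr ger0_norm // /e opprK.
rewrite /e /entry_a n0 k0 kn /= sqrrN.
rewrite /alpha !exprMn sqrrN !sqr_sqrtr.
- rewrite ?exprVn !(qnumE (lval n + mval n k)) !(qnumE (lval n - mval n k)).
  rewrite (qnumE (2 * lval n)) (qnumE (lval n + M)) (qnumE (lval n - M)).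
  rewrite (qnumE (2 * lval n - 1)) (qnumE (2 * lval n + 1)) !powRN qm qk qlm.
  rewrite (qB (2 * lval n)) (qD (2 * lval n)) !q2l (qD _ M) (qB _ M) powRr1 ?(ltW q0) //.
  rewrite /asq /Phi -XE -[(X n ^+ 2) ^+ 2]exprM.
  by apply: offdiag_identity; rewrite ?X4 // gt_eqF.
- apply: mulr_ge0; apply: addr_ge0; rewrite ?mulr_ge0 ?powR_ge0 ?sqr_ge0 //;
    by case/andP: s01.
- have l4 : 1 <= lval n by rewrite /lval; move: n1 nu0; move: (n%:~R : R) => z; lra.
  have l5 : 0 <= 2 * lval n - 1 by lra.
  have l6 : 0 <= 2 * lval n + 1 by lra.
  exact: divr_ge0 (mulr_ge0 (mulr_ge0 (ltW t_gt0) (qnum_ge0 l1)) (qnum_ge0 l2))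
    (mulr_ge0 (qnum_ge0 l5) (qnum_ge0 l6)).
- exact: mulr_ge0 (mulr_ge0 (ltW t_gt0) (qnum_ge0 l3)) (qnum_ge0 hl).
Qed.

Let s2_01 : 0 <= s ^+ 2 <= 1.
Proof. by case/andP: s01 => h1 h2; rewrite sqr_ge0 exprn_ile1. Qed.

Let U_le1 (k : int) : 0 <= k -> (q ^ k) ^+ 2 <= 1.
Proof. by move=> k0; rewrite exprn_ile1 ?(ltW (U_gt0 k)) // exprz_le1. Qed.

Let den_conv c d : 0 < d -> c * q ^+ 4 <= 1 - d -> 0 <= c ->
  conv_to (q ^+ 2) (fun n _ => (1 - X2 n ^+ 2 * c)^-1) (fun=> 1).
Proof.
move=> d0 hd c0.
have h : conv_to (q ^+ 2) (fun n _ => 1 - X2 n ^+ 2 * c) (fun=> 1).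
  have := conv_toD (conv_to_cst q2_01 1) (conv_toN (conv_toM q2_01 (conv_toM q2_01 X2_conv X2_conv)
    (conv_to_cst q2_01 c))).
  by rewrite !mul0r subr0.
have := conv_toV q2_01 (d := Num.min d 1) _ h; rewrite invr1; apply.
- by rewrite lt_min d0 ltr01.
- exists 1 => n _ n1 _; apply: le_trans (ler_norm _).
  rewrite ge_min lerBrDr -lerBrDl; apply/orP; left.
  apply: le_trans hd; rewrite mulrC ler_wpM2l //.
  by apply: le_trans (X2bnd _) _; rewrite ?gtz0_ge1 // -exprD.
by move=> _; rewrite normr1 ge_min lexx orbT.
Qed.

Lemma Phi_conv : conv_to (q ^+ 2) (fun n _ => Phi n) (fun=> s ^+ 2).
Proof.
have cst c := conv_to_cst q2_01 c.
have q4 : q ^+ 4 < 1 by rewrite exprn_ilt1 // ltW.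
have d1 : conv_to (q ^+ 2) (fun n _ => (1 - X2 n ^+ 2 * (q ^+ 2)^-1)^-1) (fun=> 1).
  apply: (den_conv (d := 1 - q ^+ 2)); first by rewrite subr_gt0; case/andP: q2_01.
    by rewrite opprB addrC subrK -[4%N]/(2 + 2)%N exprD mulKf // expf_neq0.
  by rewrite invr_ge0 sqr_ge0.
have d2 : conv_to (q ^+ 2) (fun n _ => (1 - X2 n ^+ 2 * q ^+ 2)^-1) (fun=> 1).
  apply: (den_conv (d := 1 - q ^+ 4)); rewrite ?subr_gt0 ?sqr_ge0 //.
  rewrite opprB addrC subrK ler_piMl ?exprn_ge0 ?(ltW q0) //.
  by case/andP: q2_01 => _ /ltW.
have d3 : conv_to (q ^+ 2) (fun n _ => (1 - X2 n ^+ 2 * 1)^-1) (fun=> 1).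
  apply: (den_conv (d := 1 - q ^+ 4)); rewrite ?subr_gt0 //.
  by rewrite opprB addrC subrK mul1r.
have n1 := conv_toD (cst 1) (conv_toN (conv_toM q2_01 X2_conv (cst (W ^+ 2)))).
have n2 := conv_toD (cst 1) (conv_toN (conv_toM q2_01 X2_conv (cst (W ^+ 2)^-1))).
have n3 := conv_toD (conv_toM q2_01 X2_conv (cst (W ^+ 2))) (cst (s ^+ 2)).
have n4 := conv_toD (conv_toM q2_01 X2_conv (cst (s ^+ 2 / W ^+ 2))) (cst 1).
have := conv_toM q2_01 (conv_toM q2_01 (conv_toM q2_01 (conv_toM q2_01 n1 n2) n3) n4)
  (conv_toM q2_01 (conv_toM q2_01 d1 d2) (conv_toM q2_01 d3 d3)).
rewrite !mul0r !subr0 !add0r !mulr1 !mul1r => h; apply: (conv_to_eq h) => n _.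
by rewrite /Phi mulr1 -!invfM -[(1 - X2 n ^+ 2) * _]expr2 [X2 n * (_ / _)]mulrA.
Qed.

Lemma lim_a_le (k : int) : 0 < k -> `|lim_a k| <= q ^ k / q.
Proof.
move=> k0; rewrite /lim_a k0 normrN ger0_norm ?sqrtr_ge0 //.
rewrite -(@ger0_norm _ (q ^ k / q)) -?sqrtr_sqr; last by rewrite divr_ge0 // ltW.
apply: ler_wsqrtr; rewrite expr_div_n -mulrA ler_piMr //.
  by rewrite divr_ge0 ?sqr_ge0.
have := U_le1 (ltW k0); have : 0 <= (q ^ k) ^+ 2 by rewrite sqr_ge0.
case/andP: s2_01; move: (s ^+ 2) ((q ^ k) ^+ 2) => x y x0 x1 y0 y1.
by rewrite mulr_ile1 ?subr_ge0 // lerBlDr lerDl.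
Qed.

Let n1_le (n : int) : 0 <= n -> n + 1 <= 2 * n + p%:Z.
Proof.
have p0 : (0 < p)%N by rewrite -(ltr_nat R) pnu mulr_gt0.
by move: p0; clear; lia.
Qed.

(** Inside the lattice the radicands differ by [O (q ^ (2 n))] uniformly in [k]: the prefactor
    [(q ^ k) ^ 2] cancels the denominator of the cutoff term [X2 n ^ 2 / (q ^ k) ^ 2]. The square
    root leaves [O (q ^ n)]. *)
Lemma entry_a_conv : conv_to q entry_a lim_a.
Proof.
have [C [n0 [C0 h1 h2 h3]]] := conv_toP q2_01 Phi_conv.
(* [C] accounts for [Phi n - s ^ 2], and [2 * C] for the cutoff term, where it bounds [Phi]. *)
pose K := q ^- 2 * (C + 2 * C).
have K0 : 0 <= K by rewrite mulr_ge0 ?invr_ge0 ?sqr_ge0 // addr_ge0 // mulr_ge0.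
exists (Num.sqrt K + 1), (Num.max n0 1) => n k; rewrite ge_max => /andP[nn0 n1] nge.
have n0' : 0 < n by rewrite gtz0_ge1.
split; last first.
  case: (ltP 0 k) => k0; last by rewrite /lim_a ltNge k0 normr0 addr_ge0 ?sqrtr_ge0.
  apply: le_trans (lim_a_le k0) _; apply: ler_wpDl; first by rewrite sqrtr_ge0.
  by rewrite ler_pdivrMr // mul1r -[leRHS]expr1z; apply: exprz_wle => //; rewrite -gtz0_ge1.
have qn_ge : 0 <= q ^ n by rewrite ltW.
rewrite mulrDl mul1r; case: (ltP 0 k) => k0; last first.
  by rewrite /entry_a /lim_a n0' ltNge k0 /= subrr normr0 addr_ge0 // mulr_ge0 ?sqrtr_ge0.
(* From the upper edge of the lattice on the entry is 0, but there [k >= n + 1] and the limit itself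
   is at most [q ^ n]; this is the summand 1 of the constant. *)
case: (ltP k (2 * n + p%:Z)) => kn; last first.
  rewrite /entry_a n0' k0 ltNge kn /= sub0r normrN.
  apply: ler_wpDl; first by rewrite mulr_ge0 ?sqrtr_ge0.
  apply: le_trans (lim_a_le k0) _; rewrite ler_pdivrMr // -[X in _ <= _ * X]expr1z -expfzDr //.
  apply: exprz_wle => //; apply: le_trans kn.
  exact: n1_le.
apply: ler_wpDr => //.
have [asq0 ->] := entry_aE n0' k0 kn.
have U2 : 0 <= 1 - (q ^ k) ^+ 2 by rewrite subr_ge0 U_le1 // ltW.
have s2 : 0 <= s ^+ 2 by rewrite sqr_ge0.
have u2 : 0 <= (q ^ k) ^+ 2 by rewrite sqr_ge0.
have q2i : 0 <= (q ^+ 2)^-1 by rewrite invr_ge0 sqr_ge0.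
have x2 : 0 <= X2 n ^+ 2 by rewrite sqr_ge0.
rewrite /lim_a k0 opprK addrC; apply: le_trans (sqrt_dist _ _) _ => //.
  exact: mulr_ge0 (mulr_ge0 (divr_ge0 u2 (sqr_ge0 q)) U2) s2.
have -> : Num.sqrt K * q ^ n = Num.sqrt (K * (q ^+ 2) ^ n).
  have -> : (q ^+ 2) ^ n = (q ^ n) ^+ 2 by rewrite !exprnP !exprz_exp mulrC.
  by rewrite (sqrtrM _ K0) sqrtr_sqr (ger0_norm qn_ge).
apply: ler_wsqrtr.
have -> : (q ^ k) ^+ 2 / q ^+ 2 * (1 - (q ^ k) ^+ 2) * s ^+ 2 - asq n k =
  - ((q ^+ 2)^-1 * ((q ^ k) ^+ 2 * (1 - (q ^ k) ^+ 2)) * (Phi n - s ^+ 2)) +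
    (q ^+ 2)^-1 * ((1 - (q ^ k) ^+ 2) * X2 n ^+ 2) * Phi n.
  rewrite /asq; move: (Phi n) (lt0r_neq0 (U_gt0 k)); move: (q ^ k) (X2 n) => u x P u0.
  by field; rewrite qn0 u0.
apply: le_trans (ler_normD _ _) _; rewrite [K]mulrDr [leRHS]mulrDl; apply: lerD.
  rewrite normrN normrM -[leRHS]mulrA; apply: ler_pM => //; last exact: h1.
  rewrite (ger0_norm (mulr_ge0 q2i (mulr_ge0 u2 U2))) ler_piMr //.
  by rewrite mulr_ile1 ?U_le1 ?(ltW k0) // lerBlDr lerDl.
rewrite normrM [leRHS]mulrAC; apply: ler_pM => //; last exact: h3.
rewrite (ger0_norm (mulr_ge0 q2i (mulr_ge0 U2 x2))); apply: ler_wpM2l => //.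
apply: le_trans (_ : X2 n ^+ 2 <= _).
  by rewrite ler_piMl // lerBlDr lerDl.
apply: le_trans (X2_le n); rewrite expr2 ler_piMl ?(ltW (X2_gt0 n)) //.
by apply: le_trans (X2_le n) _; exact: exprz_le1.
Qed.

Lemma lim_a_decays : decays q lim_a.
Proof.
exists q^-1 => k; rewrite mulrC; case: (ltP 0 k) => k0; first exact: lim_a_le.
by rewrite /lim_a ltNge k0 normr0 mulr_ge0 // ?invr_ge0 ?(ltW q0) ?(ltW (U_gt0 k)).
Qed.

Definition psi (n : int) : R :=
  ((1 - X2 n ^+ 2) * (1 - s ^+ 2)
   - q * qnum q 2 * (X2 n * (W ^+ 2 - X2 n)) * (1 - s ^+ 2)
   + (q^-1 - q) * q * qnum q 2 * qn (W ^+ 2) * s ^+ 2 * X2 n)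
  / (1 - q ^+ 4 * X2 n ^+ 2).

Lemma entry_bE (n k : int) : 0 < n -> in_lattice n k -> entry_b n k =
  (1 - s ^+ 2 - psi n) / (q * qnum q 2)
  + ((q ^ k) ^+ 2 - X2 n ^+ 2) * (psi n / (1 - X2 n ^+ 2)).
Proof.
move=> n0 nk; have [h2 h3 h4] := den n0.
have h5 : 1 - q ^+ 4 * X2 n ^+ 2 != 0.
  rewrite subr_eq0 gt_eqF //; apply: (@le_lt_trans _ _ (X2 n ^+ 2)).
    by rewrite ler_piMl ?sqr_ge0 // exprn_ile1 ?(ltW q0) ?(ltW q1).
  apply: le_lt_trans (X2bnd n0) _; case/andP: q2_01 => z0 z1.
  by rewrite mulr_ilt1 // ltW.
rewrite /entry_b nk /beta !(qnumE (2 * lval n)) (qnumE (lval n - mval n k)).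
rewrite (qnumE (lval n - M)) (qnumE (2 * lval n + 2)) (qnumE (2 * M)).
rewrite (qD (lval n + mval n k)) (qD (lval n + M)) (qD (lval n) M) (qB (lval n) M) qk qlm.
rewrite (qD (2 * lval n)) !q2l powRr1 ?(ltW q0) // (_ : q `^ 2 = q ^+ 2); last first.
  by rewrite -powR_mulrn // ltW.
rewrite (_ : q `^ (2 * M) = W ^+ 2); last by rewrite mulr_natl mulr2n qD expr2.
rewrite /psi -XE -[(X n ^+ 2) ^+ 2]exprM.
by apply: diag_identity; rewrite ?X4 // gt_eqF.
Qed.

Lemma psi_conv : conv_to (q ^+ 2) (fun n _ => psi n) (fun=> 1 - s ^+ 2).
Proof.
have cst c := conv_to_cst q2_01 c; have cM := conv_toM q2_01.
have q41 : q ^+ 4 < 1 by rewrite exprn_ilt1 // ltW.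
have q4 : 0 <= q ^+ 4 by rewrite exprn_ge0 // ltW.
have d1 : conv_to (q ^+ 2) (fun n _ => (1 - X2 n ^+ 2 * q ^+ 4)^-1) (fun=> 1).
  apply: (den_conv (d := 1 - q ^+ 4)); rewrite ?subr_gt0 //.
  by rewrite opprB addrC subrK ler_piMl // ltW.
have n1 := conv_toD (cst 1) (conv_toN (cM _ _ _ _ X2_conv X2_conv)).
have n2 := conv_toD (cst (W ^+ 2)) (conv_toN X2_conv).
have n3 := cM _ _ _ _ (cst (q * qnum q 2)) (cM _ _ _ _ X2_conv n2).
have n4 := conv_toD (conv_toD (cM _ _ _ _ n1 (cst (1 - s ^+ 2)))
  (conv_toN (cM _ _ _ _ n3 (cst (1 - s ^+ 2)))))
  (cM _ _ _ _ (cst ((q^-1 - q) * q * qnum q 2 * qn (W ^+ 2) * s ^+ 2)) X2_conv).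
have := cM _ _ _ _ n4 d1.
rewrite !(mul0r, mulr0, subr0, addr0, mulr1, mul1r) => h; apply: (conv_to_eq h) => n _.
by rewrite /psi [q ^+ 4 * _]mulrC.
Qed.

Lemma psi2_conv : conv_to (q ^+ 2) (fun n _ => psi n / (1 - X2 n ^+ 2)) (fun=> 1 - s ^+ 2).
Proof.
have q41 : q ^+ 4 < 1 by rewrite exprn_ilt1 // ltW.
have d3 : conv_to (q ^+ 2) (fun n _ => (1 - X2 n ^+ 2 * 1)^-1) (fun=> 1).
  apply: (den_conv (d := 1 - q ^+ 4)); rewrite ?subr_gt0 //.
  by rewrite opprB addrC subrK mul1r.
have := conv_toM q2_01 psi_conv d3; rewrite mulr1 => h.
by apply: (conv_to_eq h) => n _; rewrite mulr1.
Qed.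

Let q2n_le (n : int) : 0 <= n -> (q ^+ 2) ^ n <= q ^ n.
Proof.
move=> n0; rewrite exprnP exprz_exp; apply: exprz_wle => //.
by rewrite ler_peMl.
Qed.

Lemma lim_b_le k : `|lim_b k| <= q ^ k.
Proof.
rewrite /lim_b; case: ifP => k0; last by rewrite normr0 ltW.
case/andP: s2_01 => x0 x1; have s1 : 0 <= 1 - s ^+ 2 by rewrite subr_ge0.
rewrite (ger0_norm (mulr_ge0 (sqr_ge0 (q ^ k)) s1)).
have Uk := ltW (U_gt0 k); rewrite expr2 -mulrA ler_piMr //.
by apply: mulr_ile1; rewrite ?subr_ge0 ?exprz_le1 // lerBlDr lerDl.
Qed.

Lemma lim_b_decays : decays q lim_b.
Proof. by exists 1 => k; rewrite mul1r; exact: lim_b_le. Qed.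

(** Inside the lattice there is no square root to take and the error is [O (q ^ (2 n))]; above the
    upper edge the limit itself is at most [q ^ n]. *)
Lemma entry_b_conv : conv_to q entry_b lim_b.
Proof.
have [C [n1 [C0 h1 _ _]]] := conv_toP q2_01 psi_conv.
have [D [n2 [D0 g1 _ g3]]] := conv_toP q2_01 psi2_conv.
pose K := C / (q * qnum q 2) + (D + 2 * D).
have K1 : 0 <= C / (q * qnum q 2) by rewrite divr_ge0 // mulr_ge0 // ltW.
have K2 : 0 <= D + 2 * D by rewrite addr_ge0 // mulr_ge0.
exists (K + 1), (Num.max n1 (Num.max n2 1)) => n k.
rewrite !ge_max => /and3P[m1 m2 m3] n0.
have n0' : 0 < n by rewrite gtz0_ge1.
split; last first.
  apply: ler_wpDl; first exact: addr_ge0.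
  case: (leP 0 k) => k0; last by rewrite /lim_b (lt_geF k0) normr0.
  by apply: le_trans (lim_b_le k) _; exact: exprz_le1.
have qn_ge : 0 <= q ^ n by rewrite ltW.
case: (boolP (in_lattice n k)) => nk; last first.
  rewrite /entry_b (negbTE nk) sub0r normrN.
  case: (leP 0 k) => k0; last first.
    by rewrite /lim_b (lt_geF k0) normr0 mulr_ge0 // addr_ge0 // addr_ge0.
  rewrite mulrDl mul1r; apply: ler_wpDl; first by rewrite mulr_ge0 // addr_ge0.
  apply: le_trans (lim_b_le k) _; apply: exprz_wle => //.
  move: nk; rewrite /in_lattice n0 k0 /= -ltNge => /ltW; apply: le_trans.
  by apply: le_trans (n1_le n0); rewrite lerDl.
have k0 : 0 <= k by case/and3P: nk.
rewrite (entry_bE n0' nk) /lim_b k0.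
set P := psi n / _; set u := (q ^ k) ^+ 2.
have -> : (1 - s ^+ 2 - psi n) / (q * qnum q 2) + (u - X2 n ^+ 2) * P - u * (1 - s ^+ 2) =
   - (psi n - (1 - s ^+ 2)) / (q * qnum q 2) + (u * (P - (1 - s ^+ 2)) - X2 n ^+ 2 * P).
  by ring.
rewrite mulrDl mul1r; apply: ler_wpDr => //.
apply: le_trans (_ : K * (q ^+ 2) ^ n <= _); last first.
  by apply: ler_wpM2l; [exact: addr_ge0|exact: q2n_le].
rewrite /K mulrDl; apply: le_trans (ler_normD _ _) _; apply: lerD.
  rewrite normrM normfV normrN mulrAC (gtr0_norm (mulr_gt0 q0 t_gt0)).
  by apply: ler_wpM2r; [rewrite invr_ge0 mulr_ge0 // ltW|exact: h1].
apply: le_trans (ler_normB _ _) _; rewrite mulrDl; apply: lerD; rewrite normrM.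
  rewrite -[leRHS]mul1r; apply: ler_pM => //; last exact: g1.
  by rewrite /u ger0_norm ?sqr_ge0 // U_le1.
rewrite [leRHS]mulrC; apply: ler_pM => //; last exact: g3.
rewrite ger0_norm ?sqr_ge0 //; apply: le_trans (X2_le n).
rewrite expr2 ler_piMl ?(ltW (X2_gt0 n)) //.
by apply: le_trans (X2_le n) _; exact: exprz_le1.
Qed.

End MatrixEntries.

(** * Traces over the levels of the representation *)

Section RapidDecrease.
Variable R : realType.
Local Notation C := R[i].
Implicit Types (eps : nat -> C) (n J : nat).

Lemma rapid_eventually eps : (forall J, exists K n0, forall n, (n0 <= n)%N ->
    nrm (eps n) <= K * rpw n J%:R) -> rapid eps.
Proof.
move=> h J; have [K [n0 hK]] := h J.
exists (`|K| + \sum_(0 <= i < n0) nrm (eps i) / rpw i J%:R) => n.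
rewrite mulrDl; case: (leqP n0 n) => nn.
  apply: ler_wpDr; last first.
    by apply: le_trans (hK n nn) _; rewrite ler_wpM2r ?rpw_ge0 // ler_norm.
  rewrite mulr_ge0 ?rpw_ge0 // sumr_ge0 // => i _; rewrite divr_ge0 ?rpw_ge0 //.
  exact: nrm_ge0.
apply: ler_wpDl; first by rewrite mulr_ge0 ?rpw_ge0.
rewrite -ler_pdivrMr ?rpw_gt0 // (big_cat_nat (n := n.+1)) //= big_nat_recr //=.
rewrite -addrA addrCA lerDl addr_ge0 // sumr_ge0 // => i _;
  by rewrite divr_ge0 ?rpw_ge0 // nrm_ge0.
Qed.

Lemma rapidD eps eps' : rapid eps -> rapid eps' -> rapid (fun n => eps n + eps' n).
Proof.
move=> h h' J; have [K hK] := h J; have [L hL] := h' J.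
exists (K + L) => n; rewrite mulrDl; apply: le_trans (nrmD _ _) _; exact: lerD.
Qed.

Lemma rapidZ (c : C) eps : rapid eps -> rapid (fun n => c * eps n).
Proof.
move=> h J; have [K hK] := h J; exists (nrm c * K) => n.
by rewrite nrmM -mulrA ler_wpM2l ?nrm_ge0.
Qed.

Lemma rapid0 : rapid (fun=> 0 : C).
Proof. by move=> J; exists 0 => n; rewrite nrm0 mul0r. Qed.

Variable q : R.
Hypothesis q01 : 0 < q < 1.
Let q0 : 0 < q. Proof. by case/andP: q01. Qed.
Let q1 : q < 1. Proof. by case/andP: q01. Qed.

(** From [exp y >= 1 + y ^ (J + 1) / (J + 1)!] at [y = (n + 1) t] with [t = - ln q]; the power
    [J + 1] leaves room for the factor [n + 1]. *)
Lemma geo_rapid J : exists K, forall n, n.+1%:R * q ^+ n <= K * rpw n J%:R.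
Proof.
pose t := - ln q; have t0 : 0 < t by rewrite oppr_gt0 -ln1 ltr_ln ?posrE.
have tJ : 0 < t ^+ J.+1 by rewrite exprn_gt0.
exists (J.+1`!%:R / t ^+ J.+1 / q) => n; rewrite rpw_nat.
have n0 : 0 < n.+1%:R :> R by [].
rewrite ler_pdivlMr ?exprn_gt0 // mulrAC -exprS ler_pdivlMr // -mulrA -exprSr.
rewrite ler_pdivlMr // mulrAC -exprMn.
have := @expR_ge1Dxn R (n.+1%:R * t) J.
have y0 : 0 <= n.+1%:R * t by rewrite mulr_ge0 // ltW.
move=> /(_ y0) h.
have -> : q ^+ n.+1 = (expR (n.+1%:R * t))^-1.
  by rewrite expRM_natl -exprVn -expRN opprK lnK ?posrE.
rewrite ler_pdivrMr ?expR_gt0 // -ler_pdivrMl; last by rewrite ltr0n fact_gt0.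
by rewrite mulrC; apply: le_trans h; rewrite lerDr.
Qed.

(** The constant is the full sum of [f]. The error consists of the differences [F - f] over one
    level and of the tail of [f] beyond it. *)
Lemma level_sum_conv (F : int -> int -> R) (f : int -> R) (p : nat) :
  conv_to q F f -> decays q f -> exists c eps, rapid eps /\
    forall n : nat, \sum_(0 <= k < n.*2 + p.+1) (F n%:Z k%:Z)%:C = c%:C + eps n.
Proof.
move=> /(conv_toP q01)[C0 [m0 [CC h1 h2 _]]] [D hD].
have q1' : 0 < 1 - q by rewrite subr_gt0.
have hD' k : `|f k%:Z| <= D * q ^+ k by have := hD k%:Z.
have D0 : 0 <= D by have := le_trans (normr_ge0 _) (hD' 0%N); rewrite mulr1.
have geo n : \sum_(0 <= k < n) q ^+ k <= (1 - q)^-1.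
  rewrite -[leRHS]mul1r ler_pdivlMr // big_mkord.
  have := subrX1 q n; have : 0 <= q ^+ n by rewrite exprn_ge0 // ltW.
  by move: (\sum_(i < n) _) (q ^+ n) => x y y0; lra.
have [c hc _] : exists2 c, rsum (fun k => f k%:Z) c & `|c| <= D / (1 - q).
  apply: rsum_abs => n; apply: le_trans (_ : \sum_(0 <= k < n) D * q ^+ k <= _).
    by apply: ler_sum => k _; exact: hD'.
  by rewrite -mulr_sumr ler_wpM2l.
have tail m : `|c - \sum_(0 <= k < m) f k%:Z| <= D / (1 - q) * q ^+ m.
  have hcC : csum (fun k => (f k%:Z)%:C) c%:C.
    split => //=; have [h _] := csum0 R; exact: h.
  have := csum_tail m hcC.
  have -> : c%:C - \sum_(0 <= k < m) (f k%:Z)%:C = (c - \sum_(0 <= k < m) f k%:Z)%:C.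
    by rewrite rmorphB rmorph_sum.
  rewrite -nrmR => /csum_nrm; apply => n.
  apply: le_trans (_ : \sum_(0 <= i < n) D * q ^+ m * q ^+ i <= _).
    apply: ler_sum => i _; rewrite nrmR; apply: le_trans (hD' _) _.
    by rewrite exprD [q ^+ i * _]mulrC mulrA.
  rewrite -mulr_sumr [leRHS]mulrAC; apply: ler_wpM2l => //.
  by rewrite mulr_ge0 // exprn_ge0 // ltW.
exists c, (fun n => \sum_(0 <= k < n.*2 + p.+1) (F n%:Z k%:Z)%:C - c%:C).
split; last by move=> n; rewrite addrC subrK.
apply: rapid_eventually => J; have [K hK] := geo_rapid J.
(* A level has [2 n + p + 1 <= (2 + p + 1) (n + 1)] points, each with error at most [C0 * q ^ n];
   the second summand bounds the tail of [f]. *)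
pose L := C0 * (2 + p.+1%:R) + D / (1 - q).
have L0 : 0 <= L.
  by apply: addr_ge0; [apply: mulr_ge0 => //; apply: addr_ge0|apply: divr_ge0 => //; exact: ltW].
exists (L * K), `|m0|%N => n mn; rewrite -mulrA; apply: le_trans (ler_wpM2l L0 (hK n)).
have qn : 0 <= q ^+ n by rewrite exprn_ge0 // ltW.
have -> : \sum_(0 <= k < n.*2 + p.+1) (F n%:Z k%:Z)%:C - c%:C =
   (\sum_(0 <= k < n.*2 + p.+1) (F n%:Z k%:Z - f k%:Z)
     - (c - \sum_(0 <= k < n.*2 + p.+1) f k%:Z))%:C.
  by rewrite -rmorph_sum -rmorphB sumrB; congr (_%:C); ring.
rewrite nrmR; apply: le_trans (ler_normB _ _) _; rewrite mulrDl; apply: lerD.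
  apply: le_trans (ler_norm_sum _ _ _) _.
  apply: le_trans (_ : \sum_(0 <= k < n.*2 + p.+1) C0 * q ^+ n <= _).
    apply: ler_sum => k _; apply: (h1 n%:Z k%:Z) => //.
    by apply: le_trans (lez_abs _) _; rewrite lez_nat.
  rewrite sumr_const_nat subn0 -mulrnAr -[leRHS]mulrA; apply: ler_wpM2l => //.
  rewrite -[q ^+ n *+ _]mulr_natl mulrA; apply: ler_wpM2r => //.
  rewrite -[2 in leRHS]/(2%:R) -natrD -natrM ler_nat mulnDl leq_add ?leq_pmulr //.
  by rewrite mul2n leq_double.
apply: le_trans (tail _) _; apply: ler_wpM2l; first by rewrite divr_ge0 // ltW.
apply: le_trans (_ : q ^+ n <= _); last by rewrite ler_peMl // ler1n.
apply: ler_wiXn2l; rewrite ?(ltW q0) ?(ltW q1) //.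
by rewrite -addnn -addnA leq_addr.
Qed.

End RapidDecrease.

(** * Unordered sums computed level by level *)

Section UnorderedSum.
Variables (R : realType) (I : choiceType) (lev : I -> nat) (E : nat -> seq I).
Hypothesis memE : forall n i, (i \in E n) = (lev i == n).
Hypothesis uniqE : forall n, uniq (E n).
Local Notation C := R[i].
Implicit Types (x : I -> C) (g : I -> R).

Fixpoint below n : seq I := if n is n'.+1 then below n' ++ E n' else [::].

Lemma mem_below n i : (i \in below n) = (lev i < n)%N.
Proof.
by elim: n => [|n IH] //=; rewrite mem_cat IH memE ltnS [RHS]leq_eqVlt orbC.
Qed.

Lemma uniq_below n : uniq (below n).
Proof.
elim: n => [|n IH] //=; rewrite cat_uniq IH uniqE andbT /=.
by apply/hasPn => i; rewrite memE mem_below => /eqP ->; rewrite ltnn.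
Qed.

Lemma sum_below (V : zmodType) (f : I -> V) n :
  \sum_(i <- below n) f i = \sum_(0 <= m < n) \sum_(i <- E m) f i.
Proof.
elim: n => [|n IH]; first by rewrite big_nil big_geq.
by rewrite /= big_cat IH big_nat_recr.
Qed.

Lemma sum_subset (V : zmodType) (f : I -> V) (s t : seq I) : uniq s -> uniq t ->
  {subset s <= t} ->
  \sum_(i <- t) f i = \sum_(i <- s) f i + \sum_(i <- t | i \notin s) f i.
Proof.
move=> us ut st; rewrite -[X in _ + X]big_filter -big_cat /=; apply: perm_big.
apply: uniq_perm => // [|i].
  rewrite cat_uniq us filter_uniq // andbT; apply/hasPn => i.
  by rewrite mem_filter => /andP[].
rewrite mem_cat mem_filter; case: (boolP (i \in s)) => //= h; exact: st.
Qed.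

(** A finite set containing all levels below [N] differs from them by indices of higher levels,
    where the terms are dominated by a tail of the convergent series of level sums of [g]. *)
Lemma unordered_sum_to x g (t : C) M : (forall i, nrm (x i) <= g i) ->
  (forall n, \sum_(i <- below n) g i <= M) ->
  csum (fun n => \sum_(i <- E n) x i) t ->
  summability.partial_sum (x : I -> C^o) @ summability.totally --> (t : C^o).
Proof.
have totF : ProperFilter (@summability.totally I) := summability.totally_filter.
move=> xg gM /csumP xt; apply/cvgrPdist_lt => e e0.
have eR : e = (complex.Re e)%:C by rewrite RRe_real // gtr0_real.
have e0' : 0 < complex.Re e by move: e0; rewrite {1}eR ltcR.
have e2 : 0 < complex.Re e / 2 by rewrite divr_gt0.
have [N1 h1] := xt _ e2.
have g0 i : 0 <= g i by apply: le_trans (xg i); exact: nrm_ge0.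
have [l hl _] : exists2 l, rsum (fun n => \sum_(i <- E n) g i) l & l <= M.
  apply: rsum_bounded => [n|n]; first exact: sumr_ge0.
  by rewrite /series /= -sum_below.
have hle m : \sum_(i <- below m) g i <= l.
  rewrite sum_below; apply: (rsum_ge_series (u := fun n => \sum_(i <- E n) g i)) => //.
  by move=> i; exact: sumr_ge0.
have /cvgrPdist_lt/(_ _ e2)[N2 _ h2] := hl.
pose N := maxn N1 N2.
exists (finmap.seq_fset tt (below N)) => // B /finmap.fsubsetP sB /=.
have sB' : {subset below N <= finmap.enum_fset B}.
  by move=> i hi; apply: sB; rewrite finmap.seq_fsetE.
rewrite /summability.partial_sum -(@finmap.big_seq_fsetE _ _ _ _ B predT x) /=.
rewrite (sum_subset _ (uniq_below N) (finmap.fset_uniq B) sB') opprD addrA.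
rewrite nrmE eR ltcR [complex.Re e]splitr; apply: le_lt_trans (nrmB _ _) _.
apply: ltrD; first by rewrite sum_below; apply: h1; exact: leq_maxl.
(* Being finite, [B] lies below some level; adding up all levels that occur in it is a crude
   choice. *)
have [m Nm hm] : exists2 m, (N <= m)%N & {subset finmap.enum_fset B <= below m}.
  exists (N + \sum_(i <- finmap.enum_fset B) (lev i).+1)%N; first exact: leq_addr.
  move=> i iB; rewrite mem_below (bigD1_seq i) ?finmap.fset_uniq //=.
  by rewrite addnCA ltn_addr.
apply: le_lt_trans (nrm_sum _ _ _) _.
apply: le_lt_trans (_ : \sum_(i <- below m | i \notin below N) g i < _).
  apply: le_trans (_ : \sum_(i <- finmap.enum_fset B | i \notin below N) g i <= _).
    by apply: ler_sum => i _.
  rewrite -[leLHS]big_filter -[leRHS]big_filter.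
  rewrite (sum_subset (s := [seq i <- finmap.enum_fset B | i \notin below N])
    (t := [seq i <- below m | i \notin below N]) g) ?filter_uniq ?finmap.fset_uniq ?uniq_below //.
    by rewrite lerDl sumr_ge0.
  by move=> i; rewrite !mem_filter => /andP[-> /hm].
have sN : {subset below N <= below m}.
  by move=> i; rewrite !mem_below => /leq_trans; apply.
have := hle m; rewrite (sum_subset _ (uniq_below N) (uniq_below m) sN).
have := h2 N (leq_maxr _ _); rewrite /series /= -sum_below => /(le_lt_trans (ler_norm _)).
by lra.
Qed.

End UnorderedSum.

(** * The representation in lattice coordinates *)

Section Lattice.
Variables (R : realType) (q s N : R) (p : nat).
Hypothesis q01 : 0 < q < 1.
Hypothesis s01 : 0 <= s <= 1.
Hypothesis N0 : N != 0.
Hypothesis pN : p%:R = 2 * `|N|.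
Variables (H : lmodType R[i]) (ip : {dot H for Num.conj}).
Variable ket : bool * lm_index N -> H.
Hypothesis hket : orthonormal_basis ip ket.
Variable rho : podles q s -> H -> H.
Hypothesis hrho : star_rep ip rho.
Hypothesis hrho_ket : rep_formulas ket rho.

Let q0 : 0 < q. Proof. by case/andP: q01. Qed.
Let q1 : q < 1. Proof. by case/andP: q01. Qed.
Let nu0 : 0 < `|N|. Proof. by rewrite normr_gt0. Qed.

Local Notation A := (podA : podles q s).
Local Notation B := (podB : podles q s).
Local Notation Bs := (pstar podB : podles q s).
Local Notation lv := (lval `|N|).
Local Notation mv := (mval `|N|).
Local Notation inL := (in_lattice p).

Let rho_lin c a b v : rho (c *: a + b) v = c *: rho a v + rho b v.
Proof. by case: hrho. Qed.
Let rhoM a b v : rho (a * b) v = rho a (rho b v).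
Proof. by case: hrho. Qed.
Let rho1 v : rho 1 v = v.
Proof. by case: hrho. Qed.
Let rho_adj a v w : ip (rho a v) w = ip v (rho (pstar a) w).
Proof. by case: hrho. Qed.
Let rho_linear a : linear (rho a).
Proof. by case: hrho => /(_ a)[]. Qed.

Lemma rho_v0 a : rho a 0 = 0.
Proof. by have := rho_linear a (-1) 0 0; rewrite scaler0 addr0 scaleN1r addNr. Qed.
Lemma rho_vZ a c v : rho a (c *: v) = c *: rho a v.
Proof. by have := rho_linear a c v 0; rewrite !addr0 rho_v0 addr0. Qed.
Lemma rho0 v : rho 0 v = 0.
Proof. by have := rho_lin (-1) 0 0 v; rewrite scaler0 addr0 scaleN1r addNr. Qed.
Lemma rhoZ c a v : rho (c *: a) v = c *: rho a v.
Proof. by have := rho_lin c a 0 v; rewrite rho0 !addr0. Qed.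
Lemma rhoD a b v : rho (a + b) v = rho a v + rho b v.
Proof. by have := rho_lin 1 a b v; rewrite !scale1r. Qed.

Lemma lattice_cond (n k : int) :
  [&& (lv n, mv n k).1 - `|N| \is a Num.nat,
      (lv n, mv n k).2 + (lv n, mv n k).1 \is a Num.nat &
      (lv n, mv n k).2 <= (lv n, mv n k).1] = inL n k.
Proof.
rewrite /= /mval subrK [lv n - _]addrC /lval addKr /in_lattice !natrEint !intr_int !ler0z /=.
congr [&& _, _ & _]; rewrite lerBlDr -(ler_int R) intrD intrM /=.
by congr (_ <= _); rewrite -[p%:~R]/(p%:R) pN; ring.
Qed.

Definition kv (b : bool) (n k : int) : H := ket0 ket b (lv n) (mv n k).

Lemma kv_in b n k (h : inL n k) : exists i : lm_index N,
  val i = (lv n, mv n k) /\ kv b n k = ket (b, i).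
Proof.
rewrite /kv /ket0; case: insubP => [i _ e|]; first by exists i.
by rewrite lattice_cond h.
Qed.

Lemma kv_out b n k : ~~ inL n k -> kv b n k = 0.
Proof.
move=> h; rewrite /kv /ket0; case: insubP => // i; by rewrite lattice_cond (negbTE h).
Qed.

Lemma lv_inj : injective lv.
Proof. by move=> n n' /addrI/(@intr_inj R). Qed.

Lemma mv_inj n : injective (mv n).
Proof. by move=> k k' /addIr/(@intr_inj R). Qed.

Lemma kv_ip b b' n k n' k' : inL n k -> inL n' k' ->
  ip (kv b n k) (kv b' n' k') = ((b == b') && (n == n') && (k == k'))%:R.
Proof.
move=> h h'; have [i [ei ->]] := kv_in b h; have [i' [ei' ->]] := kv_in b' h'.
case: hket => -> _; congr (_%:R); rewrite xpair_eqE -andbA; congr (_ && _).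
rewrite -val_eqE; rewrite [val i]ei [val i']ei' xpair_eqE.
rewrite (inj_eq lv_inj); case: eqP => //= ->; by rewrite (inj_eq (@mv_inj _)).
Qed.

Let qt_neq0 : q * qnum q 2 != 0.
Proof.
by rewrite mulf_neq0 ?gt_eqF // qnum2 // addr_gt0 // invr_gt0.
Qed.

Lemma rho_A v : rho A v =
  ((q * qnum q 2)^-1)%:C *: ((1 - s ^+ 2)%:C *: v - rho (x_0 q s) v).
Proof.
have -> : rho (x_0 q s) v = (1 - s ^+ 2)%:C *: v - (q * qnum q 2)%:C *: rho A v.
  rewrite /x_0 -scaleN1r rhoD !rhoZ rho1 scaleN1r //.
rewrite opprB addrC subrK scalerA -rmorphM /= mulVf // scale1r //.
Qed.

Local Notation ea b := (entry_a q s `|N| (signed N b) p).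
Local Notation eb b := (entry_b q s `|N| (signed N b) p).

(** The element [x_0] preserves [m], so all three vectors lie on one line [n - k] constant. The
    formula holds for all integers, because [kv] is 0 off the lattice and the entries vanish on
    links that leave it. *)
Lemma rho_A_kv b n k : rho A (kv b n k) =
  (ea b (n + 1) (k + 1))%:C *: kv b (n + 1) (k + 1) + (eb b n k)%:C *: kv b n k
  + (ea b n k)%:C *: kv b (n - 1) (k - 1).
Proof.
have e1 : inL n k = [&& 0 < n + 1, 0 < k + 1 & k + 1 < 2 * (n + 1) + p%:Z].
  by rewrite /in_lattice; clear; lia.
have e2 : inL (n - 1) (k - 1) = [&& 0 < n, 0 < k & k < 2 * n + p%:Z].
  by rewrite /in_lattice; clear; lia.
case: (boolP (inL n k)) => h; last first.
  rewrite (kv_out _ h) rho_v0 /entry_b (negbTE h) scaler0 addr0.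
  rewrite {1}/entry_a -e1 (negbTE h) scale0r add0r.
  case: (boolP (inL (n - 1) (k - 1))) => h2; last by rewrite (kv_out _ h2) scaler0.
  by case/negP: h; move: h2; rewrite /in_lattice; clear; lia.
have [i [ei ek]] := kv_in b h.
have [_] := hrho_ket b i; rewrite -ek [val i]ei /= => e.
rewrite rho_A e {e}.
have lD : lv n + 1 = lv (n + 1) by rewrite /lval intrD; ring.
have mD : mv n k = mv (n + 1) (k + 1) by rewrite /mval /lval !intrD; ring.
have lB : lv n - 1 = lv (n - 1) by rewrite /lval intrB; ring.
have mB : mv n k = mv (n - 1) (k - 1) by rewrite /mval /lval !intrB; ring.
rewrite lB -[ket0 _ _ (lv n) _]/(kv b n k).
have -> : ket0 ket b (lv n + 1) (mv n k) = kv b (n + 1) (k + 1) by rewrite /kv -mD lD.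
have -> : ket0 ket b (lv (n - 1)) (mv n k) = kv b (n - 1) (k - 1) by rewrite /kv -mB.
have -> : ea b (n + 1) (k + 1) = - (q * qnum q 2)^-1 * (q `^ mv n k * Num.sqrt
    (qnum q 2 * qnum q (lv n - mv n k + 1) * qnum q (lv n + mv n k + 1))
      * alpha q s (signed N b) (lv n + 1)).
  by rewrite /entry_a -e1 h -mD -lD [lv n + 1 - _]addrAC [lv n + 1 + _]addrAC.
have -> : (ea b n k)%:C *: kv b (n - 1) (k - 1) = (- (q * qnum q 2)^-1 * (q `^ mv n k *
    Num.sqrt (qnum q 2 * qnum q (lv n - mv n k) * qnum q (lv n + mv n k)) *
      alpha q s (signed N b) (lv n)))%:C *: kv b (n - 1) (k - 1).
  case: (boolP (inL (n - 1) (k - 1))) => h2; last by rewrite (kv_out _ h2) !scaler0.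
  by rewrite /entry_a -e2 h2.
rewrite /entry_b h; set c := 1 - s ^+ 2.
move: (q `^ mv n k * _ * _) (q `^ mv n k * _ * _) (_ * beta _ _ _ _) => x z y.
move: (q * qnum q 2)^-1 (kv _ _ _) (kv _ _ _) (kv _ _ _) => w u1 u2 u3.
rewrite scalerBr !scalerDr !scalerA -!rmorphM !mulNr !rmorphN !scaleNr.
rewrite mulrBl rmorphB scalerBl [w * c]mulrC [w * y]mulrC.
by rewrite !opprD !addrA [_ *: u3 - _]addrC.
Qed.

Lemma rho_A_sym v w : ip (rho A v) w = ip v (rho A w).
Proof. by rewrite rho_adj pstar_podA. Qed.

Lemma ip_realZr (c : R) v w : ip v (c%:C *: w) = c%:C * ip v w.
Proof. by rewrite linearZr_LR /= conj_realC. Qed.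

Lemma ipDr v w w' : ip v (w + w') = ip v w + ip v w'.
Proof. by rewrite linearDr. Qed.

Lemma lattice_up n k : inL n k -> inL (n + 1) (k + 1).
Proof. by rewrite /in_lattice; clear; lia. Qed.

Lemma entry_a_out b n k : ~~ inL (n - 1) (k - 1) -> ea b n k = 0.
Proof.
move=> h; rewrite /entry_a (_ : [&& _, _ & _] = false) //.
by move: h; rewrite /in_lattice; clear; lia.
Qed.

(** As [A] is symmetric, one factor can be moved to the right-hand vector, where [rho_A_kv] yields
    the recursion of [jac]. From a lattice point only the lower neighbour can leave the lattice, and
    then its entry is 0. *)
Lemma rho_AX_jac j b n k i : inL n k ->
  ip (rho (A ^+ j) (kv b n k)) (kv b (n + i) (k + i)) =
  (jac (ea b) (eb b) j i n k)%:C * (inL (n + i) (k + i))%:R.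
Proof.
move=> h; elim: j i => [|j IH] i /=.
  rewrite expr0 rho1; case: (boolP (inL (n + i) (k + i))) => h'; last first.
    by rewrite (kv_out _ h') linear0r mulr0.
  rewrite kv_ip // eqxx mulr1 /= -{1}[n]addr0 -{1}[k]addr0.
  by rewrite !(inj_eq (addrI _)) andbb [0 == i]eq_sym; case: (i == 0).
rewrite exprS rhoM rho_A_sym; case: (boolP (inL (n + i) (k + i))) => h'; last first.
  by rewrite (kv_out _ h') rho_v0 linear0r mulr0.
rewrite mulr1 rho_A_kv !ipDr !ip_realZr.
have e3 : ip (rho (A ^+ j) (kv b n k)) (kv b (n + i + 1) (k + i + 1)) =
    (jac (ea b) (eb b) j (i + 1) n k)%:C.
  by rewrite -[n + i + 1]addrA -[k + i + 1]addrA IH !addrA (lattice_up h') mulr1.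
have e4 : (ea b (n + i) (k + i))%:C *
     ip (rho (A ^+ j) (kv b n k)) (kv b (n + i - 1) (k + i - 1)) =
    (ea b (n + i) (k + i))%:C * (jac (ea b) (eb b) j (i - 1) n k)%:C.
  case: (boolP (inL (n + i - 1) (k + i - 1))) => h2.
    by rewrite -[n + i - 1]addrA -[k + i - 1]addrA IH !addrA h2 mulr1.
  by rewrite (entry_a_out _ h2) !mul0r.
by rewrite e3 e4 IH h' mulr1 !rmorphD !rmorphM.
Qed.

Lemma rho_AX_diag j b n k : inL n k ->
  ip (rho (A ^+ j) (kv b n k)) (kv b n k) = (jac (ea b) (eb b) j 0 n k)%:C.
Proof. by move=> h; have := rho_AX_jac j b 0 h; rewrite !addr0 h mulr1. Qed.

(** The span of the basis vectors with second label [mu]. Generating it by [ket0] covers the zero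
    terms of the representation formulas without case distinctions. *)
Inductive weight mu : H -> Prop :=
| weight_lin c v w : weight mu v -> weight mu w -> weight mu (c *: v + w)
| weight0 : weight mu 0
| weight_ket0 b l : weight mu (ket0 ket b l mu).

Lemma weightZ mu c v : weight mu v -> weight mu (c *: v).
Proof. by move=> hv; rewrite -[_ *: _]addr0; apply: weight_lin => //; exact: weight0. Qed.

Lemma weightD mu v w : weight mu v -> weight mu w -> weight mu (v + w).
Proof. by move=> hv hw; rewrite -[v]scale1r; exact: weight_lin. Qed.

Lemma weightN mu v : weight mu v -> weight mu (- v).
Proof. by rewrite -scaleN1r; exact: weightZ. Qed.

Lemma weight_rho mu mu' a : (forall b l, weight mu' (rho a (ket0 ket b l mu))) ->
  forall v, weight mu v -> weight mu' (rho a v).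
Proof.
move=> h v; elim=> [c x y _ hx _ hy||//]; last by rewrite rho_v0; exact: weight0.
by rewrite rho_linear; exact: weight_lin.
Qed.

Lemma ket0P b l m : ket0 ket b l m = 0 \/
  exists i : lm_index N, val i = (l, m) /\ ket0 ket b l m = ket (b, i).
Proof. by rewrite /ket0; case: insubP => [i _ e|_]; [right; exists i|left]. Qed.

Lemma weight_ket b i : weight (val i).2 (ket (b, i)).
Proof.
have := @weight_ket0 (val i).2 b (val i).1; rewrite /ket0; case: insubP => [j _ ej|].
  by rewrite (_ : j = i) //; apply: val_inj; rewrite ej; case: (val i).
by case/negP; have := valP i; case: (val i).
Qed.

Lemma weight_A mu v : weight mu v -> weight mu (rho A v).
Proof.
apply: weight_rho => b l; case: (ket0P b l mu) => [->|[i [ei ->]]].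
  by rewrite rho_v0; exact: weight0.
have ek : weight mu (ket (b, i)) by have := weight_ket b i; rewrite ei.
rewrite rho_A; apply/weightZ/weightD; first exact: weightZ.
have [_ ->] := hrho_ket b i; rewrite ei /=.
by apply: weightN; apply: weightD; [apply: weightD|]; apply: weightZ; exact: weight_ket0.
Qed.

Lemma weight_B mu v : weight mu v -> weight (mu + 1) (rho B v).
Proof.
apply: weight_rho => b l; case: (ket0P b l mu) => [->|[i [ei ->]]].
  by rewrite rho_v0; exact: weight0.
have c0 : (Num.sqrt (q * qnum q 2))%:C != 0 :> R[i].
  rewrite eq_complex /= eqxx andbT gt_eqF // sqrtr_gt0 mulr_gt0 // qnum2 //.
  by rewrite addr_gt0 // invr_gt0.
have -> : rho B (ket (b, i)) = ((Num.sqrt (q * qnum q 2))%:C)^-1 *: rho (x_1 q s) (ket (b, i)).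
  by rewrite /x_1 rhoZ scalerA mulVf // scale1r.
apply: weightZ; have [-> _] := hrho_ket b i; rewrite ei /=.
apply: weightD; last by apply/weightN/weightZ; exact: weight_ket0.
apply: weightD; last by apply/weightN/weightZ; exact: weight_ket0.
by apply: weightZ; exact: weight_ket0.
Qed.

Lemma weight_ip mu v (b : bool) (i : lm_index N) : weight mu v -> (val i).2 != mu ->
  ip v (ket (b, i)) = 0.
Proof.
move=> hv im; elim: hv => [c x y _ hx _ hy||b' l].
- by rewrite linearDl linearZl_LR /= hx hy mulr0 addr0.
- by rewrite linear0l.
case: (ket0P b' l mu) => [->|[i' [ei ->]]]; first by rewrite linear0l.
case: hket => -> _; rewrite xpair_eqE; case: eqP => //= _; case: eqP => // e.
by move: im; rewrite -e ei eqxx.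
Qed.

Lemma diag_AB j k (b : bool) (i : lm_index N) : (0 < k)%N ->
  ip (rho (A ^+ j * B ^+ k) (ket (b, i))) (ket (b, i)) = 0.
Proof.
move=> k0; apply: (@weight_ip ((val i).2 + k%:R)); last first.
  by rewrite -subr_eq0 opprD addNKr oppr_eq0 pnatr_eq0 -lt0n.
have hi := weight_ket b i.
rewrite rhoM; elim: j => [|j IH]; last by rewrite exprS rhoM; exact: weight_A.
rewrite expr0 rho1; elim: {k0}k => [|k IH]; first by rewrite expr0 rho1 addr0.
by rewrite exprS rhoM -natr1 addrA; exact: weight_B.
Qed.

Lemma pstarX (a : podles q s) k : pstar (a ^+ k) = pstar a ^+ k.
Proof.
elim: k => [|k IH].
  rewrite !expr0; have := pi_TCst q s 1; rewrite scale1r => e.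
  by rewrite -e pstarE /= conjC1.
by rewrite exprS exprSr pstarM IH.
Qed.

(** The representation formulas give [B] on the basis and not its adjoint, so the entry is
    conjugated first, which leads to [B ^ k * A ^ j]. *)
Lemma diag_ABs j k (b : bool) (i : lm_index N) : (0 < k)%N ->
  ip (rho (A ^+ j * Bs ^+ k) (ket (b, i))) (ket (b, i)) = 0.
Proof.
move=> k0; rewrite rho_adj pstarM !pstarX pstarK pstar_podA.
rewrite hermC /= expr0 mul1r.
suff -> : ip (rho (B ^+ k * A ^+ j) (ket (b, i))) (ket (b, i)) = 0 by rewrite conjC0.
apply: (@weight_ip ((val i).2 + k%:R)); last first.
  by rewrite -subr_eq0 opprD addNKr oppr_eq0 pnatr_eq0 -lt0n.
have hi := weight_ket b i.
rewrite rhoM; elim: {k0}k => [|k IH].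
  rewrite expr0 rho1 addr0; elim: j => [|j IH]; first by rewrite expr0 rho1.
  by rewrite exprS rhoM; exact: weight_A.
by rewrite exprS rhoM -natr1 addrA; exact: weight_B.
Qed.

Definition level_trace a n : R[i] :=
  \sum_(0 <= k < n.*2 + p.+1)
     (ip (rho a (kv true n%:Z k%:Z)) (kv true n%:Z k%:Z)
      + ip (rho a (kv false n%:Z k%:Z)) (kv false n%:Z k%:Z)).

Lemma level_trace_lin c a b n :
  level_trace (c *: a + b) n = c * level_trace a n + level_trace b n.
Proof.
rewrite /level_trace mulr_sumr -big_split; apply: eq_bigr => k _ /=.
by rewrite !rho_lin !linearDl !linearZl_LR /= mulrDr addrACA.
Qed.

Lemma level_lattice (n k : nat) : (k < n.*2 + p.+1)%N -> inL n%:Z k%:Z.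
Proof. by rewrite /in_lattice; clear; lia. Qed.

Lemma level_trace0 a :
  (forall b i, ip (rho a (ket (b, i))) (ket (b, i)) = 0) ->
  forall n, level_trace a n = 0.
Proof.
move=> h n; rewrite /level_trace big_nat big1 // => k /andP[_ kn].
have [i [_ ->]] := kv_in true (level_lattice kn).
have [i' [_ ->]] := kv_in false (level_lattice kn).
by rewrite !h addr0.
Qed.

Definition level_asymptotics a := exists c0 c1 eps, rapid eps /\
  (forall n : nat, level_trace a n = 4 * c0 * n.+1%:R + c1 + eps n) /\
  cmean (circle_symbol a) c0.

Lemma level_asymptotics_lin : lin_closed level_asymptotics.
Proof.
move=> c a b [a0 [a1 [ea [ra [ha sa]]]]] [b0 [b1 [eb [rb [hb sb]]]]].
exists (c * a0 + b0), (c * a1 + b1), (fun n => c * ea n + eb n); split.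
  by apply: rapidD => //; exact: rapidZ.
split=> [n|]; first by rewrite level_trace_lin ha hb; ring.
by rewrite circle_symbolD circle_symbolZ; exact: cmean_lin.
Qed.

Lemma level_asymptotics0 a :
  (forall b i, ip (rho a (ket (b, i))) (ket (b, i)) = 0) ->
  cmean (circle_symbol a) 0 -> level_asymptotics a.
Proof.
move=> h ca; exists 0, 0, (fun=> 0); split; first exact: rapid0; split=> // n.
by rewrite level_trace0 // mulr0 mul0r !addr0.
Qed.

Lemma circle_symbolX (a : podles q s) k :
  circle_symbol (a ^+ k) = fun x => circle_symbol a x ^+ k.
Proof.
elim: k => [|k IH]; first by rewrite expr0 circle_symbol1.
by rewrite exprS circle_symbolM IH; apply/funext => x; rewrite exprS.
Qed.

Lemma circle_symbol_AX j (a : podles q s) : (0 < j)%N ->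
  circle_symbol (A ^+ j * a) = fun=> 0.
Proof.
move=> j0; rewrite circle_symbolM circle_symbolX circle_symbolA.
by apply/funext => x; rewrite expr0n eqn0Ngt j0 mul0r.
Qed.

Lemma level_asymptotics1 : level_asymptotics 1.
Proof.
(* Level [n] has [2 (2 n + p + 1) = 4 (n + 1) + 2 p - 2] basis vectors, counting both signs of
   [N]. *)
exists 1, (2 * p%:R - 2), (fun=> 0); split; first exact: rapid0; split; last first.
  by rewrite circle_symbol1; exact: cmean_cst.
move=> n; rewrite /level_trace (eq_big_nat _ _ (F2 := fun=> 2)).
  rewrite sumr_const_nat subn0 -[2 *+ _]mulr_natr (natrD _ n.*2 p.+1) -muln2 natrM.
  by rewrite -[p.+1%:R]natr1 -[n.+1%:R]natr1; ring.
by move=> k /andP[_ /level_lattice h]; rewrite !rho1 !kv_ip ?eqxx.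
Qed.

Lemma level_asymptotics_AX j : (0 < j)%N -> level_asymptotics (A ^+ j).
Proof.
move=> j0.
have hs b : `|signed N b| = `|N| by case: b => //=; rewrite normrN.
have key b : exists c eps, rapid eps /\ forall n : nat,
   \sum_(0 <= k < n.*2 + p.+1) ip (rho (A ^+ j) (kv b n%:Z k%:Z)) (kv b n%:Z k%:Z)
   = c + eps n.
  have [g [hg /(_ j0) dg]] := jac_conv q01 j
    (entry_a_conv q01 s01 nu0 pN (hs b))
    (entry_b_conv q01 (signed N b) s01 nu0 pN) (lim_a_decays q01 s01)
    (lim_b_decays q01 s01) 0.
  have [c [eps [re he]]] := level_sum_conv q01 p hg dg.
  exists c%:C, eps; split=> // n; rewrite -he; apply: eq_big_nat => k /andP[_ kn].
  by rewrite rho_AX_diag // level_lattice.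
have [c [eps [re he]]] := key true; have [c' [eps' [re' he']]] := key false.
exists 0, (c + c'), (fun n => eps n + eps' n); split; first exact: rapidD.
split=> [n|]; last first.
  by rewrite -[A ^+ j]mulr1 circle_symbol_AX //; exact: cmean_cst.
by rewrite /level_trace big_split /= he he'; ring.
Qed.

Lemma level_asymptotics_all a : level_asymptotics a.
Proof.
have q0' : q != 0 by rewrite gt_eqF.
apply: (podles_span q0' a); first exact: level_asymptotics_lin.
- move=> j [|k]; rewrite ?expr0 ?mulr1.
    by case: j => [|j]; [rewrite expr0; exact: level_asymptotics1|exact: level_asymptotics_AX].
  apply: level_asymptotics0 => [b i|]; first exact: diag_AB.
  case: j => [|j]; last by rewrite circle_symbol_AX //; exact: cmean_cst.
  rewrite expr0 mul1r circle_symbolX circle_symbolB.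
  have := @cmean_uX R (s%:C ^+ k.+1) k.+1 isT.
  by congr cmean; apply/funext => x; rewrite exprMn.
- move=> j [|k]; rewrite ?expr0 ?mulr1.
    by case: j => [|j]; [rewrite expr0; exact: level_asymptotics1|exact: level_asymptotics_AX].
  apply: level_asymptotics0 => [b i|]; first exact: diag_ABs.
  case: j => [|j]; last by rewrite circle_symbol_AX //; exact: cmean_cst.
  rewrite expr0 mul1r -pstarX circle_symbol_star circle_symbolX circle_symbolB.
  have := cmean_conj (@cmean_uX R (s%:C ^+ k.+1) k.+1 isT); rewrite conjC0.
  by congr cmean; apply/funext => x; rewrite exprMn.
Qed.

Variables (dom : set H) (D : H -> H).
Hypothesis hD : self_adjoint ip dom D.
Hypothesis hD_ket : dirac_formula ket dom D.

(** [D] is given as a bare function on a set; homogeneity of [D] and of its domain is drawn from the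
    adjoint clause of self-adjointness. *)
Lemma dirac_sqr_ket b (i : lm_index N) (mu := (val i).1 - `|N| + 1) :
  dom (D (ket (b, i))) /\ D (D (ket (b, i))) = (mu ^+ 2)%:C *: ket (b, i).
Proof.
have [d1 e1] := hD_ket b i; have [d2 e2] := hD_ket (~~ b) i; case: hD => _ hs.
rewrite e1 -/mu; apply/hs => x dx; rewrite !ip_realZr.
have /hs/(_ x dx) -> : dom (ket (~~ b, i)) /\ D (ket (~~ b, i)) = mu%:C *: ket (b, i).
  by rewrite e2 negbK.
by rewrite ip_realZr mulrA -rmorphM.
Qed.

Lemma level_ge0 (i : lm_index N) : 0 <= (val i).1 - `|N|.
Proof. by case/and3P: (valP i) => /natr_ge0. Qed.

Lemma abs_power_ket z P b (i : lm_index N) : is_abs_power ip dom D z P ->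
  P (ket (b, i)) = cpow ((val i).1 - `|N| + 1) z *: ket (b, i).
Proof.
move=> [_ h]; have [d1 _] := hD_ket b i; have [d2 e2] := dirac_sqr_ket b i.
by apply: h => //; rewrite ltr_wpDl ?level_ge0.
Qed.

Lemma cpow_npw (n : nat) z : cpow (n%:R + 1) (- z) = npw n z :> R[i].
Proof.
by rewrite /cpow /npw /cexp natr1 ReM ImM /= ReN ImN; congr (_%:C * circle_u _);
  [congr expR|]; ring.
Qed.

(** Cauchy-Schwarz, from the nonnegative square norm of [v - t *: e], the part of [v] orthogonal to
    the unit vector [e]. The constant works because [|t| ^ 2 <= c] implies [|t| <= |c| + 1]. *)
Lemma diag_bounded a : exists K, forall b i,
  nrm (ip (rho a (ket (b, i))) (ket (b, i))) <= K.
Proof.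
case: hrho => /(_ a)[_ [c hc]] _ _ _ _; exists (`|c| + 1) => b i.
have ee : ip (ket (b, i)) (ket (b, i)) = 1 by case: hket => -> _; rewrite eqxx.
set v := rho a _; set e := ket _; set t := ip v e.
have h1 : ip v v <= c%:C by have := hc e; rewrite ee mulr1.
have h2 : 0 <= ip (v - t *: e) (v - t *: e) by exact: dnorm_ge0.
have h3 : ip (v - t *: e) (v - t *: e) = ip v v - (nrm t ^+ 2)%:C.
  rewrite linearBl !linearBr /= !linearZl_LR !linearZr_LR /= -/e ee.
  rewrite [ip e v]hermC /= expr0 mul1r -/t mulr1.
  have -> : (nrm t ^+ 2)%:C = t * t^* :> R[i].
    by rewrite rmorphXn /= -nrmE sqr_normc.
  by rewrite -[_ *: t]/(_ * t); ring.
move: h2; rewrite h3 subr_ge0 => /le_trans/(_ h1); rewrite lecR => h4.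
have := nrm_ge0 t; have := ler_norm c; nra.
Qed.

Lemma lm_index0 : lm_index N.
Proof. by exists (`|N|, - `|N|); rewrite /= subrr addNr rpred0 lerNl ge0_cp. Qed.

Definition index_at (n k : nat) : lm_index N := insubd lm_index0 (lv n, mv n k).

Lemma val_index_at n k : (k < n.*2 + p.+1)%N -> val (index_at n k) = (lv n, mv n k).
Proof. by move=> kn; rewrite val_insubd lattice_cond level_lattice. Qed.

Lemma kv_index_at b n k : (k < n.*2 + p.+1)%N -> kv b n%:Z k%:Z = ket (b, index_at n k).
Proof.
move=> kn; have [i [ei ->]] := kv_in b (level_lattice kn).
by congr (ket (b, _)); apply: val_inj; rewrite val_index_at.
Qed.

Lemma index_atP (i : lm_index N) : exists n k : nat,
  (k < n.*2 + p.+1)%N /\ i = index_at n k.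
Proof.
have /and3P[/natrP[n hn] /natrP[k hk] hm] := valP i.
have kn : (k < n.*2 + p.+1)%N.
  rewrite addnS ltnS -(ler_nat R) natrD -muln2 natrM pN -hk -hn mulrBl.
  by move: hm; lra.
exists n, k; split => //; apply: val_inj; rewrite val_index_at // [LHS]surjective_pairing.
by rewrite /mval /lval -!pmulrn -hn -hk; congr (_, _); ring.
Qed.

Definition level (bi : bool * lm_index N) : nat := Num.truncn ((val bi.2).1 - `|N|).

Lemma level_index_at b n k : (k < n.*2 + p.+1)%N -> level (b, index_at n k) = n.
Proof. by move=> kn; rewrite /level val_index_at //= /lval addrC addKr natrK. Qed.

Definition level_seq n : seq (bool * lm_index N) :=
  [seq (true, index_at n k) | k <- iota 0 (n.*2 + p.+1)] ++
  [seq (false, index_at n k) | k <- iota 0 (n.*2 + p.+1)].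

Lemma mem_level_seq n bi : (bi \in level_seq n) = (level bi == n).
Proof.
case: bi => b i; have [m [k [km ->]]] := index_atP i; rewrite level_index_at //.
apply/idP/eqP => [|<-].
  rewrite mem_cat => /orP[] /mapP[k']; rewrite mem_iota => /andP[_ kn] e.
    by rewrite -(level_index_at b km) e level_index_at.
  by rewrite -(level_index_at b km) e level_index_at.
rewrite mem_cat; case: b; apply/orP; [left|right]; apply/mapP; exists k => //;
  by rewrite mem_iota.
Qed.

Lemma uniq_level_seq n : uniq (level_seq n).
Proof.
have inj (b : bool) : {in iota 0 (n.*2 + p.+1) &, injective (fun k => (b, index_at n k))}.
  move=> k k'; rewrite !mem_iota => /andP[_ hk] /andP[_ hk'] [] /(congr1 val).
  by rewrite !val_index_at // => -[] /mv_inj [].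
rewrite cat_uniq !map_inj_in_uniq ?iota_uniq ?andbT //=.
by apply/hasPn => _ /mapP[k _ ->]; apply/mapP => -[].
Qed.

Lemma sum_level_seq (V : zmodType) (f : bool * lm_index N -> V) n :
  \sum_(bi <- level_seq n) f bi =
  \sum_(0 <= k < n.*2 + p.+1) (f (true, index_at n k) + f (false, index_at n k)).
Proof. by rewrite big_cat !big_map big_split /index_iota subn0. Qed.

(** The diagonal entries of level [n] are at most [K (n + 1) ^ (- Re z)], and there are at most
    [(4 + 2 p) (n + 1)] of them; the sum over levels converges since [Re z - 1 > 1]. *)
Lemma has_trace_level a z P t : 2 < complex.Re z -> is_abs_power ip dom D (- z) P ->
  csum (fun n => level_trace a n * npw n z) t ->
  has_trace ip ket (fun v => rho a (P v)) t.
Proof.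
move=> z2 hP ht; have [K hK] := diag_bounded a.
have K0 : 0 <= K by apply: le_trans (hK true (index_at 0 0)); exact: nrm_ge0.
have diagE b n k : (k < n.*2 + p.+1)%N ->
    ip (rho a (P (ket (b, index_at n k)))) (ket (b, index_at n k)) =
    npw n z * ip (rho a (ket (b, index_at n k))) (ket (b, index_at n k)).
  move=> kn; rewrite (abs_power_ket _ _ hP) rho_vZ linearZl_LR /= val_index_at //=.
  by rewrite -cpow_npw /lval [_ + n%:~R]addrC addrK.
have x1 : 1 < complex.Re z - 1 by lra.
have [M hM] := rpw_summable x1.
apply: (@unordered_sum_to R _ level level_seq mem_level_seq uniq_level_seq _
  (fun bi => K * rpw (level bi) (complex.Re z)) t (K * ((4 + 2 * p%:R) * M))).
- case=> b i; have [n [k [kn ->]]] := index_atP i.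
  by rewrite diagE // level_index_at // nrmM nrm_npw mulrC ler_wpM2r ?rpw_ge0.
- move=> n; rewrite -mulr_sumr (sum_below level_seq) ler_wpM2l //.
  apply: le_trans (ler_wpM2l _ (hM n)); last by rewrite addr_ge0 // mulr_ge0.
  rewrite mulr_sumr; apply: ler_sum => m _; rewrite sum_level_seq.
  rewrite (eq_big_nat _ _ (F2 := fun=> 2 * rpw m (complex.Re z))); last first.
    by move=> k /andP[_ km]; rewrite !level_index_at //; ring.
  rewrite sumr_const_nat subn0 -[leLHS]mulr_natr.
  have -> : rpw m (complex.Re z) = rpw m (complex.Re z - 1) / m.+1%:R.
    by rewrite -[in LHS](subrK 1 (complex.Re z)) rpwD (rpw_nat _ m 1).
  have key : 2 * (m.*2 + p.+1)%:R <= (4 + 2 * p%:R) * m.+1%:R :> R.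
    rewrite -muln2 (natrD _ (m * 2) p.+1) natrM -[m.+1%:R]natr1 -[p.+1%:R]natr1.
    have : 0 <= p%:R :> R by []. have : 0 <= m%:R :> R by [].
    by move: (m%:R) (p%:R) => y w y0 w0; nra.
  have r0 := rpw_ge0 m (complex.Re z - 1).
  by rewrite mulrA mulrAC ler_pdivrMr // mulrAC [leRHS]mulrAC ler_wpM2r.
- move: ht; congr csum; apply/funext => n; rewrite sum_level_seq /level_trace mulr_suml.
  apply: eq_big_nat => k /andP[_ kn]; rewrite !diagE // !kv_index_at //; ring.
Qed.

End Lattice.

Lemma circle_symbol_cst0 (R : realType) (q : R) (a : podles q 0) :
  exists c, forall theta, circle_symbol a theta = c.
Proof.
rewrite /circle_symbol; elim: (repr a) => [||| c|x [c hc] y [d hd]|x [c hc] y [d hd]] /=.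
- by exists 0.
- by exists 0 => theta; rewrite mul0r.
- by exists 0 => theta; rewrite mul0r.
- by exists c.
- by exists (c + d) => theta; rewrite hc hd.
- by exists (c * d) => theta; rewrite hc hd.
Qed.

Theorem proposition3p14 (R : realType) (q s N : R)
  (hq : 0 < q < 1) (hs : 0 <= s <= 1)
  (hN : 2 * N \is a Num.int) (hN0 : N != 0)
  (H : lmodType R[i]) (ip : {dot H for Num.conj}) (hH : dot_complete ip)
  (ket : bool * lm_index N -> H) (hket : orthonormal_basis ip ket)
  (rho : podles q s -> H -> H) (hrho : star_rep ip rho)
  (hrho_ket : rep_formulas ket rho)
  (dom : set H) (D : H -> H) (hD : self_adjoint ip dom D)
  (hD_ket : dirac_formula ket dom D)
  (absDpow : R[i] -> H -> H)
  (habsD : forall z, complex.Re z <= 0 -> is_abs_power ip dom D z (absDpow z))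
  (a : podles q s) :
  (exists F, zeta_extension ip ket rho absDpow a F) /\
  (forall F, zeta_extension ip ket rho absDpow a F ->
     is_residue F 2
       ((2 / pi)%:C * circle_integral (circle_symbol a))) /\
  (s = 0 -> exists c : R[i],
     (forall theta, circle_symbol a theta = c) /\
     (2 / pi)%:C * circle_integral (circle_symbol a) = 4 * c).
Proof.
have [p pN] : exists p : nat, p%:R = 2 * `|N|.
  have /natrP[p hp] : 2 * `|N| \is a Num.nat.
    by rewrite -[2](@ger0_norm R) // -normrM natr_norm_int.
  by exists p.
(* A function of mean [c] has integral [2 pi c] over the circle, and [2 / pi * (2 pi) = 4]. *)
have residueE f c : cmean f c -> (2 / pi)%:C * circle_integral f = 4 * c :> R[i].
  move=> /cmean_integral ->; rewrite mulrA -rmorphM /=; congr (_ * _).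
  rewrite (_ : 2 / pi * (2 * pi) = 4 :> R); first by rewrite -[RHS](rmorph_nat (real_complex R)).
  have pi0 : pi != 0 :> R by rewrite gt_eqF // pi_gt0.
  by rewrite mulrCA divfK //; ring.
have [c0 [c1 [eps [reps [htau hmean]]]]] :=
  level_asymptotics_all hq hs hN0 pN hket hrho hrho_ket a.
have trF z : 2 < complex.Re z ->
    has_trace ip ket (fun v => rho a (absDpow (- z) v)) (zext (4 * c0) c1 eps z).
  move=> z2; have := csum_zext (4 * c0) c1 reps z2.
  have hP : is_abs_power ip dom D (- z) (absDpow (- z)).
    by apply: habsD; rewrite ReN; lra.
  move=> h; apply: (has_trace_level pN hket hrho hD hD_ket z2 hP).
  by move: h; congr csum; apply/funext => n; rewrite htau.
split; [|split].
- exists (zext (4 * c0) c1 eps); split => //; exact: zext_meromorphic.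
- move=> F [mF tF]; rewrite (residueE _ _ hmean); apply: (dirichlet_residue reps mF).
  move=> z z2.
  (* Uniqueness of unordered sums identifies any extension with [zext] on the half-plane [Re z > 2],
     and its values there determine the residue. *)
  have totF := @summability.totally_filter (bool * lm_index N)%type.
  exact: (cvg_unique (@norm_hausdorff _ _) (tF z z2) (trF z z2)).
- move=> s0; subst s; have [c hc] := circle_symbol_cst0 a; exists c; split=> //.
  apply: residueE; rewrite (_ : circle_symbol a = fun=> c); last exact/funext.
  exact: cmean_cst.
Qed.
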